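(* The mapping $\Phi:\mathcal{A}\to H^1(\Omega)\cap C^{0,\mu}(\bar\Omega)$, $\Phi(u)=\varphi_u$, is of class $C^1$, and for all $u\in\mathcal{A}$ and $v\in L^2(\Omega)$ the function $\eta_{u,v}=\Phi'(u)v$ is the unique solution of $$A^*\eta+\frac{\partial a}{\partial y}(x,y_u)\eta+u\eta=\Big[\frac{\partial^2L}{\partial y^2}(x,y_u)-\varphi_u\frac{\partial^2a}{\partial y^2}(x,y_u)\Big]z_{u,v}-v\varphi_u\ \text{ in }\Omega,\qquad\partial_{n_{A^*}}\eta=0\ \text{ on }\Gamma,$$ where $z_{u,v}=G'(u)v$.
   Context: $\Omega\subset\mathbb{R}^d$, $d\in\{2,3\}$, is a bounded open connected set with Lipschitz boundary $\Gamma$. Operator: $Ay=-\sum_{i,j=1}^d\partial_{x_j}[a_{ij}(x)\partial_{x_i}y]$ with $a_{ij}\in L^\infty(\Omega)$ and, for some $M_A,\Lambda_A>0$, $M_A|\xi|^2\ge\sum_{i,j}a_{ij}(x)\xi_i\xi_j\ge\Lambda_A|\xi|^2$ for a.a. $x\in\Omega$ and all $\xi\in\mathbb{R}^d$; $\partial_{n_A}y=\sum_{i,j}a_{ij}\partial_{x_i}y\,n_j$ with $n$ the outward unit normal. $A^*$ and $\partial_{n_{A^*}}$ are defined in the same way with $a_{ji}$ in place of $a_{ij}$. Equations are understood in the weak $H^1(\Omega)$ sense. Nonlinearity: $a:\Omega\times\mathbb{R}\to\mathbb{R}$ is a Carathéodory function, of class $C^2$ in the second variable, such that for a.a. $x\in\Omega$: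 $a(\cdot,0)\in L^p(\Omega)$ for some $p>d/2$; $\frac{\partial a}{\partial y}(x,y)\ge a_0$ for all $y\in\mathbb{R}$, for some constant $a_0\ge0$; for every $M>0$ there is $C_{a,M}$ with $\sum_{j=1}^2|\frac{\partial^ja}{\partial y^j}(x,y)|\le C_{a,M}$ for all $|y|\le M$; for every $\varepsilon>0$ and $M>0$ there is $\rho>0$ with $|\frac{\partial^2a}{\partial y^2}(x,y_1)-\frac{\partial^2a}{\partial y^2}(x,y_2)|\le\varepsilon$ for all $|y_1|,|y_2|\le M$ with $|y_1-y_2|\le\rho$. Boundary datum: $g\in L^q(\Gamma)$, $q>d-1$. Cost integrand: $L:\Omega\times\mathbb{R}\to\mathbb{R}$ is Carathéodory, of class $C^2$ in the second variable, and for a.a. $x$: $L(\cdot,0)\in L^1(\Omega)$; for all $M>0$ there is $L_M\in L^p(\Omega)$ with $|\frac{\partial L}{\partial y}(x,y)|\le L_M(x)$ for $|y|\le M$; for all $M>0$ there is $C_{L,M}\in\mathbb{R}$ with $|\frac{\partial^2L}{\partial y^2}(x,y)|\le C_{L,M}$ for $|y|\le M$; for all $\varepsilon,M>0$ there is $\rho>0$ with $|\frac{\partial^2L}{\partial y^2}(x,y_1)-\frac{\partial^2L}{\partial y^2}(x,y_2)|\le\varepsilon$ for $|y_1|,|y_2|\le M$, $|y_1-y_2|\le\rho$. Exponent $\mu$: $\mu\in(0,1]$ is a fixed Hölder exponent provided by known elliptic regularity theory, i.e. such that, for $B\in\{A,A^*\}$, every weak solution $y\in H^1(\Omega)$ of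 $By+y=f$ in $\Omega$, $\partial_{n_B}y=h$ on $\Gamma$, with $f\in L^{\min\{p,2\}}(\Omega)$, $h\in L^q(\Gamma)$, belongs to $C^{0,\mu}(\bar\Omega)$ with $\|y\|_{C^{0,\mu}(\bar\Omega)}\le C(\|f\|_{L^{\min\{p,2\}}(\Omega)}+\|h\|_{L^q(\Gamma)})$. The open set $\mathcal{A}$ and the map $G$: let $m_u=\operatorname{ess\,inf}_\Omega u$, $\Lambda_u=\min\{\Lambda_A,a_0+m_u\}$, $\mathcal{A}_0=\{u\in L^2(\Omega):a_0+m_u>0\}$, and $C_{4,\Omega}$ a constant with $\|y\|_{L^4(\Omega)}\le C_{4,\Omega}\|y\|_{H^1(\Omega)}$ for all $y\in H^1(\Omega)$. Then $\mathcal{A}=\bigcup_{\bar u\in\mathcal{A}_0}B_{\varepsilon_{\bar u}}(\bar u)$ (open balls in $L^2(\Omega)$), with radii $0<\varepsilon_{\bar u}<\Lambda_{\bar u}/C_{4,\Omega}^2$ chosen (this is possible) so that for every $u\in\mathcal{A}$ the state equation $Ay+a(x,y)+uy=0$ in $\Omega$, $\partial_{n_A}y=g$ on $\Gamma$, has a unique solution $y_u\in H^1(\Omega)\cap C^{0,\mu}(\bar\Omega)$ and $G:\mathcal{A}\to H^1(\Omega)\cap C^{0,\mu}(\bar\Omega)$, $G(u)=y_u$, is of class $C^2$. For $v\in L^2(\Omega)$, $z=z_{u,v}=G'(u)v$ is the unique solution of $Az+\frac{\partial a}{\partial y}(x,y_u)z+uz+vy_u=0$ in $\Omega$, $\partial_{n_A}z=0$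 on $\Gamma$. Adjoint state: for $u\in\mathcal{A}$, $\varphi_u\in H^1(\Omega)\cap C^{0,\mu}(\bar\Omega)$ is the unique solution of $A^*\varphi+\frac{\partial a}{\partial y}(x,y_u)\varphi+u\varphi=\frac{\partial L}{\partial y}(x,y_u)$ in $\Omega$, $\partial_{n_{A^*}}\varphi=0$ on $\Gamma$. *)

(* Defs.v *)
From HB Require Import structures.
From mathcomp Require Export all_boot all_order all_algebra.
From mathcomp Require Export all_classical all_reals all_analysis ess_sup_inf.
Export numFieldNormedType.Exports.

Set Implicit Arguments.
Unset Strict Implicit.
Unset Printing Implicit Defensive.
Import Order.TTheory GRing.Theory Num.Theory.

Local Open Scope classical_set_scope.
Local Open Scope ring_scope.

(* Copy of T on which every set is measurable, so that [mu_ext] is the infimum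
   over all countable covers by arbitrary sets. *)
Definition cover_type (T : Type) : Type := T.

Section cover_type.
Variable T : pointedType.
HB.instance Definition _ := Pointed.on (cover_type T).
HB.instance Definition _ := @isMeasurable.Build default_measure_display
  (cover_type T) setT I (fun _ _ => I) (fun _ _ => I).
End cover_type.

Section euclidean.
Context {R : realType} {d : nat}.
Implicit Types x y : 'rV[R]_d.

Definition dotv x y : R := \sum_i x 0 i * y 0 i.

(* The library norm of 'rV[R]_d is the sup norm. *)
Definition enorm x : R := Num.sqrt (dotv x x).

Definition box (a b : 'rV[R]_d) : set 'rV[R]_d :=
  [set x | forall i, a 0 i <= x 0 i <= b 0 i].

Definition diam (A : set 'rV[R]_d) : \bar R :=
  ereal_sup [set (enorm (x - y))%:E | x in A & y in A].

End euclidean.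

Section lebesgue.
Variables (R : realType) (d : nat).
Local Open Scope ereal_scope.

Definition box_gauge (A : set (cover_type 'rV[R]_d)) : \bar R :=
  if `[< A = set0 >] then 0 else
  ereal_inf [set v | exists a b : 'rV[R]_d,
    [/\ forall i, (a ord0 i <= b ord0 i)%R, A `<=` box a b
      & v = (\prod_i (b ord0 i - a ord0 i))%R%:E]].

Lemma box_gauge0 : box_gauge set0 = 0.
Proof. by rewrite /box_gauge; case: asboolP. Qed.

Lemma box_gauge_ge0 A : 0 <= box_gauge A.
Proof.
rewrite /box_gauge; case: asboolP => // _; apply: le_ereal_inf_tmp => _ [a [b [ab _ ->]]].
by rewrite lee_fin; apply: prodr_ge0 => i _; rewrite subr_ge0.
Qed.

(* Lebesgue outer measure: coverings by boxes. *)
Definition leb_ext : set 'rV[R]_d -> \bar R := mu_ext box_gauge.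

HB.instance Definition _ := isOuterMeasure.Build R 'rV[R]_d leb_ext
  (mu_ext0 box_gauge0 box_gauge_ge0) (mu_ext_ge0 box_gauge_ge0)
  (le_mu_ext box_gauge) (mu_ext_sigma_subadditive box_gauge_ge0).

Definition leb_outer : {outer_measure set 'rV[R]_d -> \bar R} := leb_ext.

Definition leb : {measure set (caratheodory_type leb_outer) -> \bar R} :=
  leb_outer.

End lebesgue.

Section hausdorff.
Variables (R : realType) (d s : nat).
Local Open Scope ereal_scope.

(* Volume of the s-dimensional ball of diameter 1, for s <= 2; it makes the
   measure below agree with length (s = 1) and surface area (s = 2). *)
Definition hausdorff_cst : R := (if s == 2%N then pi / 4 else 1)%R.

Definition hausdorff_gauge (delta : R) (A : set (cover_type 'rV[R]_d)) : \bar R :=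
  if `[< A = set0 >] then 0 else
  if diam A <= delta%:E then hausdorff_cst%:E * diam A ^+ s else +oo.

Lemma hausdorff_gauge0 delta : hausdorff_gauge delta set0 = 0.
Proof. by rewrite /hausdorff_gauge; case: asboolP. Qed.

Lemma hausdorff_gauge_ge0 delta A : 0 <= hausdorff_gauge delta A.
Proof.
rewrite /hausdorff_gauge; case: asboolP => // /eqP/set0P[x Ax].
case: ifP => // _; apply: mule_ge0.
  by rewrite lee_fin /hausdorff_cst; case: ifP => // _; rewrite divr_ge0 ?pi_ge0.
apply: expe_ge0; apply: ereal_sup_ubound; exists x => //; exists x => //.
by rewrite subrr /enorm /dotv big1 ?sqrtr0// => i _; rewrite mxE mul0r.
Qed.

Definition hausdorff_ext (A : set 'rV[R]_d) : \bar R :=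
  ereal_sup [set mu_ext (hausdorff_gauge delta) A | delta in [set e : R | (0 < e)%R]].

Lemma hausdorff_ext_ge0 A : 0 <= hausdorff_ext A.
Proof.
apply: le_trans (mu_ext_ge0 (hausdorff_gauge_ge0 1) A) _.
by apply: ereal_sup_ubound; exists 1%R => //=.
Qed.

Lemma hausdorff_ext0 : hausdorff_ext set0 = 0.
Proof.
apply/eqP; rewrite eq_le hausdorff_ext_ge0 andbT.
apply: ge_ereal_sup => _ [e _ <-].
by rewrite (mu_ext0 (hausdorff_gauge0 e) (hausdorff_gauge_ge0 e)).
Qed.

Lemma le_hausdorff_ext :
  {homo hausdorff_ext : A B / A `<=` B >-> A <= B}.
Proof.
move=> A B AB; apply: ge_ereal_sup => _ [e e0 <-].
apply: le_trans (le_mu_ext (hausdorff_gauge e) AB) _.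
by apply: ereal_sup_ubound; exists e.
Qed.

Lemma hausdorff_ext_sigma_subadditive : sigma_subadditive hausdorff_ext.
Proof.
move=> F; apply: ge_ereal_sup => _ [e e0 <-].
apply: le_trans (mu_ext_sigma_subadditive (hausdorff_gauge_ge0 e) F) _.
apply: lee_nneseries => [i _ _|i _].
  exact: (mu_ext_ge0 (hausdorff_gauge_ge0 e)).
by apply: ereal_sup_ubound; exists e.
Qed.

HB.instance Definition _ := isOuterMeasure.Build R 'rV[R]_d hausdorff_ext
  hausdorff_ext0 hausdorff_ext_ge0 le_hausdorff_ext
  hausdorff_ext_sigma_subadditive.

Definition hausdorff_outer : {outer_measure set 'rV[R]_d -> \bar R} :=
  hausdorff_ext.

Definition hausdorff : {measure set (caratheodory_type hausdorff_outer) -> \bar R} :=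
  hausdorff_outer.

End hausdorff.

Section domain.
Context {R : realType} {d : nat}.

Definition boundary (Omega : set 'rV[R]_d) : set 'rV[R]_d :=
  closure Omega `\` interior Omega.

(* Around every boundary point, Omega is the part of a ball lying strictly above
   the graph of a Lipschitz function gamma of the component orthogonal to a
   unit vector nu; only the values of gamma on the hyperplane orthogonal to nu
   matter. *)
Definition lipschitz_boundary (Omega : set 'rV[R]_d) : Prop :=
  forall x0, boundary Omega x0 ->
  exists (r : R) (nu : 'rV[R]_d) (gamma : 'rV[R]_d -> R) (k : R),
    [/\ 0 < r, enorm nu = 1,
        (forall z z', dotv z nu = 0 -> dotv z' nu = 0 ->
           `|gamma z - gamma z'| <= k * enorm (z - z')) &
        forall z, enorm z < r ->
          Omega (x0 + z) <-> gamma (z - dotv z nu *: nu) < dotv z nu].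

Definition lipschitz_domain (Omega : set 'rV[R]_d) : Prop :=
  [/\ Omega !=set0, open Omega, bounded_set Omega, connected Omega
    & lipschitz_boundary Omega].

End domain.

Section function_spaces.
Context {R : realType} {d : nat}.
Variable Omega : set 'rV[R]_d.
Implicit Types (f v y : 'rV[R]_d -> R) (p : \bar R).

Local Notation Gamma := (boundary Omega).
Local Notation surf := (hausdorff R d d.-1).

(* [f \_ Omega] vanishes outside Omega, so Lp p is L^p(Omega). *)
Definition Lp p : set ('rV[R]_d -> R) :=
  [set f | (f \_ Omega : caratheodory_type (leb_outer R d) -> R) \in Lfun (leb R d) p].

Definition Lp_norm p f : R :=
  fine ('N[leb R d]_p [EFin \o (f \_ Omega)])%E.

Definition LpG p : set ('rV[R]_d -> R) :=
  [set f | (f \_ Gamma : caratheodory_type (hausdorff_outer R d d.-1) -> R)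
             \in Lfun surf p].

Definition LpG_norm p f : R := fine ('N[surf]_p [EFin \o (f \_ Gamma)])%E.

Definition aeO (P : 'rV[R]_d -> Prop) : Prop :=
  {ae leb R d, forall x : 'rV[R]_d, Omega x -> P x}.

Definition intO f : R := (\int[leb R d]_(x in Omega) f x)%R.
Definition intG f : R := (\int[surf]_(x in Gamma) f x)%R.

Definition partial (i : 'I_d) f : 'rV[R]_d -> R := 'D_(delta_mx 0 i) f.

Definition C1fun f : Prop :=
  (forall x, differentiable f x) /\ forall i, continuous (partial i f).

(* First-order weak derivatives are tested against C^1 functions with compact
   support in Omega (Gilbarg-Trudinger, Section 7.3). *)
Definition test_fun f : Prop :=
  C1fun f /\ exists K : set 'rV[R]_d,
    [/\ compact K, K `<=` Omega & forall x, ~ K x -> f x = 0].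

Definition is_wgrad v (w : 'rV[R]_d -> 'rV[R]_d) : Prop :=
  forall i, Lp 2%:E (fun x => w x 0 i) /\
    forall phi, test_fun phi ->
      intO (fun x => v x * partial i phi x) = - intO (fun x => w x 0 i * phi x).

Definition H1 : set ('rV[R]_d -> R) :=
  [set v | Lp 2%:E v /\ exists w, is_wgrad v w].

(* The weak gradient, unique up to null sets on H1. *)
Definition wgrad v : 'rV[R]_d -> 'rV[R]_d := get (is_wgrad v).

Definition H1_norm v : R :=
  Num.sqrt (Lp_norm 2%:E v ^+ 2
            + \sum_i Lp_norm 2%:E (fun x => wgrad v x 0 i) ^+ 2).

(* w is the trace of v: the common limit of functions of class C^1 up to the
   boundary, in H1(Omega) towards v and in L2(Gamma) towards w. *)
Definition is_trace v w : Prop :=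
  LpG 2%:E w /\ exists phi : nat -> 'rV[R]_d -> R,
    [/\ forall n, C1fun (phi n),
        (fun n => H1_norm (phi n - v)) @ \oo --> (0 : R) &
        (fun n => LpG_norm 2%:E (phi n - w)) @ \oo --> (0 : R)].

(* The trace, unique up to null sets on H1 when the boundary is Lipschitz. *)
Definition trace v : 'rV[R]_d -> R := get (is_trace v).

(* y in H1 is a weak solution of
     - sum_ij d_j (A_ij d_i y) + l = f in Omega,  d_{n_A} y = h on Gamma. *)
Definition weak_neumann (A : 'rV[R]_d -> 'M[R]_d) y l f h : Prop :=
  H1 y /\ forall v, H1 v ->
    intO (fun x => \sum_i \sum_j A x i j * wgrad y x 0 i * wgrad v x 0 j)
      + intO (fun x => l x * v x)
    = intO (fun x => f x * v x) + intG (fun x => h x * trace v x).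

Definition holder_bound (mu : R) y (C : R) : Prop :=
  forall x x', closure Omega x -> closure Omega x' ->
    `|y x - y x'| <= C * enorm (x - x') `^ mu.

Definition holder (mu : R) : set ('rV[R]_d -> R) :=
  [set y | exists C, holder_bound mu y C].

Definition holder_norm (mu : R) y : R :=
  sup [set `|y x| | x in closure Omega]
  + sup [set r | exists x x', [/\ closure Omega x, closure Omega x', x <> x'
                 & r = `|y x - y x'| / enorm (x - x') `^ mu]].

(* The default value +oo does not affect the essential infimum. *)
Definition ess_infO f : \bar R :=
  ess_inf (leb R d) (patch (fun=> +oo%E) Omega (EFin \o f)).

End function_spaces.

(* A vector space of functions, the members of a subspace of it, and a seminorm
   on the members; it stands for the normed space of classes of members modulo
   the kernel of the seminorm. *)
Record snspace (R : realType) := SNSpace {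
  sn_car :> lmodType R;
  sn_mem : set sn_car;
  sn_norm : sn_car -> R }.

Section differentiability.
Context {R : realType}.
Implicit Types X Y : snspace R.

Definition bounded_op X Y (T : X -> Y) : Prop :=
  [/\ forall v, sn_mem v -> sn_mem (T v),
      forall (c : R) v w, sn_mem v -> sn_mem w ->
        sn_norm (T (c *: v + w) - (c *: T v + T w)) = 0 &
      exists C : R, forall v, sn_mem v -> sn_norm (T v) <= C * sn_norm v].

(* Bounded linear operators, with the operator norm. *)
Definition Lop X Y : snspace R :=
  @SNSpace R (X -> Y) (@bounded_op X Y)
    (fun T => sup [set sn_norm (T v) | v in [set v | sn_mem v /\ sn_norm v <= 1]]).

Definition C0_on X Y (D : set X) (F : X -> Y) : Prop :=
  forall u, D u -> forall eps : R, 0 < eps -> exists2 delta : R, 0 < delta &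
    forall u', D u' -> sn_norm (u' - u) < delta -> sn_norm (F u' - F u) <= eps.

Definition frechet_on X Y (D : set X) (F : X -> Y) (DF : X -> Lop X Y) : Prop :=
  forall u, D u -> forall eps : R, 0 < eps -> exists2 delta : R, 0 < delta &
    forall h, sn_mem h -> sn_norm h < delta -> D (u + h) ->
      sn_norm (F (u + h) - F u - DF u h) <= eps * sn_norm h.

(* F : D -> Y is of class C^1 on the open set D, with derivative DF. *)
Definition C1_on X Y (D : set X) (F : X -> Y) (DF : X -> Lop X Y) : Prop :=
  [/\ forall u, D u -> sn_mem (F u), forall u, D u -> sn_mem (DF u),
      frechet_on D F DF & C0_on D DF].

Definition C2_on X Y (D : set X) (F : X -> Y) (DF : X -> Lop X Y) : Prop :=
  C1_on D F DF /\ exists D2F : X -> Lop X (Lop X Y), C1_on D DF D2F.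

End differentiability.

Section control_problem.
Context {R : realType} {d : nat}.
Variable Omega : set 'rV[R]_d.

Definition L2_space : snspace R :=
  @SNSpace R ('rV[R]_d -> R) (Lp Omega 2%:E) (Lp_norm Omega 2%:E).

Definition H1_holder_space (mu : R) : snspace R :=
  @SNSpace R ('rV[R]_d -> R) (H1 Omega `&` holder Omega mu)
    (fun y => H1_norm Omega y + holder_norm Omega mu y).

Definition elliptic_coef (A : 'rV[R]_d -> 'M[R]_d) (M Lambda : R) : Prop :=
  [/\ forall i j, Lp Omega +oo%E (fun x => A x i j), 0 < M, 0 < Lambda &
      aeO Omega (fun x => forall xi : 'rV[R]_d,
        Lambda * enorm xi ^+ 2 <= \sum_i \sum_j A x i j * xi 0 i * xi 0 j
                               <= M * enorm xi ^+ 2)].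

Definition transp (A : 'rV[R]_d -> 'M[R]_d) : 'rV[R]_d -> 'M[R]_d :=
  fun x => (A x)^T.

Definition C2_real (f : R -> R) : Prop :=
  [/\ forall y, derivable f y 1, forall y, derivable (derive1 f) y 1
    & continuous (derive1n 2 f)].

Definition caratheodory_C2 (f : 'rV[R]_d -> R -> R) : Prop :=
  [/\ forall y, measurable_fun (Omega : set (caratheodory_type (leb_outer R d)))
                  (fun x => f x y),
      aeO Omega (fun x => continuous (f x)) & aeO Omega (fun x => C2_real (f x))].

Definition second_deriv_unif (f : 'rV[R]_d -> R -> R) : Prop :=
  forall eps M : R, 0 < eps -> 0 < M -> exists2 rho : R, 0 < rho &
    aeO Omega (fun x => forall y1 y2, `|y1| <= M -> `|y2| <= M ->
      `|y1 - y2| <= rho -> `|derive1n 2 (f x) y1 - derive1n 2 (f x) y2| <= eps).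

Definition nonlinearity (p : \bar R) (a0 : R) (a : 'rV[R]_d -> R -> R) : Prop :=
  [/\ caratheodory_C2 a,
      Lp Omega p (fun x => a x 0),
      0 <= a0 /\ aeO Omega (fun x => forall y, a0 <= derive1 (a x) y),
      forall M : R, 0 < M -> exists C : R, aeO Omega (fun x =>
        forall y, `|y| <= M -> `|derive1 (a x) y| + `|derive1n 2 (a x) y| <= C)
    & second_deriv_unif a].

Definition cost_integrand (p : \bar R) (L : 'rV[R]_d -> R -> R) : Prop :=
  [/\ caratheodory_C2 L,
      Lp Omega 1%:E (fun x => L x 0),
      forall M : R, 0 < M -> exists2 LM, Lp Omega p LM & aeO Omega (fun x =>
        forall y, `|y| <= M -> `|derive1 (L x) y| <= LM x),
      forall M : R, 0 < M -> exists C : R, aeO Omega (fun x =>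
        forall y, `|y| <= M -> `|derive1n 2 (L x) y| <= C)
    & second_deriv_unif L].

(* Since the elements of H1 are only defined up to null sets, membership in
   C^{0,mu} means the existence of a Hoelder continuous representative. *)
Definition holder_regularity (p q : \bar R) (mu : R) (B : 'rV[R]_d -> 'M[R]_d) : Prop :=
  exists C : R, forall f h y,
    Lp Omega (Order.min p 2%:E) f -> LpG Omega q h -> weak_neumann Omega B y y f h ->
    exists y', [/\ aeO Omega (fun x => y' x = y x), holder Omega mu y' &
      holder_norm Omega mu y' <=
        C * (Lp_norm Omega (Order.min p 2%:E) f + LpG_norm Omega q h)].

Definition L4_embedding (C4 : R) : Prop :=
  forall y, H1 Omega y ->
    Lp Omega 4%:E y /\ Lp_norm Omega 4%:E y <= C4 * H1_norm Omega y.

Definition A0_set (a0 : R) : set ('rV[R]_d -> R) :=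
  [set u | Lp Omega 2%:E u /\ (0 < a0%:E + ess_infO Omega u)%E].

Definition Lambda_u (Lambda a0 : R) (u : 'rV[R]_d -> R) : \bar R :=
  Order.min Lambda%:E (a0%:E + ess_infO Omega u)%E.

Definition A_set (a0 : R) (eps : ('rV[R]_d -> R) -> R) : set L2_space :=
  \bigcup_(ubar in A0_set a0)
    [set u | Lp Omega 2%:E u /\ Lp_norm Omega 2%:E (u - ubar) < eps ubar].

Definition state_solution (A : 'rV[R]_d -> 'M[R]_d) (a : 'rV[R]_d -> R -> R) g u
    (y : 'rV[R]_d -> R) : Prop :=
  weak_neumann Omega A y (fun x => a x (y x) + u x * y x) (fun=> 0) g.

(* A^* z + (d_y a)(x, y) z + u z = f in Omega, with zero conormal derivative. *)
Definition adjoint_solution (A : 'rV[R]_d -> 'M[R]_d) (a : 'rV[R]_d -> R -> R)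
    (u y f z : 'rV[R]_d -> R) : Prop :=
  weak_neumann Omega (transp A) z (fun x => derive1 (a x) (y x) * z x + u x * z x)
    f (fun=> 0).

End control_problem.

Arguments A_set {R d} Omega a0 eps.

(* Main.v *)
(** Idea.  A control u in the admissible set is L2-close to some ubar whose zero
order term is bounded below, and the L4 embedding lets the difference be
absorbed: the adjoint operator at u is coercive on H1.  Its zero order
coefficient is only in L2, but its large values have small L2 norm, so that the
Hoelder regularity of the operator A^* + 1 gives
  |w|_{H1} + |w|_{C^{0,mu}} <= K |f|_{L2}
for every Hoelder continuous solution w with right-hand side f.

Although dL/dy(., y_u) need not be in L2, the increment of the adjoint state
solves the equation at u with an L2 right-hand side, which is the right-hand side
of the linearized equation up to o(|h|_{L2}).  Hence the difference quotients of
the adjoint state in a direction v are Cauchy in H1 and C^{0,mu}; their limit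
solves the linearized equation, so that no existence theorem for linear
equations is needed.  Differentiability and the continuity of the derivative
follow by applying the same estimate to the corresponding differences. *)
Require Import Defs.
From mathcomp Require Import measurable_realfun ring lra.

Set Implicit Arguments.
Unset Strict Implicit.
Unset Printing Implicit Defensive.
Import Order.TTheory GRing.Theory Num.Theory.

Local Open Scope classical_set_scope.
Local Open Scope ring_scope.
(** * Square-integrable functions *)

(** Three obstacles shape the development. [leb] is the Caratheodory measure of an outer measure
    defined by box covers, so measurability of open sets, their positivity, translation invariance
    and outer regularity are drawn from the covers. They lead to the du Bois-Reymond lemma and so to
    uniqueness of weak gradients; as [wgrad] is a chosen gradient, every linearity used for the
    bilinear form rests on it. Next, a real integral of a non-integrable function is 0 by default,
    so the equation of [Phi u] does not visibly allow [dL/dy] to be tested against all of H1;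
    [source_integrable] recovers this. Finally, the coefficient of the adjoint equation moves with
    the control: two controls are compared by freezing the coefficient at [u] and moving its
    increment, times a Hoelder continuous function, to the right. That term contains the unknown
    increment and is absorbed for small perturbations. As the spaces carry seminorms and the
    derivative is a chosen solution, its linearity holds up to seminorm zero. *)

Section integrals.
Context d (T : measurableType d) (R : realType) (mu : {measure set T -> \bar R}).
Variable D : set T.
Hypothesis mD : measurable D.
Implicit Types f g h : T -> R.

Lemma integrable_measurable f : mu.-integrable D (EFin \o f) -> measurable_fun D f.
Proof. by move/measurable_int/measurable_EFinP. Qed.

Lemma integrableD_EFin f g : mu.-integrable D (EFin \o f) ->
  mu.-integrable D (EFin \o g) -> mu.-integrable D (EFin \o (fun x => f x + g x)).
Proof. exact: integrableD. Qed.

Lemma integrableB_EFin f g : mu.-integrable D (EFin \o f) ->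
  mu.-integrable D (EFin \o g) -> mu.-integrable D (EFin \o (fun x => f x - g x)).
Proof. exact: integrableB. Qed.

Lemma integrableZl_EFin (c : R) f : mu.-integrable D (EFin \o f) ->
  mu.-integrable D (EFin \o (fun x => c * f x)).
Proof. exact: (@integrableZl _ _ _ _ _ mD c (EFin \o f)). Qed.

Lemma ae_le_integrable f g : measurable_fun D f -> mu.-integrable D (EFin \o g) ->
  (\forall x \ae mu, D x -> `|f x| <= g x) -> mu.-integrable D (EFin \o f).
Proof.
move=> mf ig fg; apply/integrableP; split; first exact/measurable_EFinP.
have [mg ltg] := integrableP _ _ _ ig.
apply: le_lt_trans ltg.
apply: ae_ge0_le_integral => //.
- by apply: measurableT_comp => //; exact/measurable_EFinP.
- by apply: measurableT_comp.
- apply: filterS fg => x + Dx => /(_ Dx) /= fgx.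
  by rewrite lee_fin (le_trans fgx)// ler_norm.
Qed.

Lemma ae_eq_Rintegral f g : measurable_fun D f -> measurable_fun D g ->
  (\forall x \ae mu, D x -> f x = g x) ->
  \int[mu]_(x in D) f x = \int[mu]_(x in D) g x.
Proof.
move=> mf mg fg; rewrite /Rintegral; congr fine; apply: ae_eq_integral => //.
- exact/measurable_EFinP.
- exact/measurable_EFinP.
- by apply: filterS fg => x + Dx => /(_ Dx) ->.
Qed.

Lemma ae_le_Rintegral f g : mu.-integrable D (EFin \o f) ->
  mu.-integrable D (EFin \o g) -> (\forall x \ae mu, D x -> f x <= g x) ->
  \int[mu]_(x in D) f x <= \int[mu]_(x in D) g x.
Proof.
move=> if_ ig fg; rewrite -subr_ge0 -RintegralB//.
have mfg : measurable_fun D (fun x => g x - f x).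
  by apply: measurable_funB; exact: integrable_measurable.
(* [g - f] is nonnegative only almost everywhere, whereas [Rintegral_ge0] asks for it at every
   point; hence the absolute value. *)
rewrite (@ae_eq_Rintegral _ (fun x => `|g x - f x|))//.
- exact: Rintegral_ge0.
- exact: measurableT_comp.
- by apply: filterS fg => x + Dx => /(_ Dx) ?; rewrite ger0_norm// subr_ge0.
Qed.

Lemma Rintegral_eq0_ae f : mu.-integrable D (EFin \o f) ->
  (\forall x \ae mu, D x -> 0 <= f x) -> \int[mu]_(x in D) f x = 0 ->
  \forall x \ae mu, D x -> f x = 0.
Proof.
move=> if_ f0 If; have mf := integrable_measurable if_.
have If' : \int[mu]_(x in D) `|f x| = 0.
  rewrite -If; apply: ae_eq_Rintegral => //; first exact: measurableT_comp.
  by apply: filterS f0 => x + Dx => /(_ Dx) ?; rewrite ger0_norm.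
have /(ae_eq_integral_abs mu mD) : measurable_fun D (EFin \o f).
  exact/measurable_EFinP.
move=> [+ _]; have -> : (\int[mu]_(x in D) `|(EFin \o f) x| = 0)%E.
  rewrite -(fineK (integrable_fin_num _ (integrable_abse if_)))//.
  by move: If'; rewrite /Rintegral => ->.
by move=> /(_ erefl); apply: filterS => x /= + Dx => /(_ Dx) [].
Qed.

End integrals.

Section square_integrable.
Context d (T : measurableType d) (R : realType) (mu : {measure set T -> \bar R}).
Variable D : set T.
Hypothesis mD : measurable D.
Implicit Types f g h : T -> R.

(** The L2 calculus is carried out with the integral of the square, free of extended-real norms and
    real powers; [Lfun2P] and [fine_Lnorm2] identify it with the spaces of the statement. *)
Definition sqint f := measurable_fun D f /\
  mu.-integrable D (EFin \o (fun x => f x ^+ 2)).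

Definition n2 f : R := Num.sqrt (\int[mu]_(x in D) (f x ^+ 2)).

Lemma n2_ge0 f : 0 <= n2 f. Proof. exact: sqrtr_ge0. Qed.

Lemma sqr_n2 f : n2 f ^+ 2 = \int[mu]_(x in D) (f x ^+ 2).
Proof. by rewrite sqr_sqrtr// Rintegral_ge0// => x _; rewrite sqr_ge0. Qed.

Lemma sqint_mul f g : sqint f -> sqint g ->
  mu.-integrable D (EFin \o (fun x => f x * g x)).
Proof.
move=> [mf f2] [mg g2]; apply: (@ae_le_integrable _ _ _ _ _ mD _
  (fun x => f x ^+ 2 + g x ^+ 2)).
- exact: measurable_funM.
- exact: (integrableD mD f2 g2).
- apply: aeW => x _; rewrite normrM -[leRHS]ger0_norm ?addr_ge0 ?sqr_ge0//.
  rewrite [leRHS]ger0_norm ?addr_ge0 ?sqr_ge0//.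
  rewrite -(real_normK (num_real (f x))) -(real_normK (num_real (g x))).
  by have := normr_ge0 (f x); have := normr_ge0 (g x); nra.
Qed.

Lemma ae_le_sqint f g : measurable_fun D f -> sqint g ->
  (\forall x \ae mu, D x -> `|f x| <= g x) -> sqint f /\ n2 f <= n2 g.
Proof.
move=> mf [mg g2] fg.
have fg2 : \forall x \ae mu, D x -> `|f x ^+ 2| <= g x ^+ 2.
  apply: filterS fg => x + Dx => /(_ Dx) fgx.
  by rewrite normrX lerXn2r ?nnegrE// (le_trans _ fgx).
have f2 : mu.-integrable D (EFin \o (fun x => f x ^+ 2)).
  by apply: (ae_le_integrable mD _ g2) => //; exact: measurable_funX.
split; first by [].
rewrite /n2 ler_wsqrtr//; apply: ae_le_Rintegral => //.
by apply: filterS fg2 => x + Dx => /(_ Dx); exact/le_trans/ler_norm.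
Qed.

Lemma eq_sqint f g : (forall x, D x -> f x = g x) -> sqint f -> sqint g.
Proof.
move=> fg [mf f2]; split.
- by apply: eq_measurable_fun mf => x /set_mem; exact: fg.
- by apply: eq_integrable f2 => // x /set_mem Dx /=; rewrite fg.
Qed.

Lemma eq_n2 f g : (forall x, D x -> f x = g x) -> n2 f = n2 g.
Proof.
by move=> fg; rewrite /n2; congr Num.sqrt; apply: eq_Rintegral => x /set_mem /fg ->.
Qed.

Lemma ae_eq_n2 f g : measurable_fun D f -> measurable_fun D g ->
  (\forall x \ae mu, D x -> f x = g x) -> n2 f = n2 g.
Proof.
move=> mf mg fg; rewrite /n2; congr Num.sqrt; apply: ae_eq_Rintegral => //.
- exact: measurable_funX.
- exact: measurable_funX.
- by apply: filterS fg => x + Dx => /(_ Dx) ->.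
Qed.

Lemma sqintZ (c : R) f : sqint f -> sqint (fun x => c * f x).
Proof.
move=> [mf f2]; split; first exact: measurable_funM.
by apply: eq_integrable (integrableZl_EFin mD (c ^+ 2) f2) => // x _ /=; rewrite exprMn.
Qed.

Lemma n2Z (c : R) f : sqint f -> n2 (fun x => c * f x) = `|c| * n2 f.
Proof.
move=> [mf f2]; rewrite /n2 -sqrtr_sqr -sqrtrM ?sqr_ge0// -RintegralZl//.
by congr Num.sqrt; apply: eq_Rintegral => x _; rewrite exprMn.
Qed.

Lemma sqintD f g : sqint f -> sqint g -> sqint (fun x => f x + g x).
Proof.
move=> [mf f2] [mg g2]; split; first exact: measurable_funD.
apply: (@ae_le_integrable _ _ _ _ _ mD _
  (fun x => 2 * (f x ^+ 2) + 2 * (g x ^+ 2))).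
- by apply: measurable_funX; exact: measurable_funD.
- apply: integrableD_EFin => //.
  + exact: integrableZl_EFin.
  + exact: integrableZl_EFin.
- by apply: aeW => x _; rewrite ger0_norm ?sqr_ge0//; have := sqr_ge0 (f x - g x); nra.
Qed.

Lemma sqintN f : sqint f -> sqint (fun x => - f x).
Proof. by move=> /(sqintZ (-1)); apply: eq_sqint => x _; rewrite mulN1r. Qed.

Lemma n2N f : n2 (fun x => - f x) = n2 f.
Proof. by rewrite /n2; congr Num.sqrt; apply: eq_Rintegral => x _; rewrite sqrrN. Qed.

Lemma sqintB f g : sqint f -> sqint g -> sqint (fun x => f x - g x).
Proof. by move=> sf /sqintN; exact: sqintD. Qed.

Lemma sqint0 : sqint (fun=> 0).
Proof.
split; first exact: measurable_cst.
by rewrite (_ : _ \o _ = cst 0%E) ?integrable0//; apply/funext => x /=; rewrite expr0n.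
Qed.

Lemma sqint_sum (I : Type) (s : seq I) (F : I -> T -> R) :
  (forall i, sqint (F i)) -> sqint (fun x => \sum_(i <- s) F i x).
Proof.
move=> sF; elim: s => [|i s ih].
  by apply: eq_sqint sqint0 => x _; rewrite big_nil.
by apply: (eq_sqint _ (sqintD (sF i) ih)) => x _; rewrite big_cons.
Qed.

(** The integral of [(f + t g)^2] is a nonnegative quadratic polynomial in [t]; its value at the
    minimum [- b / c] gives the inequality. *)
Lemma cauchy_schwarz f g : sqint f -> sqint g ->
  `|\int[mu]_(x in D) (f x * g x)| <= n2 f * n2 g.
Proof.
move=> sf sg; have ifg := sqint_mul sf sg.
rewrite /n2 -sqrtrM; last by apply: Rintegral_ge0 => x _; exact: sqr_ge0.
rewrite -sqrtr_sqr ler_wsqrtr//.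
set a := (X in X * _); set b := (X in X ^+ 2); set c := (X in _ * X).
have q t : 0 <= a + 2 * t * b + t ^+ 2 * c.
  rewrite /a /b /c -!RintegralZl//; last by case: sg.
  rewrite -RintegralD//; [|by case: sf|].
  rewrite -RintegralD//.
  - apply: Rintegral_ge0 => x _.
    rewrite (_ : _ + _ = (f x + t * g x) ^+ 2) ?sqr_ge0//; ring.
  - apply: integrableD_EFin => //; first by case: sf.
    exact: integrableZl_EFin.
  - by apply: integrableZl_EFin => //; case: sg.
  - exact: integrableZl_EFin.
have c0 : 0 <= c by apply: Rintegral_ge0 => x _; exact: sqr_ge0.
have [c0'|c0'] := eqVneq c 0.
  have [b0|b0] := eqVneq b 0; first by rewrite b0 expr0n/= c0' mulr0.
  (* With [c = 0] the polynomial is affine in [t] and equals [-1] at this point, which is absurd. *)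
  have := q (- (a + 1) / (2 * b)); rewrite c0' mulr0 addr0.
  rewrite (_ : 2 * _ * b = - (a + 1)); last by field.
  by move=> ?; exfalso; lra.
have := q (- b / c); rewrite (_ : _ + _ = (a * c - b ^+ 2) / c); last by field.
by rewrite pmulr_lge0 ?invr_gt0 ?lt_neqAle ?c0 1?eq_sym ?c0'// subr_ge0.
Qed.

Lemma n2D f g : sqint f -> sqint g -> n2 (fun x => f x + g x) <= n2 f + n2 g.
Proof.
move=> sf sg; rewrite -ler_sqr ?nnegrE ?addr_ge0 ?n2_ge0//.
have -> : n2 (fun x => f x + g x) ^+ 2 =
    n2 f ^+ 2 + 2 * \int[mu]_(x in D) (f x * g x) + n2 g ^+ 2.
  have ifg := sqint_mul sf sg.
  rewrite !sqr_n2 -RintegralZl// -RintegralD//; [|by case: sf|].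
  rewrite -RintegralD//.
  - by apply: eq_Rintegral => x _; ring.
  - apply: integrableD_EFin => //; first by case: sf.
    exact: integrableZl_EFin.
  - by case: sg.
  - exact: integrableZl_EFin.
have := cauchy_schwarz sf sg; have := ler_norm (\int[mu]_(x in D) (f x * g x)).
nra.
Qed.

Lemma n2B f g : sqint f -> sqint g -> n2 (fun x => f x - g x) <= n2 f + n2 g.
Proof. by move=> sf sg; rewrite -(n2N g); apply: n2D => //; exact: sqintN. Qed.

Lemma n2_eq0 f : sqint f -> n2 f = 0 -> \forall x \ae mu, D x -> f x = 0.
Proof.
move=> [mf f2] f0; have : \int[mu]_(x in D) (f x ^+ 2) = 0.
  by rewrite -sqr_n2 f0 expr0n.
move/(Rintegral_eq0_ae mD f2) => /(_ (aeW mu (fun x _ => sqr_ge0 (f x)))).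
by apply: filterS => x + Dx => /(_ Dx)/eqP; rewrite sqrf_eq0 => /eqP.
Qed.

End square_integrable.

(** * Completeness of L2 *)

Section riesz_fischer.
Context d (T : measurableType d) (R : realType) (mu : {measure set T -> \bar R}).
Variable D : set T.
Hypothesis mD : measurable D.

(** [G] is the pointwise limit of the increasing squares, and monotone convergence bounds its
    integral by [B ^+ 2]. It is extended-real-valued because the limit may be infinite on a null
    set. *)
Lemma nondecreasing_sqint_dominated (g : (T -> R)^nat) (B : R) :
  (forall k, sqint mu D (g k)) -> (forall k, n2 mu D (g k) <= B) ->
  (forall k x, D x -> 0 <= g k x) ->
  (forall x, D x -> {homo g^~ x : m n / (m <= n)%N >-> m <= n}) ->
  exists2 G : T -> \bar R, mu.-integrable D G &
    forall k x, D x -> ((g k x ^+ 2)%:E <= G x)%E.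
Proof.
move=> sg gB g0 ndg.
pose e k x := (g k x ^+ 2)%:E.
have me k : measurable_fun D (e k).
  by case: (sg k) => mgk _; apply/measurable_EFinP; exact: measurable_funX.
have e0 k x : D x -> (0 <= e k x)%E by move=> _; rewrite lee_fin sqr_ge0.
have nde x : D x -> {homo e^~ x : m n / (m <= n)%N >-> (m <= n)%E}.
  move=> Dx m n mn; rewrite lee_fin lerXn2r ?nnegrE ?g0//.
  exact: ndg.
have cve x : D x -> cvgn (e^~ x).
  by move=> Dx; apply: ereal_nondecreasing_is_cvgn; exact: nde.
pose G x := limn (e^~ x).
have eG k x : D x -> (e k x <= G x)%E.
  move=> Dx; apply: lime_ge; first exact: cve.
  by exists k => // m /= km; exact: nde.
exists G => //; apply/integrableP; split.
  by apply: (emeasurable_fun_cvg e) => // x Dx; exact: cve.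
have -> : (\int[mu]_(x in D) `|G x| = \int[mu]_(x in D) G x)%E.
  by apply: eq_integral => x /set_mem Dx; rewrite gee0_abs// (le_trans (e0 0%N x Dx))// eG.
have cvI := @cvg_monotone_convergence _ _ _ mu _ mD _ me e0 nde.
apply: (@le_lt_trans _ _ (B ^+ 2)%:E); last exact: ltry.
rewrite -(cvg_lim _ cvI)//; apply: lime_le; first by apply/cvg_ex; eexists; exact: cvI.
apply: nearW => k; have [_ ik] := sg k.
rewrite -(fineK (integrable_fin_num mD ik)) lee_fin -[leLHS]/(Rintegral _ _ _).
by rewrite -sqr_n2// lerXn2r ?nnegrE ?n2_ge0// (le_trans _ (gB k))// n2_ge0.
Qed.

(** Riesz-Fischer: along a subsequence whose increments have norm at most [2^-k], the partial sums
    [g] of the absolute increments stay below 2 in L2. A single integrable [G] dominates their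
    squares; it gives pointwise convergence where it is finite and serves as majorant for
    convergence in norm. *)
Lemma sqint_complete (F : (T -> R)^nat) : (forall n, sqint mu D (F n)) ->
  (forall e : R, 0 < e -> exists N, forall m n, (N <= m)%N -> (N <= n)%N ->
     n2 mu D (fun x => F m x - F n x) <= e) ->
  exists2 f, sqint mu D f & forall e : R, 0 < e -> exists N, forall n, (N <= n)%N ->
     n2 mu D (fun x => f x - F n x) <= e.
Proof.
move=> sF cF.
have /choice[N0 N0P] : forall k, exists N, forall m n, (N <= m)%N -> (N <= n)%N ->
    n2 mu D (fun x => F m x - F n x) <= 2^-1 ^+ k.
  by move=> k; apply: cF; rewrite exprn_gt0.
(* The maximum makes [phi] nondecreasing and the summand [i] makes it unbounded, besides
   [N0 k <= phi k]. *)
pose phi k := (\max_(i < k.+1) (N0 i + i))%N.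
have phiNk k : (N0 k + k <= phi k)%N.
  by rewrite /phi (leq_bigmax (ord_max : 'I_k.+1)).
have phiN k : (N0 k <= phi k)%N by rewrite (leq_trans _ (phiNk k))// leq_addr.
have kphi k : (k <= phi k)%N by rewrite (leq_trans _ (phiNk k))// leq_addl.
have phiS k : (phi k <= phi k.+1)%N.
  by rewrite /phi [leqRHS]big_ord_recr/= leq_maxl.
pose h k x := `|F (phi k.+1) x - F (phi k) x|.
have sh k : sqint mu D (h k) /\ n2 mu D (h k) <= 2^-1 ^+ k.
  have [m1 i1] := sqintB mD (sF (phi k.+1)) (sF (phi k)).
  have hE x : D x -> h k x ^+ 2 = (F (phi k.+1) x - F (phi k) x) ^+ 2.
    by move=> _; rewrite /h real_normK ?num_real.
  split.
    split; first exact: measurableT_comp.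
    by apply: eq_integrable i1 => // x /set_mem Dx /=; rewrite hE.
  rewrite (_ : n2 _ _ _ = n2 mu D (fun x => F (phi k.+1) x - F (phi k) x)).
    by apply: N0P => //; exact: leq_trans (phiN k) (phiS k).
  by congr Num.sqrt; apply: eq_Rintegral => x /set_mem; exact: hE.
pose g k x := \sum_(i < k) h i x.
have sg k : sqint mu D (g k).
  by rewrite /g; apply: sqint_sum => // i; case: (sh i).
have gB k : n2 mu D (g k) <= 2 - 2 * 2^-1 ^+ k.
  elim: k => [|k ih].
    rewrite expr0 mulr1 subrr (@eq_n2 _ _ _ _ _ _ (fun=> 0)).
      by rewrite /n2 expr0n/= Rintegral_cst// mul0r sqrtr0.
    by move=> x _; rewrite /g big_ord0.
  rewrite (@eq_n2 _ _ _ _ _ _ (fun x => g k x + h k x)).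
    apply: le_trans (n2D mD (sg k) (sh k).1) _.
    rewrite exprS mulrA divff ?mul1r//.
    by have := (sh k).2; move: ih; lra.
  by move=> x _; rewrite /g big_ord_recr.
have h0 k x : 0 <= h k x by rewrite normr_ge0.
have ndg x : {homo g^~ x : m n / (m <= n)%N >-> m <= n}.
  apply/nondecreasing_seqP => n; rewrite /g big_ord_recr/= lerDl.
  exact: h0.
have [|||G iG gG] := @nondecreasing_sqint_dominated g 2 sg.
- move=> k; apply: le_trans (gB k) _; rewrite gerBl mulr_ge0// exprn_ge0.
- by move=> k x _; rewrite /g sumr_ge0.
- by move=> x _; exact: ndg.
have mG := measurable_int _ iG.
have aeG := integrable_ae mD iG.
have FgF m k x : (k <= m)%N -> `|F (phi m) x - F (phi k) x| <= g m x - g k x.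
  elim: m => [|m ih]; first by rewrite leqn0 => /eqP->; rewrite !subrr normr0.
  rewrite leq_eqVlt => /predU1P[->|]; first by rewrite !subrr normr0.
  rewrite ltnS => /ih{}ih; rewrite {1}/g big_ord_recr/= -/(g m x).
  apply: le_trans (ler_distD (F (phi m) x) _ _) _.
  by rewrite -/(h m x); lra.
have cvF x : D x -> G x \is a fin_num -> cvgn (fun k => F (phi k) x).
  move=> Dx Gx.
  pose u k := F (phi k.+1) x - F (phi k) x.
  have cu : cvgn (series u).
    apply: normed_cvg; suff -> : [normed series u] = g^~ x.
      apply: nondecreasing_is_cvgn; first exact: ndg.
      exists (fine (G x) + 1) => _ [k _ <-].
      have := gG k x Dx; rewrite -(fineK Gx) lee_fin => gGk.
      (* [t ^+ 2 <= G] implies [t <= G + 1], because [2 t <= t ^+ 2 + 1]. *)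
      by have := sqr_ge0 (g k x - 1); nra.
    by apply/funext => k; rewrite /g /= seriesEord.
  rewrite (_ : (fun k => _) = (fun k => F (phi 0%N) x + series u k)).
    by apply: is_cvgD => //; exact: is_cvg_cst.
  by apply/funext => k; rewrite /series/= telescope_sumr// addrC subrK.
pose S := D `&` [set x | G x \is a fin_num].
have mS : measurable S by exact: emeasurable_fin_num.
(* Setting the sequence to 0 off [S] makes it converge at every point of [D], so that its limit is
   measurable. *)
pose Fk k x := F (phi k) x * \1_S x.
have mFk k : measurable_fun D (Fk k).
  by apply: measurable_funM; [case: (sF (phi k))|exact: measurable_indic].
have FkE k x : S x -> Fk k x = F (phi k) x.
  by move=> Sx; rewrite /Fk indicE mem_set// mulr1.
pose f x := limn (Fk^~ x).
have cvFk x : D x -> Fk^~ x @ \oo --> f x.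
  move=> Dx; rewrite /f /Fk indicE; case: (boolP (x \in _)) => /= Sx.
    under eq_fun do rewrite mulr1.
    by move: Sx => /set_mem[_ Gx]; exact: cvF.
  by under eq_fun do rewrite mulr0; rewrite lim_cst//; exact: cvg_cst.
have mf : measurable_fun D f by apply: (measurable_fun_cvg mFk) => x; exact: cvFk.
have cvd x k : S x ->
    (`|Fk m x - F (phi k) x| ^+ 2) @[m --> \oo] --> `|f x - F (phi k) x| ^+ 2.
  move=> [Dx Gx]; apply: (@cvg_comp _ _ _ _ (fun t : R => t ^+ 2)); last exact: exprn_continuous.
  by apply: cvg_norm; apply: cvgB; [exact: cvFk|exact: cvg_cst].
have fG x k : S x -> `|f x - F (phi k) x| ^+ 2 <= fine (G x).
  move=> Sx; have := cvd x k Sx => cvdx; rewrite -(cvg_lim _ cvdx)//.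
  apply: limr_le; first by apply/cvg_ex; eexists; exact: cvdx.
  exists k => // m /= km; rewrite FkE//.
  apply: (@le_trans _ _ (g m x ^+ 2)); last first.
    by case: Sx => Dx Gx; rewrite -lee_fin fineK//; exact: gG.
  rewrite lerXn2r ?nnegrE ?sumr_ge0//.
  by apply: le_trans (FgF _ _ _ km) _; rewrite gerBl sumr_ge0.
have ifG : mu.-integrable D (EFin \o (fine \o G)).
  apply: (le_integrable mD _ _ iG).
    by apply/measurable_EFinP; apply: measurableT_comp.
  by move=> x Dx /=; case: (G x) => [r| |] //=; rewrite normr0 leey.
have aeS : \forall x \ae mu, D x -> S x.
  by apply: filterS aeG => x + Dx => /(_ Dx).
have sfk k : sqint mu D (fun x => f x - F (phi k) x).
  have m1 : measurable_fun D (fun x => f x - F (phi k) x).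
    by apply: measurable_funB => //; case: (sF (phi k)).
  split=> //; apply: (ae_le_integrable mD _ ifG); first exact: measurable_funX.
  apply: filterS aeS => x + Dx => /(_ Dx) Sx /=.
  by rewrite normrX; exact: fG.
have sf : sqint mu D f.
  apply: (eq_sqint mD _ (sqintD mD (sfk 0%N) (sF (phi 0%N)))) => x _.
  by rewrite subrK.
exists f => // e e0.
(* Dominated convergence gives the limit along the subsequence; the Cauchy property then carries it
   over to the whole sequence. *)
have [] := @dominated_convergence _ _ _ mu _ mD
  (fun k x => (`|f x - F (phi k) x| ^+ 2)%:E) (cst 0%E) (EFin \o (fine \o G)).
- move=> k; apply/measurable_EFinP; apply: measurable_funX.
  by apply: measurableT_comp => //; case: (sfk k).
- exact: measurable_cst.
- apply: filterS aeS => x + Dx => /(_ Dx) Sx.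
  apply/fine_cvgP; split; first exact: nearW.
  rewrite (_ : _ \o _ = (fun k => `|f x - F (phi k) x| ^+ 2))//.
  rewrite [X in _ --> X](_ : _ = `|0 : R| ^+ 2); last by rewrite normr0 expr0n.
  apply: (@cvg_comp _ _ _ _ (fun t : R => t ^+ 2)); last exact: exprn_continuous.
  apply: cvg_norm; rewrite -(subrr (f x)); apply: cvgB; first exact: cvg_cst.
  have := cvFk x Dx; under eq_fun do rewrite FkE//.
  exact.
- exact: ifG.
- apply: filterS aeS => x Sx k Dx; rewrite /= ger0_norm ?sqr_ge0//.
  by rewrite lee_fin; apply: fG; exact: Sx.
move=> _ _; rewrite integral0 => /fine_cvgP[_ /cvgrPdist_le].
move=> /(_ ((e / 2) ^+ 2)); rewrite exprn_gt0 ?divr_gt0// => /(_ isT)[K _ KP].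
have [N NP] := cF _ (divr_gt0 e0 (ltr0Sn R 1)).
exists N => n Nn; pose k := maxn N K.
rewrite (@eq_n2 _ _ _ _ _ _
  (fun x => (f x - F (phi k) x) + (F (phi k) x - F n x))); last first.
  by move=> x _; rewrite addrA subrK.
apply: le_trans (n2D mD (sfk k) (sqintB mD (sF (phi k)) (sF n))) _.
rewrite [leRHS]splitr lerD//; last first.
  by apply: NP => //; rewrite (leq_trans _ (kphi k))// leq_maxl.
have := KP k (leq_maxr _ _); rewrite sub0r normrN => IK.
rewrite -ler_sqr ?nnegrE ?n2_ge0// ?(ltW (divr_gt0 e0 (ltr0Sn R 1)))// sqr_n2.
apply: le_trans (le_trans (ler_norm _) IK).
rewrite le_eqVlt; apply/orP; left; apply/eqP.
by apply: eq_Rintegral => x _; rewrite real_normK ?num_real.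
Qed.
End riesz_fischer.

(** * Lebesgue measure *)

Section lebesgue_measurability.
Variables (R : realType) (d : nat).
Local Notation lebT := (caratheodory_type (leb_outer R d)).
Local Open Scope ereal_scope.

Lemma box_gauge_le (X : set 'rV[R]_d) (a b : 'rV[R]_d) : (forall i, a 0 i <= b 0 i)%R ->
  X `<=` box a b -> box_gauge X <= (\prod_i (b 0 i - a 0 i))%R%:E.
Proof.
move=> ab Xab; rewrite /box_gauge; case: asboolP => _.
  by rewrite lee_fin prodr_ge0// => i _; rewrite subr_ge0.
by apply: ereal_inf_lbound; exists a, b.
Qed.

Lemma le_box_gauge (X : set 'rV[R]_d) (v : \bar R) : (X = set0 -> v <= 0) ->
  (forall a b : 'rV[R]_d, (forall i, a 0 i <= b 0 i)%R -> X `<=` box a b ->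
    v <= (\prod_i (b 0 i - a 0 i))%R%:E) -> v <= box_gauge X.
Proof.
move=> v0 vX; rewrite /box_gauge; case: asboolP => [/v0//|_].
by apply: le_ereal_inf_tmp => _ [a [b [ab Xab ->]]]; exact: vX.
Qed.

Definition upd (a : 'rV[R]_d) (i : 'I_d) (c : R) : 'rV[R]_d :=
  \row_j (if j == i then c else a 0%R j).

(** Cutting a box by [x_i = c] gives two boxes whose volumes add up, or leaves one side empty.
    Applied to each member of a cover, this yields the Caratheodory criterion for half-spaces, hence
    measurability of the coordinates. *)
Lemma box_gauge_split (i : 'I_d) (c : R) (X : set 'rV[R]_d) :
  box_gauge (X `&` [set x | x 0 i <= c]%R) + box_gauge (X `&` ~` [set x | x 0 i <= c]%R)
  <= box_gauge X.
Proof.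
apply: le_box_gauge => [->|a b ab Xab].
  by rewrite !set0I box_gauge0 adde0.
have [cb|bc] := leP (b 0 i)%R c.
  have -> : X `&` ~` [set x | x 0 i <= c]%R = set0.
    apply/seteqP; split=> x//= -[/Xab/(_ i)/andP[_ xb]].
    by rewrite (le_trans xb).
  by rewrite box_gauge0 adde0; apply: box_gauge_le => // x [/Xab].
have [ca|ac] := ltP c (a 0 i)%R.
  have -> : X `&` [set x | x 0 i <= c]%R = set0.
    apply/seteqP; split=> x//= -[/Xab/(_ i)/andP[ax _]].
    by rewrite leNgt (lt_le_trans ca).
  by rewrite box_gauge0 add0e; apply: box_gauge_le => // x [/Xab].
have -> : (\prod_j (b 0 j - a 0 j) = \prod_j (upd b i c 0 j - a 0 j) +
    \prod_j (b 0 j - upd a i c 0 j))%R.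
  rewrite [LHS](bigD1 i)//= [X in _ = (X + _)%R](bigD1 i)//= [X in _ = (_ + X)%R](bigD1 i)//=.
  rewrite !mxE eqxx.
  under [X in _ = (_ * X + _)%R]eq_bigr => j ji do rewrite mxE (negbTE ji).
  under [X in _ = (_ + _ * X)%R]eq_bigr => j ji do rewrite mxE (negbTE ji).
  by rewrite -mulrDl; congr (_ * _)%R; ring.
rewrite EFinD; apply: leeD; apply: box_gauge_le.
- by move=> j; rewrite mxE; case: eqP => // ->.
- move=> x [/Xab xab /= xc] j; rewrite mxE; case: eqP => [->|_]; last exact: xab.
  by rewrite xc andbT; case/andP: (xab i).
- by move=> j; rewrite mxE; case: eqP => // ->; exact: ltW.
- move=> x [/Xab xab /= /negP]; rewrite -ltNge => xc j.
  rewrite mxE; case: eqP => [->|_]; last exact: xab.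
  by rewrite (ltW xc)/=; case/andP: (xab i).
Qed.

Lemma leb_ext_le_cover (X : set 'rV[R]_d) (F : (set 'rV[R]_d)^nat) :
  X `<=` \bigcup_k F k -> leb_ext X <= \sum_(0 <= k <oo) box_gauge (F k).
Proof. by move=> XF; apply: ereal_inf_lbound; exists F. Qed.

Lemma le_leb_ext (X : set 'rV[R]_d) v :
  (forall F : (set 'rV[R]_d)^nat, X `<=` \bigcup_k F k ->
    v <= \sum_(0 <= k <oo) box_gauge (F k)) -> v <= leb_ext X.
Proof. by move=> vX; apply: le_ereal_inf_tmp => _ [F [_ XF] <-]; exact: vX. Qed.

Lemma measurable_halfspace (i : 'I_d) (c : R) :
  measurable ([set x | x 0%R i <= c]%R : set lebT).
Proof.
apply: le_caratheodory_measurable => X; apply: le_leb_ext => F XF.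
apply: (@le_trans _ _ (\sum_(0 <= k <oo)
   (box_gauge (F k `&` [set x | x 0 i <= c]%R) +
    box_gauge (F k `&` ~` [set x | x 0 i <= c]%R)))); last first.
  by apply: lee_nneseries => k _ *; [rewrite adde_ge0// box_gauge_ge0|exact: box_gauge_split].
rewrite nneseriesD; [|by move=> *; exact: box_gauge_ge0..].
by apply: leeD; apply: leb_ext_le_cover; rewrite -setI_bigcupl; exact: setSI.
Qed.

Lemma measurable_coord (i : 'I_d) : measurable_fun setT (fun x : lebT => x 0%R i).
Proof.
apply: (measurability _ (RGenOInfty.measurableE R)).
move=> _ [_ [c ->] <-]; rewrite setTI.
rewrite (_ : _ @^-1` _ = ~` [set x : lebT | x 0 i <= c]%R).
  by apply: measurableC; exact: measurable_halfspace.
by apply/seteqP; split => x /=; rewrite in_itv/= andbT ltNge => /negP.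
Qed.

Lemma measurable_box (a b : 'rV[R]_d) : measurable (box a b : set lebT).
Proof.
rewrite (_ : box a b = \bigcap_(i in [set: 'I_d])
   ((fun x : lebT => x 0 i) @^-1` `[a 0 i, b 0 i]%classic)%R).
  apply: fin_bigcap_measurable => [|i _]; first exact: finite_finset.
  by rewrite -[X in measurable X]setTI; exact: measurable_coord.
by apply/seteqP; split => x /= xab i; [move=> _|]; have := xab i; rewrite /= in_itv//=; exact.
Qed.

Definition obox (a b : 'rV[R]_d) : set 'rV[R]_d :=
  [set x | forall i, (a 0 i < x 0 i < b 0 i)%R].

Lemma measurable_obox (a b : 'rV[R]_d) : measurable (obox a b : set lebT).
Proof.
rewrite (_ : obox a b = \bigcap_(i in [set: 'I_d])
   ((fun x : lebT => x 0 i) @^-1` `]a 0 i, b 0 i[%classic)%R).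
  apply: fin_bigcap_measurable => [|i _]; first exact: finite_finset.
  by rewrite -[X in measurable X]setTI; exact: measurable_coord.
by apply/seteqP; split => x /= xab i; [move=> _|]; have := xab i; rewrite /= in_itv//=; exact.
Qed.

(** Rational corners keep the family of boxes countable, which gives measurability of open sets and
    lets local almost-everywhere statements be glued. Balls of the sup norm are cubes, so a box fits
    into one. *)
Lemma open_rat_box (U : set 'rV[R]_d) x : open U -> U x ->
  exists a b : 'rV[rat]_d, obox (map_mx ratr a) (map_mx ratr b) x /\
    box (map_mx ratr a) (map_mx ratr b) `<=` U.
Proof.
move=> oU Ux; have /nbhs_ballP[e /= e0 eU] := open_nbhs_nbhs (conj oU Ux).
have /choice[a aP] : forall i, exists q : rat, (x 0 i - e < ratr q < x 0 i)%R.
  move=> i; have [|q] := @rat_in_itvoo R (x 0 i - e)%R (x 0 i)%R.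
    by rewrite ltrBlDr ltrDl.
  by rewrite in_itv/= => ?; exists q.
have /choice[b bP] : forall i, exists q : rat, (x 0 i < ratr q < x 0 i + e)%R.
  move=> i; have [|q] := @rat_in_itvoo R (x 0 i)%R (x 0 i + e)%R.
    by rewrite ltrDl.
  by rewrite in_itv/= => ?; exists q.
exists (\row_i a i), (\row_i b i); split.
  move=> i; rewrite !mxE; have /andP[_ ->] := aP i; by have /andP[-> _] := bP i.
move=> y yab; apply: eU; split => // k i; rewrite (ord1 k).
have := yab i; rewrite !mxE => /andP[ay yb].
have /andP[xa _] := aP i; have /andP[_ xb] := bP i.
by rewrite /ball/= ltr_distlC; apply/andP; split; lra.
Qed.

Lemma open_bigcup_box (U : set 'rV[R]_d) : open U ->
  U = \bigcup_(ab in [set ab : 'rV[rat]_d * 'rV[rat]_d |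
        box (map_mx ratr ab.1) (map_mx ratr ab.2) `<=` U])
      obox (map_mx ratr ab.1) (map_mx ratr ab.2).
Proof.
move=> oU; apply/seteqP; split => [x /(open_rat_box oU)[a [b [xab abU]]]|].
  by exists (a, b).
move=> x [[a b]/= abU xab]; apply: abU => i.
by have /andP[/ltW-> /ltW->] := xab i.
Qed.

Lemma open_measurable_leb (U : set 'rV[R]_d) : open U -> measurable (U : set lebT).
Proof.
move=> /open_bigcup_box ->; rewrite bigcup_mkcond.
apply: countable_bigcupT_measurable => [|ab]; first exact: countableP.
by case: ifP => // _; exact: measurable_obox.
Qed.

Lemma leb_box_le (a b : 'rV[R]_d) : (forall i, a 0 i <= b 0 i)%R ->
  leb R d (box a b) <= (\prod_i (b 0 i - a 0 i))%R%:E.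
Proof.
move=> ab; apply: le_trans (_ : \sum_(0 <= k <oo)
    box_gauge (if k == 0%N then box a b else set0) <= _).
  by apply: leb_ext_le_cover => x xab; exists 0%N.
rewrite nneseries_recl//=; last by move=> *; exact: box_gauge_ge0.
rewrite eseries0 ?adde0; last by move=> [|k]// _ _; rewrite box_gauge0.
exact: box_gauge_le.
Qed.

Lemma bounded_sub_box (X : set 'rV[R]_d) : bounded_set X ->
  exists2 c : R, (0 < c)%R & X `<=` box (const_mx (- c)%R) (const_mx c).
Proof.
move=> [c [_ /(_ (`|c| + 1)%R)]].
have -> : (c < `|c| + 1)%R by have := ler_norm c; lra.
move=> /(_ isT) cX.
exists (`|c| + 1)%R; first by rewrite ltr_wpDl.
move=> x /cX /= xc i; rewrite !mxE -ler_norml (le_trans _ xc)//.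
rewrite [leRHS]/Num.norm/= mx_normrE.
exact: (le_bigmax _ (fun j : 'I_1 * 'I_d => `|x j.1 j.2|)%R (0%R, i)).
Qed.

Lemma leb_bounded_lty (X : set 'rV[R]_d) : bounded_set X -> leb R d X < +oo.
Proof.
move=> /bounded_sub_box[c c0 Xc].
apply: le_lt_trans (_ : leb R d (box (const_mx (- c)%R) (const_mx c)) < +oo).
  exact: le_outer_measure.
apply: le_lt_trans (leb_box_le _) (ltry _) => i; rewrite !mxE; lra.
Qed.

Lemma measure_is_complete_leb : measure_is_complete (leb R d).
Proof. exact: measure_is_complete_caratheodory. Qed.

(** A cover of [X] pulls back to a cover of its preimage, and [nu] does not exceed the gauge of any
    member. Comparison with a known measure thus gives the lower bound on [leb_ext], for which
    exhibiting one cover does not suffice. [mu_ext nu] intervenes because the members of a cover are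
    arbitrary sets. *)
Lemma leb_ge_preimage d' (T' : measurableType d') (nu : {measure set T' -> \bar R})
    (r : T' -> 'rV[R]_d) (X : set 'rV[R]_d) :
  (forall a b : 'rV[R]_d, (forall i, a 0 i <= b 0 i)%R ->
    measurable (r @^-1` box a b) /\
    nu (r @^-1` box a b) = (\prod_i (b 0 i - a 0 i))%R%:E) ->
  measurable (r @^-1` X) -> nu (r @^-1` X) <= leb_ext X.
Proof.
move=> nubox mX; apply: le_leb_ext => F XF.
rewrite -(measurable_mu_extE nu mX).
apply: (@le_trans _ _ (\sum_(0 <= k <oo) mu_ext nu (r @^-1` F k))).
  apply: (@le_trans _ _ (mu_ext nu (\bigcup_k (r @^-1` F k)))).
    by apply: le_mu_ext; rewrite -preimage_bigcup; exact: preimage_subset.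
  exact: mu_ext_sigma_subadditive.
apply: lee_nneseries => k _ *; first exact: mu_ext_ge0.
apply: le_box_gauge => [->|a b ab Fab].
  by rewrite preimage_set0 mu_ext0.
have [mab <-] := nubox a b ab.
by rewrite -(measurable_mu_extE nu mab); apply: le_mu_ext; exact: preimage_subset.
Qed.

End lebesgue_measurability.

(** * Nonempty open sets have positive Lebesgue measure *)

Section lebesgue_positivity.
Variables (R : realType) (d : nat).
Local Open Scope ereal_scope.

(** The comparison measure is the twofold or threefold product of the one-dimensional Lebesgue
    measure, carried to row vectors by [r]. *)
Lemma leb_box_ge (a b : 'rV[R]_d) : d = 2%N \/ d = 3%N ->
  (forall i, a 0 i <= b 0 i)%R ->
  (\prod_i (b 0 i - a 0 i))%R%:E <= leb R d (box a b).
Proof.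
pose lam := @lebesgue_measure R.
have lamE (s t : R) : (s <= t)%R -> lam `[s, t]%classic = (t - s)%R%:E.
  move=> st; rewrite /lam lebesgue_measure_itv/= lte_fin.
  by case: ltgtP st => // ->; rewrite subrr.
case => dE; subst d.
- pose r (st : R * R) : 'rV[R]_2 := \row_i (if i == 0%R then st.1 else st.2).
  have rbox (a' b' : 'rV[R]_2) : r @^-1` box a' b' =
      `[a' 0%R 0%R, b' 0%R 0%R]%classic `*` `[a' 0%R 1%R, b' 0%R 1%R]%classic.
    apply/seteqP; split => -[s t] /=.
      by move=> st; have := st 0%R; have := st 1%R; rewrite !mxE/= !in_itv/= => -> ->.
    rewrite !in_itv/= => -[sab tab] i; rewrite mxE.
    by have [->|->] : i = 0%R \/ i = 1%R
      by case: i => -[|[|]]// ?; [left|right]; apply/val_inj.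
  have nubox (a' b' : 'rV[R]_2) : (forall i, a' 0 i <= b' 0 i)%R ->
      measurable (r @^-1` box a' b') /\
      (lam \x lam) (r @^-1` box a' b') = (\prod_i (b' 0 i - a' 0 i))%R%:E.
    move=> ab'; rewrite rbox; split; first exact: measurableX.
    rewrite product_measure1E// [X in X * _]lamE ?ab'// [X in _ * X]lamE ?ab'//.
    rewrite 2!big_ord_recl big_ord0 mulr1 EFinM.
    by have -> : lift ord0 ord0 = 1%R :> 'I_2 by exact/val_inj.
  by move=> ab; have [mab <-] := nubox a b ab; exact: leb_ge_preimage.
- pose r (st : (R * R) * R) : 'rV[R]_3 :=
    \row_i (if i == 0%R then st.1.1 else if i == 1%R then st.1.2 else st.2).
  have rbox (a' b' : 'rV[R]_3) : r @^-1` box a' b' =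
      (`[a' 0%R 0%R, b' 0%R 0%R]%classic `*` `[a' 0%R 1%R, b' 0%R 1%R]%classic)
      `*` `[a' 0%R 2%R, b' 0%R 2%R]%classic.
    apply/seteqP; split => -[[s t] w] /=.
      move=> st; have := st 0%R; have := st 1%R; have := st 2%R.
      by rewrite !mxE/= !in_itv/= => -> -> ->.
    rewrite !in_itv/= => -[[sab tab] wab] i; rewrite mxE.
    by have [->|[->|->]] : i = 0%R \/ i = 1%R \/ i = 2%R
      by case: i => -[|[|[|]]]// ?; [left|right;left|right;right]; apply/val_inj.
  have nubox (a' b' : 'rV[R]_3) : (forall i, a' 0 i <= b' 0 i)%R ->
      measurable (r @^-1` box a' b') /\
      ((lam \x lam) \x lam) (r @^-1` box a' b') = (\prod_i (b' 0 i - a' 0 i))%R%:E.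
    move=> ab'; rewrite rbox; split.
      by apply: measurableX => //; exact: measurableX.
    rewrite product_measure1E//; last exact: measurableX.
    rewrite [X in X * _]product_measure1E//.
    rewrite [X in X * _ * _]lamE ?ab'// [X in _ * X * _]lamE ?ab'// [X in _ * X]lamE ?ab'//.
    rewrite 3!big_ord_recl big_ord0 mulr1 mulrA 2!EFinM.
    have -> : lift ord0 ord0 = 1%R :> 'I_3 by exact/val_inj.
    by have -> : lift ord0 (lift ord0 ord0) = 2%R :> 'I_3 by exact/val_inj.
  by move=> ab; have [mab <-] := nubox a b ab; exact: leb_ge_preimage.
Qed.

Lemma leb_open_gt0 (U : set 'rV[R]_d) : d = 2%N \/ d = 3%N ->
  open U -> U !=set0 -> 0 < leb R d U.
Proof.
move=> hd oU [x Ux]; have [a [b [xab abU]]] := open_rat_box oU Ux.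
apply: (@lt_le_trans _ _ (leb R d (box (map_mx ratr a) (map_mx ratr b)))); last first.
  exact: le_outer_measure.
apply: lt_le_trans (leb_box_ge hd _).
  rewrite lte_fin prodr_gt0// => i _; rewrite subr_gt0.
  by have /andP[] := xab i; exact: lt_trans.
by move=> i; have /andP[ax xb] := xab i; apply/ltW; exact: lt_trans xb.
Qed.

End lebesgue_positivity.

(** * Compactly supported C^1 functions *)

Lemma Rintegral_measure_preserving d (T : measurableType d) (R : realType)
    (mu : {measure set T -> \bar R}) (phi : T -> T) (f : T -> R) :
  measurable_fun setT phi -> (forall A, measurable A -> mu (phi @^-1` A) = mu A) ->
  measurable_fun setT f -> mu.-integrable setT (EFin \o (f \o phi)) ->
  \int[mu]_x f (phi x) = \int[mu]_x f x.
Proof.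
move=> mphi muphi mf ifphi; rewrite /Rintegral; congr fine.
have mEf : measurable_fun setT (EFin \o f) by exact/measurable_EFinP.
have := integral_pushforward mphi mEf ifphi measurableT.
rewrite preimage_setT => E; rewrite -[LHS]E.
apply: eq_measure_integral => // A mA _.
exact: muphi.
Qed.

(** * Translation invariance of Lebesgue measure *)

Section translation.
Variables (R : realType) (d : nat).
Local Notation lebT := (caratheodory_type (leb_outer R d)).
Implicit Types t : 'rV[R]_d.

Lemma box_gauge_preimage_shift t (X : set 'rV[R]_d) :
  (box_gauge ((fun x => x + t)%R @^-1` X) <= box_gauge X)%E.
Proof.
apply: le_box_gauge => [->|a b ab Xab].
  by rewrite preimage_set0 box_gauge0.
have -> : \prod_i (b 0 i - a 0 i) = \prod_i ((b - t) 0 i - (a - t) 0 i).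
  by apply: eq_bigr => i _; rewrite !mxE; ring.
apply: box_gauge_le => [i|x /= /Xab xab i].
  by rewrite !mxE lerD2r.
by have := xab i; rewrite !mxE lerBlDr lerBrDr.
Qed.

Lemma leb_ext_preimage_shift t (X : set 'rV[R]_d) :
  leb_ext ((fun x => x + t) @^-1` X) = leb_ext X.
Proof.
have le s Y : (leb_ext ((fun x : 'rV[R]_d => x + s)%R @^-1` Y) <= leb_ext Y)%E.
  apply: le_leb_ext => F YF.
  apply: (@le_trans _ _ (\sum_(0 <= k <oo) box_gauge ((fun x => x + s)%R @^-1` F k))%E).
    by apply: leb_ext_le_cover; rewrite -preimage_bigcup; exact: preimage_subset.
  by apply: lee_nneseries => k _ *; [exact: box_gauge_ge0|exact: box_gauge_preimage_shift].
apply/eqP; rewrite eq_le le/=.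
apply: le_trans (le (- t) ((fun x => x + t) @^-1` X)).
rewrite -comp_preimage (_ : _ \o _ = id)//.
by apply/funext => x /=; rewrite subrK.
Qed.

(** The target carries the Caratheodory sigma-algebra, so generators are of no help; the criterion
    for the preimage of [A] at a test set is the criterion for [A] at the translated test set. *)
Lemma measurable_shift t : measurable_fun setT (fun x : lebT => (x : 'rV[R]_d) + t : lebT).
Proof.
move=> _ A mA; have {}mA : caratheodory_measurable (@leb_ext R d) A by exact: mA.
rewrite setTI.
suff: caratheodory_measurable (@leb_ext R d) ((fun x => x + t) @^-1` A) by [].
move=> X.
have XE : X = (fun x => x + t) @^-1` ((fun x => x - t) @^-1` X).
  rewrite -comp_preimage (_ : _ \o _ = id)//.
  by apply/funext => x /=; rewrite addrK.
rewrite XE preimage_setC -!preimage_setI !leb_ext_preimage_shift.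
rewrite -(leb_ext_preimage_shift (- t) X); exact: mA.
Qed.

Lemma Rintegral_shift t (f : 'rV[R]_d -> R) :
  measurable_fun setT (f : lebT -> R) ->
  (leb R d).-integrable setT (EFin \o (fun x => f (x + t))) ->
  \int[leb R d]_x f (x + t) = \int[leb R d]_x f x.
Proof.
move=> mf ift; apply: (Rintegral_measure_preserving (measurable_shift t) _ mf ift).
by move=> A _; exact: leb_ext_preimage_shift.
Qed.

End translation.

Section C1_functions.
Variables (R : realType) (d : nat).
Implicit Types f g : 'rV[R]_d -> R.

Lemma C1fun_continuous f : C1fun f -> continuous f.
Proof. by move=> [df _] x; exact: differentiable_continuous. Qed.

Lemma C1fun_cst (c : R) : C1fun (fun _ : 'rV[R]_d => c).
Proof.
split=> [x|i]; first exact: differentiable_cst.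
rewrite (_ : partial i _ = cst 0); first exact: cst_continuous.
by apply/funext => x; rewrite /partial derive_cst.
Qed.

Lemma partialM i f g x : C1fun f -> C1fun g ->
  partial i (fun x => f x * g x) x = f x * partial i g x + g x * partial i f x.
Proof.
by move=> [df _] [dg _]; rewrite /partial deriveM//; exact: diff_derivable.
Qed.

Lemma C1funM f g : C1fun f -> C1fun g -> C1fun (fun x => f x * g x).
Proof.
move=> Cf Cg; have [df pf] := Cf; have [dg pg] := Cg.
split=> [x|i]; first exact: differentiableM.
rewrite (_ : partial i _ = fun x => f x * partial i g x + g x * partial i f x).
  move=> x; apply: (@continuousD _ _ _ (fun x => f x * partial i g x)
    (fun x => g x * partial i f x)); apply: continuousM.
  - exact: C1fun_continuous.
  - exact: pg.
  - exact: C1fun_continuous.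
  - exact: pf.
by apply/funext => x; exact: partialM.
Qed.

Lemma C1funB f g : C1fun f -> C1fun g -> C1fun (fun x => f x - g x).
Proof.
move=> [df pf] [dg pg]; split=> [x|i]; first exact: differentiableB.
rewrite (_ : partial i _ = fun x => partial i f x - partial i g x).
  move=> x; apply: (@continuousB _ _ _ (partial i f) (partial i g)).
  - exact: pf.
  - exact: pg.
by apply/funext => x; rewrite /partial deriveB//; exact: diff_derivable.
Qed.

Lemma C1funX f n : C1fun f -> C1fun (fun x => f x ^+ n).
Proof.
move=> Cf; elim: n => [|n ih].
  by under eq_fun do rewrite expr0; exact: C1fun_cst.
by under eq_fun do rewrite exprS; exact: C1funM.
Qed.

Lemma C1fun_prod (I : Type) (s : seq I) (F : I -> 'rV[R]_d -> R) :
  (forall i, C1fun (F i)) -> C1fun (fun x => \prod_(i <- s) F i x).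
Proof.
move=> CF; elim: s => [|i s ih].
  by under eq_fun do rewrite big_nil; exact: C1fun_cst.
by under eq_fun do rewrite big_cons; exact: C1funM.
Qed.

(** Serves for the truncated square [posq]: one remainder estimate treats all points alike,
    including the one where the truncation sets in. *)
Lemma is_derive_quadratic (k : R -> R) (t l C : R) :
  (forall u, `|k (t + u) - k t - l * u| <= C * u ^+ 2) -> is_derive t 1 k l.
Proof.
move=> kC; have C0 : 0 <= C by have := le_trans (normr_ge0 _) (kC 1); rewrite expr1n mulr1.
suff cv : h^-1 *: ((k \o shift t) (h *: (1 : R)) - k t) @[h --> 0^'] --> l.
  by apply: DeriveDef; [apply/cvg_ex; exists l|exact/cvg_lim].
apply/cvgrPdist_le => e e0; near=> h.
have h0 : h != 0 by near: h; exact: nbhs_dnbhs_neq.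
have hC : `|h| <= e / (C + 1).
  by near: h; apply: dnbhs0_le; rewrite divr_gt0// ltr_wpDl.
rewrite /= [_ *: (1 : R)]mulr1 -[_ *: _]/(_ * _).
rewrite (_ : _ - _ = - (h^-1 * (k (t + h) - k t - l * h))); last first.
  by rewrite [h + t]addrC; field.
rewrite normrN normrM normfV ler_pdivrMl ?normr_gt0//.
apply: le_trans (kC h) _; rewrite -real_normK ?num_real// expr2 mulrCA.
rewrite ler_wpM2l//; apply: le_trans (_ : (C + 1) * (e / (C + 1)) <= _).
  by rewrite ler_pM// ?lerDl.
by rewrite mulrC divfK// gt_eqF// ltr_wpDl.
Unshelve. all: by end_near. Qed.

Lemma C1fun_coord (i : 'I_d) (k k' : R -> R) :
  (forall t : R, is_derive t 1 k (k' t)) -> continuous k' ->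
  C1fun (fun x => k (x 0 i)).
Proof.
move=> dk ck'; split=> [x|j].
  apply: differentiable_comp; first exact: differentiable_coord.
  by apply/derivable1_diffP; case: (dk (x 0 i)).
rewrite (_ : partial j _ = fun x => (j == i)%:R * k' (x 0 i)).
  move=> x; apply: (@continuousM _ _ (fun=> (j == i)%:R)
    (fun x : 'rV[R]_d => k' (x 0 i))); first exact: cst_continuous.
  apply: (@continuous_comp _ _ _ (fun x : 'rV[R]_d => x 0 i) k').
  - exact: coord_continuous.
  - exact: ck'.
apply/funext => x; rewrite /partial /derive.
have [->|ji] := eqVneq j i.
  have [_ <-] := dk (x 0 i); rewrite mul1r /derive.
  rewrite (_ : (fun h : R => _) = (fun h => h^-1 *: ((k \o shift (x 0 i)) (h *: 1) - k (x 0 i))))//.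
  by apply/funext => h /=; rewrite !mxE !eqxx.
rewrite mul0r (_ : (fun h => _) = cst 0) ?lim_cst//.
apply/funext => h /=; rewrite !mxE [i == j]eq_sym (negbTE ji) andbF mulr0 add0r.
by rewrite subrr scaler0.
Qed.

(** The squared positive part of an affine function is of class C^1 and, for [s = 1] or [s = -1],
    positive exactly on an open half-line. Products of such functions are C^1 and positive exactly
    on an open box. *)
Definition posq (s c t : R) : R := (Num.max (s * t + c) 0) ^+ 2.

Lemma posq_gt0 s c t : 0 < s * t + c -> 0 < posq s c t.
Proof. by move=> h; rewrite /posq exprn_gt0// lt_max h. Qed.

Lemma posq_eq0 s c t : s * t + c <= 0 -> posq s c t = 0.
Proof. by move=> h; rewrite /posq max_r// expr0n. Qed.

Lemma posq_ge0 s c t : 0 <= posq s c t.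
Proof. exact: sqr_ge0. Qed.

Lemma posq_le s c t B : 0 <= B -> s * t + c <= B -> posq s c t <= B ^+ 2.
Proof. by move=> B0 h; rewrite /posq lerXn2r ?nnegrE// ?le_max ?lexx ?orbT// ge_max h. Qed.

Lemma C1fun_posq (i : 'I_d) (s c : R) : C1fun (fun x => posq s c (x 0 i)).
Proof.
apply: (@C1fun_coord _ _ (fun t => 2 * s * Num.max (s * t + c) 0)) => t.
  apply: (@is_derive_quadratic _ _ _ (s ^+ 2)) => u; rewrite /posq.
  have -> : s * (t + u) + c = (s * t + c) + s * u by ring.
  have -> : 2 * s * Num.max (s * t + c) 0 * u = 2 * Num.max (s * t + c) 0 * (s * u) by ring.
  have -> : s ^+ 2 * u ^+ 2 = (s * u) ^+ 2 by ring.
  move: (s * t + c) (s * u) => y z; rewrite ler_norml.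
  by apply/andP; split; case: (leP (y + z) 0) => yz; case: (leP y 0) => y0; nra.
apply: (@continuousM _ _ (fun=> 2 * s) (fun t => Num.max (s * t + c) 0)).
  exact: cst_continuous.
apply: (@continuous_max _ _ (fun t => s * t + c) (fun=> 0)); last exact: cst_continuous.
apply: (@continuousD _ _ _ (fun t : R => s * t) (fun=> c)); last exact: cst_continuous.
exact: mulrl_continuous.
Qed.

End C1_functions.

Section integral_convergence.
Context d (T : measurableType d) (R : realType) (mu : {measure set T -> \bar R}).

Lemma Rintegral_dominated_cvg (D : set T) (q : (T -> R)^nat) (p g : T -> R) :
  measurable D -> (forall n, measurable_fun D (q n)) -> measurable_fun D p ->
  (\forall x \ae mu, D x -> q n x @[n --> \oo] --> p x) ->
  mu.-integrable D (EFin \o g) -> (\forall x \ae mu, D x -> forall n, `|q n x| <= g x) ->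
  \int[mu]_(x in D) q n x @[n --> \oo] --> \int[mu]_(x in D) p x.
Proof.
move=> mD mq mp qp ig qg.
have [|||||ip _ cv] := @dominated_convergence _ _ _ mu _ mD
    (fun n => EFin \o q n) (EFin \o p) (EFin \o g).
- by move=> n; exact/measurable_EFinP.
- exact/measurable_EFinP.
- apply: filterS qp => x + Dx => /(_ Dx) qpx.
  by apply/fine_cvgP; split; [exact: nearW|exact: qpx].
- exact: ig.
- by apply: filterS qg => x + n Dx => /(_ Dx n); rewrite /= lee_fin.
by apply: fine_cvg; rewrite fineK//; exact: integrable_fin_num.
Qed.

Lemma integrable_cst_indic (B : set T) (C : R) : measurable B -> (mu B < +oo)%E ->
  mu.-integrable setT (EFin \o (fun x => C * \1_B x)).
Proof.
move=> mB Bfin; apply: integrableZl_EFin => //; apply/integrableP; split.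
  by apply/measurable_EFinP; exact: measurable_indic.
rewrite (eq_integral (fun x => (\1_B x)%:E)).
  by rewrite integral_indic// setIT.
by move=> x _ /=; rewrite ger0_norm.
Qed.

Lemma bounded_support_integrable (B : set T) (f : T -> R) (C : R) :
  measurable B -> (mu B < +oo)%E -> measurable_fun setT f ->
  (forall x, `|f x| <= C) -> (forall x, ~ B x -> f x = 0) ->
  mu.-integrable setT (EFin \o f).
Proof.
move=> mB Bfin mf fC fB; apply: (ae_le_integrable measurableT mf).
  exact: (integrable_cst_indic C mB Bfin).
apply: aeW => x _; rewrite indicE.
by case: (boolP (x \in B)) => [_|/negP /[!inE] /fB ->]; rewrite ?mulr1// normr0 mulr0.
Qed.

End integral_convergence.

Section compact_support.
Variables (R : realType) (d : nat).
Local Notation lebT := (caratheodory_type (leb_outer R d)).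
Implicit Types f g : 'rV[R]_d -> R.

Lemma continuous_measurable_leb f : continuous f -> measurable_fun setT (f : lebT -> R).
Proof.
move=> /continuousP cf; apply: (measurability _ (RGenOInfty.measurableE R)).
move=> _ [_ [c ->] <-]; rewrite setTI; apply: open_measurable_leb.
exact: cf.
Qed.

Lemma compact_support_bounded f (K : set 'rV[R]_d) : continuous f -> compact K ->
  (forall x, ~ K x -> f x = 0) -> exists C, forall x, `|f x| <= C.
Proof.
move=> cf cK fK.
have [C [_ CP]] : bounded_set (f @` K).
  by apply: compact_bounded; apply: continuous_compact => //; exact: continuous_subspaceT.
exists (`|C| + 1) => x; have [Kx|/fK->] := pselect (K x); last by rewrite normr0.
by apply: (CP (`|C| + 1)) => //; have := ler_norm C; lra.
Qed.

Lemma compact_measurable_leb (K : set 'rV[R]_d) : compact K ->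
  measurable (K : set lebT) /\ (leb R d K < +oo)%E.
Proof.
move=> cK; split; last by apply: leb_bounded_lty; exact: compact_bounded.
rewrite -[K]setCK; apply: measurableC; apply: open_measurable_leb.
by apply: closed_openC; apply: compact_closed.
Qed.

Lemma partial_support i f (K : set 'rV[R]_d) x : compact K ->
  (forall x, ~ K x -> f x = 0) -> ~ K x -> partial i f x = 0.
Proof.
move=> cK fK Kx; rewrite /partial -(derive_cst (0 : R) x (delta_mx 0 i : 'rV[R]_d)).
apply: near_eq_derive; apply: (@filterS _ _ _ (~` K)) => [y /fK ->//|].
apply: open_nbhs_nbhs; split=> //; apply: closed_openC.
by apply: compact_closed.
Qed.

Lemma C1fun_quotient_le f i (C : R) : C1fun f -> (forall x, `|partial i f x| <= C) ->
  forall (x : 'rV[R]_d) s, 0 <= s -> `|f (x + s *: delta_mx 0 i) - f x| <= C * s.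
Proof.
move=> [df _] fC x s s0; pose e : 'rV[R]_d := delta_mx 0 i.
pose phi (r : R) := f (x + r *: e).
have dphi (r : R) : is_derive r 1 phi (partial i f (x + r *: e)).
  have E : (fun h : R => h^-1 *: ((phi \o shift r) (h *: (1 : R)) - phi r)) =
      (fun h => h^-1 *: ((f \o shift (x + r *: e)) (h *: e) - f (x + r *: e))).
    by apply/funext => h /=; rewrite /phi [_ *: (1 : R)]mulr1 addrCA scalerDl.
  by apply: DeriveDef; rewrite /derivable /derive E//; exact: diff_derivable.
have [|c _] := MVT_segment s0 (fun r _ => dphi r).
  apply: continuous_subspaceT => r; apply: differentiable_continuous.
  by apply/derivable1_diffP; case: (dphi r).
rewrite /phi scale0r addr0 subr0 => ->.
by rewrite normrM (ger0_norm s0) ler_wpM2r.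
Qed.

(** By translation invariance the difference quotients have integral zero. They converge to the
    partial derivative, are uniformly bounded by the mean value theorem and live on a common box.
    This is the form of the divergence theorem behind integration by parts. *)
Lemma Rintegral_partial_eq0 f i (K : set 'rV[R]_d) : C1fun f -> compact K ->
  (forall x, ~ K x -> f x = 0) ->
  (leb R d).-integrable setT (EFin \o partial i f) /\
  \int[leb R d]_x partial i f x = 0.
Proof.
move=> Cf cK fK; have [df pf] := Cf; pose e : 'rV[R]_d := delta_mx 0 i.
have cf := C1fun_continuous Cf.
have pK x : ~ K x -> partial i f x = 0 by exact: partial_support.
have [C fC] := compact_support_bounded cf cK fK.
have [C' pC] := compact_support_bounded (pf i) cK pK.
have C'0 : 0 <= C' by exact: le_trans (pC 0).
have [mK Kfin] := compact_measurable_leb cK.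
have mf : measurable_fun setT (f : lebT -> R) by exact: continuous_measurable_leb.
have mp : measurable_fun setT (partial i f : lebT -> R).
  by apply: continuous_measurable_leb; exact: pf.
split; first exact: bounded_support_integrable mK Kfin mp pC pK.
have if_ : (leb R d).-integrable setT (EFin \o f).
  exact: bounded_support_integrable mK Kfin mf fC fK.
have ifs t : (leb R d).-integrable setT (EFin \o (fun x => f (x + t))).
  apply: (@bounded_support_integrable _ lebT R (leb R d)
    (((fun x => x + t) @^-1` K) : set lebT) (fun x => f (x + t)) C).
  - rewrite -[X in measurable X]setTI.
    exact: (measurable_shift t).
  - by rewrite [ltLHS]leb_ext_preimage_shift.
  - exact: (measurableT_comp mf (measurable_shift t)).
  - by move=> x; exact: fC.
  - by move=> x /fK.
have [c c0 Kc] := bounded_sub_box (compact_bounded cK).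
(* The box around [K] is enlarged by 1 because the increments [1 / (n + 1)] are at most 1. *)
pose B := box (const_mx (- (c + 1)) : 'rV[R]_d) (const_mx (c + 1)).
have Bfin : (leb R d B < +oo)%E.
  by apply: le_lt_trans (leb_box_le _) (ltry _) => j; rewrite !mxE; lra.
have mB : measurable (B : set lebT) by exact: measurable_box.
pose q n x := n.+1%:R * (f (x + n.+1%:R^-1 *: e) - f x).
have qC n x : `|q n x| <= C' * \1_B x.
  rewrite indicE; case: (boolP (x \in B)) => [_|/negP /[!inE] xB].
    rewrite mulr1 /q normrM ger0_norm// mulrC -ler_pdivlMr ?ltr0n//.
    by apply: C1fun_quotient_le => //; rewrite invr_ge0.
  rewrite mulr0 /q !fK ?subrr ?mulr0 ?normr0//.
    by move=> /Kc xc; apply: xB => j; have := xc j; rewrite !mxE => /andP[? ?]; apply/andP; split; lra.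
  move=> /Kc xc; apply: xB => j; have := xc j; rewrite !mxE /=.
  have : 0 <= (n.+1%:R^-1 : R) * (j == i)%:R <= 1.
    case: (j == i); rewrite /= ?mulr1n ?mulr0n ?mulr0 ?lexx ?ler01// mulr1.
    by rewrite invr_ge0 ler0n invf_le1 ?ler1n ?ltr0n.
  move: (_ * _) => t /andP[h1 h2] /andP[h3 h4]; apply/andP; split; lra.
have iq n : (leb R d).-integrable setT (EFin \o q n).
  by apply: integrableZl_EFin => //; apply: integrableB_EFin.
have Iq n : \int[leb R d]_x q n x = 0.
  rewrite RintegralZl//; last by apply: integrableB_EFin.
  rewrite RintegralB// Rintegral_shift// ?subrr ?mulr0//.
have iB : (leb R d).-integrable setT (EFin \o (fun x => C' * \1_B x)).
  exact: integrable_cst_indic.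
have qp (x : 'rV[R]_d) : q n x @[n --> \oo] --> partial i f x.
  have n1 : (forall n, (n.+1%:R^-1 : R) != 0) /\ (n.+1%:R^-1 : R) @[n --> \oo] --> (0 : R).
    by split=> [n|]; [rewrite invr_eq0 pnatr_eq0|exact: cvg_harmonic].
  have /cvgr_dnbhsP /(_ _ n1) := diff_derivable (v := e) (df x).
  apply: cvg_trans; rewrite (_ : (fun n => q n x) = (fun n => (n.+1%:R^-1)^-1 *:
      ((f \o shift x) (n.+1%:R^-1 *: e) - f x)))//.
  by apply/funext => n /=; rewrite /q invrK [X in f X]addrC.
suff cv : \int[leb R d]_x q n x @[n --> \oo] --> \int[leb R d]_x partial i f x.
  apply: (cvg_unique _ cv) => //; rewrite (_ : (fun n => _) = cst 0); first exact: cvg_cst.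
  by apply/funext => n; exact: Iq.
apply: (@Rintegral_dominated_cvg _ lebT R (leb R d) setT q (partial i f) _ measurableT
  (fun n => integrable_measurable (iq n)) mp _ iB).
- by apply: aeW => x _; exact: qp.
- by apply: aeW => x _ n.
Qed.

End compact_support.

(** * The du Bois-Reymond lemma *)

Lemma Rintegral_eq0_integral d (T : measurableType d) (R : realType)
    (mu : {measure set T -> \bar R}) (A : set T) (f : T -> R) :
  measurable A -> mu.-integrable A (EFin \o f) ->
  \int[mu]_(x in A) f x = 0 -> (\int[mu]_(x in A) (f x)%:E)%E = 0%E.
Proof.
move=> mA iA; rewrite /Rintegral => A0.
by rewrite -(fineK (integrable_fin_num mA iA)) [fine _]A0.
Qed.

(** * Functions whose integrals vanish on a pi-system *)

Section vanishing_integrals.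
Context d (T : measurableType d) (R : realType) (mu : {measure set T -> \bar R}).
Variables (G : set (set T)) (Q : set T) (w : T -> R).
Hypotheses (mQ : measurable Q) (iw : mu.-integrable Q (EFin \o w)).
Hypothesis mG : G `<=` measurable.
Hypothesis GI : setI_closed G.

Let integrableIQ A : measurable A -> mu.-integrable (A `&` Q) (EFin \o w).
Proof. by move=> mA; apply: integrableS iw => //; exact: measurableI. Qed.

(** Pi-lambda theorem: the measurable sets with vanishing integral form a Dynkin class that contains
    the intersection-stable family [G]. *)
Lemma Rintegral_sigma_algebra_eq0 : \int[mu]_(x in Q) w x = 0 ->
  (forall A, G A -> \int[mu]_(x in A `&` Q) w x = 0) ->
  forall B, <<s G >> B -> measurable B /\ \int[mu]_(x in B `&` Q) w x = 0.
Proof.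
move=> Q0 G0; rewrite -setI_closed_g_dynkin_g_sigma_algebra//.
pose H := [set B | measurable B /\ \int[mu]_(x in B `&` Q) w x = 0].
suff : <<d G >> `<=` H by [].
apply: smallest_sub; last by move=> A GA; split; [exact: mG|exact: G0].
split.
- by split; [exact: measurableT|rewrite setTI].
- move=> A [mA A0]; split; first exact: measurableC.
  have QE : Q = (A `&` Q) `|` (~` A `&` Q) by rewrite -setIUl setUCr setTI.
  rewrite -Q0 [in RHS]QE Rintegral_setU ?A0 ?add0r//.
  + exact: measurableI.
  + by apply: measurableI => //; exact: measurableC.
  + by rewrite -QE.
  + by apply/disj_setPS => x [[Ax _] []].
- move=> F tF HF; have mF k := (HF k).1; split; first exact: bigcupT_measurable.
  rewrite /Rintegral setI_bigcupl integral_bigcup.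
  + rewrite eseries0// => k _ _; apply: Rintegral_eq0_integral (HF k).2.
    * exact: measurableI.
    * exact: integrableIQ.
  + exact: trivIset_setIr.
  + by move=> k; exact: measurableI.
  + by rewrite -setI_bigcupl; apply: integrableIQ; exact: bigcupT_measurable.
Qed.

(** It suffices that [w] has integral 0 over every measurable subset of [Q]. Such a subset need not
    lie in the generated sigma-algebra, but it is enclosed in a member of it up to a null set, which
    leaves the integral unchanged. *)
Lemma ae_eq0_sigma_algebra : \int[mu]_(x in Q) w x = 0 ->
  (forall A, G A -> \int[mu]_(x in A `&` Q) w x = 0) ->
  (forall E, measurable E -> E `<=` Q ->
     exists B, [/\ <<s G >> B, E `<=` B & mu (B `\` E) = 0%E]) ->
  \forall x \ae mu, Q x -> w x = 0.
Proof.
move=> Q0 G0 reg.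
suff : ae_eq mu Q (EFin \o w) (cst 0%E).
  by apply: filterS => x /= + Qx => /(_ Qx) [].
apply: (integral_ae_eq mQ iw); first exact: measurable_cst.
move=> E EQ mE; rewrite integral0.
have [B [GB EB BE0]] := reg E mE EQ.
have [mB IB] := Rintegral_sigma_algebra_eq0 Q0 G0 GB.
have mBE : measurable ((B `\` E) `&` Q) by apply: measurableI => //; exact: measurableD.
have -> : (\int[mu]_(x in E) (EFin \o w) x = \int[mu]_(x in B `&` Q) (EFin \o w) x)%E.
  have BQE : B `&` Q = E `|` ((B `\` E) `&` Q).
    apply/seteqP; split => x.
      by move=> [Bx Qx]; have [Ex|nEx] := pselect (E x); [left|right].
    by move=> [Ex|[[Bx _] Qx]]; split => //; [exact: EB|exact: EQ].
  have iBQ := integrableIQ mB.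
  rewrite [in RHS]BQE [RHS](negligible_integral (N := (B `\` E) `&` Q)).
  - congr integral; apply/seteqP; split => x; last by move=> [[Ex|h] nh] //; case: nh.
    by move=> Ex; split; [left|move=> [[]]].
  - exact: mBE.
  - exact: measurableU.
  - by rewrite -BQE.
  - apply/eqP; rewrite -measure_le0 -BE0; apply: le_measure; rewrite ?inE//.
    exact: measurableD.
apply: Rintegral_eq0_integral IB; first exact: measurableI.
exact: integrableIQ.
Qed.

End vanishing_integrals.

(** * Outer regularity of Lebesgue measure *)

Section outer_regularity.
Variables (R : realType) (d : nat).
Local Notation lebT := (caratheodory_type (leb_outer R d)).

Definition oboxes : set (set 'rV[R]_d) :=
  [set A | exists a b : 'rV[R]_d, A = obox a b].

Lemma obox_setI (a b a' b' : 'rV[R]_d) : obox a b `&` obox a' b' =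
  obox (\row_i Num.max (a 0 i) (a' 0 i)) (\row_i Num.min (b 0 i) (b' 0 i)).
Proof.
apply/seteqP; split => x.
  move=> [xab xab'] i; rewrite !mxE gt_max lt_min.
  by have /andP[-> ->] := xab i; have /andP[-> ->] := xab' i.
by move=> xab; split => i; have := xab i; rewrite !mxE gt_max lt_min =>
  /andP[/andP[h1 h2] /andP[h3 h4]]; apply/andP; split.
Qed.

Lemma oboxes_setI_closed : setI_closed oboxes.
Proof. by move=> _ _ [a [b ->]] [a' [b' ->]]; rewrite obox_setI; eexists; eexists. Qed.

Lemma box_sigma_oboxes (a b : 'rV[R]_d) : <<s oboxes >> (box a b).
Proof.
suff : oboxes.-sigma.-measurable (box a b) by [].
rewrite (_ : box a b = \bigcap_n obox (a - const_mx n.+1%:R^-1) (b + const_mx n.+1%:R^-1)).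
  apply: bigcapT_measurable => n; apply: sub_sigma_algebra.
  by eexists; eexists.
apply/seteqP; split => x xab.
  move=> n _ i; rewrite !mxE; have /andP[ax xb] := xab i.
  have n0 : 0 < n.+1%:R^-1 :> R by rewrite invr_gt0.
  by move: n.+1%:R^-1 n0 => t t0; apply/andP; split; lra.
have h i n : a 0 i - n.+1%:R^-1 < x 0 i < b 0 i + n.+1%:R^-1.
  by have := xab n I i; rewrite !mxE.
move=> i; apply/andP; split; rewrite leNgt; apply/negP => lt.
- have [n nP] := ltr_add_invr lt.
  by have /andP[+ _] := h i n; rewrite ltrBlDr ltNge (ltW nP).
- have [n nP] := ltr_add_invr lt.
  by have /andP[_] := h i n; rewrite ltNge (ltW nP).
Qed.

(** Half of [e] pays for a near-optimal cover by arbitrary sets; the other half, distributed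
    geometrically, pays for enclosing each member in a box. *)
Lemma leb_cover_adherent (E : set 'rV[R]_d) (e : R) : 0 < e -> (leb_ext E < +oo)%E ->
  exists C : (set 'rV[R]_d)^nat, [/\ forall k, C k = set0 \/ exists a b, C k = box a b,
    E `<=` \bigcup_k C k & (\sum_(0 <= k <oo) leb R d (C k) <= leb_ext E + e%:E)%E].
Proof.
move=> e0 Efin.
have e2 : 0 < e / 2 by rewrite divr_gt0.
have Efn : leb_ext E \is a fin_num by rewrite ge0_fin_numE// mu_ext_ge0// => ?; exact: box_gauge_ge0.
have [_ [F [_ EF] <-] Fe] := lb_ereal_inf_adherent e2 Efn.
have gF k : (box_gauge (F k) < +oo)%E.
  apply: le_lt_trans (lt_le_trans Fe (leey _)).
  have g0 n : (0 <= box_gauge (F n))%E by exact: box_gauge_ge0.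
  by rewrite (@nneseriesD1 _ _ k)// leeDl// nneseries_ge0.
have /choice[C CP] : forall k, exists B, [/\ B = set0 \/ exists a b, B = box a b,
    F k `<=` B & (leb R d B <= box_gauge (F k) + (e / 2 / (2 ^ k.+1)%:R)%:E)%E].
  move=> k; have ek : 0 < e / 2 / (2 ^ k.+1)%:R by rewrite divr_gt0// ltr0n expn_gt0.
  (* The gauge of the empty set is 0 by convention and not an infimum over boxes. *)
  have [F0|F0] := pselect (F k = set0).
    exists set0; split; [by left|by rewrite F0|].
    by rewrite measure0 adde_ge0 ?box_gauge_ge0// lee_fin ltW.
  have := gF k; have := box_gauge_ge0 (F k); rewrite /box_gauge; case: asboolP => // _ g0 gy.
  have gfin := ge0_fin_numE g0; rewrite gy in gfin.
  have [_ [a [b [ab Fab ->]]] lt] := lb_ereal_inf_adherent ek gfin.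
  exists (box a b); split => //; first by right; exists a, b.
  exact: le_trans (leb_box_le ab) (ltW lt).
exists C; split.
- by move=> k; case: (CP k).
- by move=> x /EF[k _ Fx]; exists k => //; have [_ + _] := CP k; exact.
- apply: (@le_trans _ _ (\sum_(0 <= k <oo)
      (box_gauge (F k) + (e / 2 / (2 ^ k.+1)%:R)%:E))%E).
    by apply: lee_nneseries => k _ *; [exact: measure_ge0|case: (CP k)].
  apply: le_trans (epsilon_trick _ _ (ltW e2)) _; first by move=> ?; exact: box_gauge_ge0.
  rewrite [e in leRHS]splitr EFinD addeA leeD2r//.
  exact: ltW.
Qed.

(** [B] is the intersection of countably many near-optimal box covers, the n-th with slack
    [1 / (n + 1)]. *)
Lemma leb_outer_regular (E : set 'rV[R]_d) : (leb_ext E < +oo)%E ->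
  exists B, [/\ <<s oboxes >> B, E `<=` B & (leb R d B <= leb_ext E)%E].
Proof.
move=> Efin.
have /choice[C CP] : forall n, exists C : (set 'rV[R]_d)^nat,
    [/\ forall k, C k = set0 \/ exists a b, C k = box a b,
    E `<=` \bigcup_k C k & (\sum_(0 <= k <oo) leb R d (C k) <= leb_ext E + n.+1%:R^-1%:E)%E].
  by move=> n; apply: leb_cover_adherent => //; rewrite invr_gt0.
have mC n k : <<s oboxes >> (C n k).
  have [/(_ k)[->|[a [b ->]]] _ _] := CP n; last exact: box_sigma_oboxes.
  exact: sigma_algebra0.
pose U n := \bigcup_k C n k.
have mU n : oboxes.-sigma.-measurable (U n) by apply: bigcupT_measurable => k; exact: mC.
exists (\bigcap_n U n); split.
- suff : oboxes.-sigma.-measurable (\bigcap_n U n) by [].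
  exact: bigcapT_measurable.
- by move=> x Ex n _; have [_ + _] := CP n; exact.
- apply/lee_addgt0Pr => e e0; have [n nP] := ltr_add_invr e0.
  apply: (@le_trans _ _ (\sum_(0 <= k <oo) leb R d (C n k))%E).
    apply: (@le_trans _ _ (leb R d (U n))).
      by apply: (@le_outer_measure _ _ (leb_outer R d)) => x; exact.
    exact: (@outer_measure_sigma_subadditive _ _ (leb_outer R d)).
  have [_ _ h] := CP n; apply: le_trans h _.
  by rewrite leeD2l// lee_fin ltW// -[ltLHS]add0r.
Qed.

End outer_regularity.

Section du_bois_reymond.
Variables (R : realType) (d : nat).
Local Notation lebT := (caratheodory_type (leb_outer R d)).
Implicit Types (a b x : 'rV[R]_d).

Definition bump a b x : R :=
  \prod_i (posq 1 (- a 0 i) (x 0 i) * posq (-1) (b 0 i) (x 0 i)).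

(** With [t] the bump divided by an upper bound, [1 - (1 - t) ^+ n] stays in [[0, 1]] and tends to
    the indicator of [t > 0], that is, of the open box. The fourth power bounds the two squared
    factors that each coordinate contributes to [bump]. *)
Definition bump_seq a b n x : R :=
  1 - (1 - (\prod_i (b 0 i - a 0 i) ^+ 4)^-1 * bump a b x) ^+ n.

Lemma bump_ge0 a b x : 0 <= bump a b x.
Proof. by apply: prodr_ge0 => i _; rewrite mulr_ge0// posq_ge0. Qed.

Lemma bump_gt0 a b x : obox a b x -> 0 < bump a b x.
Proof.
move=> xab; apply: prodr_gt0 => i _; have /andP[ax xb] := xab i.
by apply: mulr_gt0; apply: posq_gt0; lra.
Qed.

Lemma bump_eq0 a b x : ~ obox a b x -> bump a b x = 0.
Proof.
move=> /existsNP[i /negP]; rewrite negb_and -!leNgt => xab.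
rewrite /bump (bigD1 i)//= (_ : posq 1 _ _ * _ = 0) ?mul0r//.
by case/orP: xab => h; [rewrite posq_eq0 ?mul0r|rewrite [X in _ * X]posq_eq0 ?mulr0]; rewrite // ?mulNr ?mul1r; lra.
Qed.

Lemma bump_le a b x : (forall i, a 0 i < b 0 i) ->
  bump a b x <= \prod_i (b 0 i - a 0 i) ^+ 4.
Proof.
move=> ab; have [xab|/bump_eq0->] := pselect (obox a b x); last first.
  by apply: prodr_ge0 => i _; rewrite exprn_ge0// subr_ge0 ltW.
apply: ler_prod => i _; rewrite mulr_ge0 ?posq_ge0//=.
have /andP[ax xb] := xab i.
rewrite (_ : 4 = 2 + 2)%N// exprD ler_pM ?posq_ge0//; apply: posq_le; lra.
Qed.

Lemma C1fun_bump_seq a b n : C1fun (bump_seq a b n).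
Proof.
apply: C1funB; first exact: C1fun_cst.
apply: C1funX; apply: C1funB; first exact: C1fun_cst.
apply: C1funM; first exact: C1fun_cst.
apply: C1fun_prod => i; apply: C1funM; exact: C1fun_posq.
Qed.

Lemma bump_seq_itv a b n x : (forall i, a 0 i < b 0 i) -> 0 <= bump_seq a b n x <= 1.
Proof.
move=> ab; rewrite /bump_seq; set M := \prod_i _; set t := M^-1 * _.
have M0 : 0 < M by apply: prodr_gt0 => i _; rewrite exprn_gt0// subr_gt0.
have t0 : 0 <= t by rewrite mulr_ge0 ?bump_ge0// invr_ge0 ltW.
have t1 : t <= 1 by rewrite /t mulrC ler_pdivrMr// mul1r bump_le.
rewrite subr_ge0 gerBl exprn_ile1 ?exprn_ge0//; lra.
Qed.

Lemma bump_seq_cvg a b x : (forall i, a 0 i < b 0 i) ->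
  bump_seq a b n x @[n --> \oo] --> (\1_(obox a b) x : R).
Proof.
move=> ab; rewrite indicE; case: (boolP (x \in _)) => [/set_mem xab|/negP/[!inE] xab]; last first.
  rewrite (_ : (fun n => _) = cst 0); first exact: cvg_cst.
  by apply/funext => n; rewrite /bump_seq bump_eq0// mulr0 subr0 expr1n subrr.
rewrite -[X in _ --> X]subr0; apply: cvgB; first exact: cvg_cst.
set M := \prod_i _; set t := M^-1 * _.
have M0 : 0 < M by apply: prodr_gt0 => i _; rewrite exprn_gt0// subr_gt0.
have t0 : 0 < t by rewrite mulr_gt0 ?bump_gt0// invr_gt0.
have t1 : t <= 1 by rewrite /t mulrC ler_pdivrMr// mul1r bump_le.
by apply: cvg_expr; rewrite ger0_norm; lra.
Qed.

Lemma compact_box a b : compact (box a b).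
Proof.
have := @rV_compact R d (fun i => `[a 0 i, b 0 i]%classic) (fun i => @segment_compact _ (a 0 i) (b 0 i)).
by congr compact; apply/seteqP; split => x xab i; have := xab i; rewrite /= in_itv.
Qed.

Lemma test_fun_bump_seq (Omega : set 'rV[R]_d) a b n : (forall i, a 0 i < b 0 i) ->
  box a b `<=` Omega -> test_fun Omega (bump_seq a b n).
Proof.
move=> ab abO; split; first exact: C1fun_bump_seq.
exists (box a b); split => //; first exact: compact_box.
move=> x xab; rewrite /bump_seq bump_eq0 ?mulr0 ?subr0 ?expr1n ?subrr//.
by move=> xab'; apply: xab => i; have /andP[/ltW-> /ltW->] := xab' i.
Qed.

Variables (Omega : set 'rV[R]_d) (w : 'rV[R]_d -> R).
Hypotheses (oO : open Omega) (iw : (leb R d).-integrable Omega (EFin \o w)).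
Hypothesis w0 : forall phi, test_fun Omega phi -> intO Omega (fun x => w x * phi x) = 0.

Let mO : measurable (Omega : set lebT).
Proof. exact: open_measurable_leb. Qed.

(** The functions [bump_seq] vanish off the closed box, which must therefore lie in [Omega] for them
    to be test functions; they converge boundedly to the indicator of the open box. *)
Lemma Rintegral_obox_eq0 a b : box a b `<=` Omega ->
  \int[leb R d]_(x in obox a b) w x = 0.
Proof.
have [ab|/existsNP[i /negP]] := pselect (forall i, a 0 i < b 0 i); last first.
  rewrite -leNgt => ba _; rewrite (_ : obox a b = set0) ?Rintegral_set0//.
  apply/seteqP; split => x // /(_ i) /andP[ax xb].
  by have := lt_trans ax xb; rewrite ltNge ba.
move=> abO.
have abO' : obox a b `<=` Omega.
  by move=> x xab; apply: abO => i; have /andP[/ltW-> /ltW->] := xab i.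
have -> : \int[leb R d]_(x in obox a b) w x =
    \int[leb R d]_(x in Omega) (w x * \1_(obox a b) x).
  rewrite -[in LHS](setIidr abO') Rintegral_mkcondr; apply: eq_Rintegral => x _.
  by rewrite patchE indicE; case: (x \in _); rewrite ?mulr1 ?mulr0.
have mw := integrable_measurable iw.
have mb n : measurable_fun (Omega : set lebT) (fun x : lebT => w x * bump_seq a b n x).
  apply: measurable_funM => //; apply: measurable_funTS.
  by apply: continuous_measurable_leb; apply: C1fun_continuous; exact: C1fun_bump_seq.
suff cv : \int[leb R d]_(x in Omega) (w x * bump_seq a b n x) @[n --> \oo] -->
    \int[leb R d]_(x in Omega) (w x * \1_(obox a b) x).
  apply: (cvg_unique _ cv) => //; rewrite (_ : (fun n => _) = cst 0); first exact: cvg_cst.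
  by apply/funext => n; apply: w0; exact: test_fun_bump_seq.
apply: (@Rintegral_dominated_cvg _ lebT R (leb R d) Omega _ _ (fun x => `|w x|) mO mb).
- by apply: measurable_funM => //; apply: measurable_indic; exact: measurable_obox.
- apply: aeW => x _; apply: (@cvgM _ _ _ _ (fun=> w x)); first exact: cvg_cst.
  exact: bump_seq_cvg.
- exact: integrable_norm.
- apply: aeW => x _ n; rewrite normrM ler_piMr//.
  by have /andP[h1 h2] := bump_seq_itv n x ab; rewrite ger0_norm.
Qed.

Lemma du_bois_reymond_obox a b : box a b `<=` Omega ->
  {ae leb R d, forall x, obox a b x -> w x = 0}.
Proof.
move=> abO.
have abO' : obox a b `<=` Omega.
  by move=> x xab; apply: abO => i; have /andP[/ltW-> /ltW->] := xab i.
suff : \forall x \ae leb R d, (obox a b : set lebT) x -> w x = 0 by [].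
apply: (@ae_eq0_sigma_algebra _ lebT R (leb R d) (@oboxes R d)).
- exact: measurable_obox.
- by apply: integrableS iw => //; exact: measurable_obox.
- by move=> _ [a' [b' ->]]; exact: measurable_obox.
- exact: oboxes_setI_closed.
- exact: Rintegral_obox_eq0.
- move=> _ [a' [b' ->]]; rewrite setIC obox_setI; apply: Rintegral_obox_eq0.
  apply: subset_trans abO => x xab i; have := xab i; rewrite !mxE ge_max le_min.
  by move=> /andP[/andP[-> _] /andP[-> _]].
- move=> E mE Eab.
  (* Finite measure turns the equality of the measures of [B] and [E] into a null difference. *)
  have Efin : (leb_ext E < +oo)%E.
    apply: (@le_lt_trans _ _ (leb R d (box a b))).
      apply: (@le_outer_measure _ _ (leb_outer R d)) => x /Eab xab i.
      by have /andP[/ltW-> /ltW->] := xab i.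
    by apply: leb_bounded_lty; apply: compact_bounded; exact: compact_box.
  have [B [sB EB BE]] := leb_outer_regular Efin.
  exists B; split => //.
  have mB : measurable (B : set lebT).
    move: sB; apply: smallest_sub; first exact: sigma_algebra_measurable.
    by move=> _ [a' [b' ->]]; exact: measurable_obox.
  have BfinE : leb R d B = leb R d E.
    apply/eqP; rewrite eq_le; apply/andP; split; first exact: BE.
    exact: (@le_outer_measure _ _ (leb_outer R d)).
  apply: (@eq_trans _ _ (leb R d B - leb R d E)%E); last first.
    by rewrite BfinE subee// ge0_fin_numE//; exact: measure_ge0.
  by rewrite measureD//; [rewrite setIidr|exact: le_lt_trans BE Efin].
Qed.

Lemma ae_leb_mono (P P' : 'rV[R]_d -> Prop) : (forall x, P x -> P' x) ->
  {ae leb R d, forall x, P x} -> {ae leb R d, forall x, P' x}.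
Proof. by move=> PP'; apply: (@filterS _ (almost_everywhere (leb R d))). Qed.

(* Cover Omega by countably many rational boxes. *)
Lemma du_bois_reymond : aeO Omega (fun x => w x = 0).
Proof.
have : {ae leb R d, forall x : 'rV[R]_d, forall n : nat, forall ab : 'rV[rat]_d * 'rV[rat]_d,
    unpickle n = Some ab -> box (map_mx ratr ab.1) (map_mx ratr ab.2) `<=` Omega ->
    obox (map_mx ratr ab.1) (map_mx ratr ab.2) x -> w x = 0}.
  apply: ae_foralln => n.
  case E : (unpickle n : option ('rV[rat]_d * 'rV[rat]_d)) => [ab|]; last first.
    by apply: aeW => x ab.
  have [abO|nabO] := pselect (box (map_mx ratr ab.1) (map_mx ratr ab.2) `<=` Omega).
    by apply: ae_leb_mono (du_bois_reymond_obox abO) => x + ab' [<-] _; exact.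
  by apply: aeW => x ab' [<-] /nabO.
apply: ae_leb_mono => x xP Ox; have [a [b [xab abO]]] := open_rat_box oO Ox.
exact: (xP (pickle (a, b)) (a, b) (pickleK _)).
Qed.

End du_bois_reymond.

(** * Sobolev and Hoelder functions *)

Section Lp_restriction.
Context d (T : measurableType d) (R : realType) (mu : {measure set T -> \bar R}).
Variable D : set T.
Hypothesis mD : measurable D.
Implicit Types f : T -> R.

Lemma Lfun_measurable (p : \bar R) f : f \_ D \in Lfun mu p -> measurable_fun D f.
Proof.
rewrite inE => /andP[/[!inE]/= mf _].
exact/(measurable_restrictT f mD).
Qed.

Lemma Lnorm_restrict (r : R) f : r != 0 ->
  ('N[mu]_r%:E [EFin \o (f \_ D)] = (\int[mu]_(x in D) (`|f x| `^ r)%:E) `^ r^-1)%E.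
Proof.
move=> r0.
have E : (\int[mu]_x (`|(EFin \o (f \_ D)) x| `^ r) = \int[mu]_(x in D) (`|f x| `^ r)%:E)%E.
  rewrite [RHS]integral_mkcond; apply: eq_integral => x _ /=.
  rewrite !patchE; case: (x \in D) => //=.
  by rewrite normr0 powR0.
by rewrite unlock E.
Qed.

Lemma LfunP_restrict (r : R) f : 1 <= r ->
  (f \_ D \in Lfun mu r%:E) <->
  measurable_fun D f /\ mu.-integrable D (EFin \o (fun x => `|f x| `^ r)).
Proof.
move=> r1; have r0 : 0 < r by exact: lt_le_trans r1.
have mpow : measurable_fun D f -> measurable_fun D (fun x => `|f x| `^ r).
  move=> mf; apply: (@measurableT_comp _ _ _ _ _ _ (@powR R ^~ r)) => //.
  exact: measurableT_comp.
have normE : (\int[mu]_(x in D) `|(EFin \o (fun x => `|f x| `^ r)%R) x| =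
    \int[mu]_(x in D) (`|f x| `^ r)%:E)%E.
  by apply: eq_integral => x _ /=; rewrite ger0_norm ?powR_ge0.
split.
  move=> Lf; have mf := Lfun_measurable Lf; split => //.
  apply/integrableP; split; first exact/measurable_EFinP/mpow.
  move: Lf; rewrite inE => /andP[_]; rewrite inE/= /finite_norm Lnorm_restrict ?gt_eqF//.
  rewrite normE => /lty_poweRy; apply; rewrite invr_eq0 gt_eqF//.
move=> [mf irf]; rewrite inE; apply/andP; rewrite !inE/=; split.
  exact/(measurable_restrictT f mD).
rewrite /finite_norm Lnorm_restrict ?gt_eqF// poweR_lty//.
by move: irf => /integrableP[_]; rewrite normE.
Qed.

Lemma fine_Lnorm_restrict (r : R) f : 1 <= r -> f \_ D \in Lfun mu r%:E ->
  fine ('N[mu]_r%:E [EFin \o (f \_ D)])%E = (\int[mu]_(x in D) (`|f x| `^ r)) `^ r^-1.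
Proof.
move=> r1; have r0 : 0 < r by exact: lt_le_trans r1.
move=> /(LfunP_restrict _ r1)[mf irf]; rewrite Lnorm_restrict ?gt_eqF//.
by rewrite -(fineK (integrable_fin_num mD irf)) poweR_EFin.
Qed.

Lemma Lfun2P f : (f \_ D \in Lfun mu 2%:E) <-> sqint mu D f.
Proof.
have E : (fun x => `|f x| `^ 2) = (fun x => f x ^+ 2).
  by apply/funext => x; rewrite powR_mulrn// real_normK ?num_real.
by rewrite LfunP_restrict ?ler1n// E.
Qed.

Lemma fine_Lnorm2 f : sqint mu D f -> fine ('N[mu]_2%:E [EFin \o (f \_ D)])%E = n2 mu D f.
Proof.
move=> /Lfun2P Lf; rewrite fine_Lnorm_restrict ?ler1n// powR12_sqrt.
  congr Num.sqrt; apply: eq_Rintegral => x _.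
  by rewrite powR_mulrn// real_normK ?num_real.
by apply: Rintegral_ge0 => x _; exact: powR_ge0.
Qed.

Lemma Lfun4_sqr f : f \_ D \in Lfun mu 4%:E ->
  sqint mu D (fun x => f x ^+ 2) /\
  n2 mu D (fun x => f x ^+ 2) = fine ('N[mu]_4%:E [EFin \o (f \_ D)])%E ^+ 2.
Proof.
have E : (fun x => `|f x| `^ 4) = (fun x => (f x ^+ 2) ^+ 2).
  apply/funext => x; rewrite powR_mulrn// (_ : 4 = 2 * 2)%N// exprM.
  by rewrite real_normK ?num_real.
move=> Lf; have [mf if4] := (LfunP_restrict _ (ler1n _ 4)).1 Lf; split.
  by split; [exact: measurable_funX|rewrite -E].
rewrite fine_Lnorm_restrict ?ler1n// E.
have I0 : 0 <= \int[mu]_(x in D) ((f x ^+ 2) ^+ 2).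
  by apply: Rintegral_ge0 => x _; exact: sqr_ge0.
rewrite -powR_mulrn ?powR_ge0// -powRrM (_ : 4^-1 * 2%:R = 2^-1 :> R); last by field.
by rewrite powR12_sqrt.
Qed.

Lemma Linfty_bounded f : f \_ D \in Lfun mu +oo%E ->
  exists C, \forall x \ae mu, D x -> `|f x| <= C.
Proof.
rewrite inE => /andP[_]; rewrite inE/= /finite_norm unlock.
(* On a space of measure zero the L^oo norm is 0 by definition, and every property holds almost
   everywhere. *)
case: ifPn => [mu0|]; last first.
  rewrite -leNgt => mu0 _; exists 0; exists setT; split => //.
  by apply/eqP; rewrite eq_le mu0 measure_ge0.
move=> /ess_supr_bounded[C fC]; exists C; apply: filterS fC => x /= + Dx.
by rewrite patchE mem_set.
Qed.

Hypothesis Dfin : (mu D < +oo)%E.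

Lemma integrable_cst_fin (c : R) : mu.-integrable D (EFin \o cst c).
Proof.
apply/integrableP; split; first exact/measurable_EFinP.
under eq_integral do rewrite /=.
by rewrite integral_cst// lte_mul_pinfty// lee_fin.
Qed.

Lemma sqint_cst (c : R) : sqint mu D (fun=> c).
Proof. by split; [exact: measurable_cst|exact: integrable_cst_fin]. Qed.

Lemma sqint_bounded f (C : R) : measurable_fun D f ->
  (\forall x \ae mu, D x -> `|f x| <= C) -> sqint mu D f.
Proof. by move=> mf fC; have [] := ae_le_sqint mD mf (sqint_cst C) fC. Qed.

Lemma n2_cst (c : R) : 0 <= c -> n2 mu D (fun=> c) = c * n2 mu D (fun=> 1).
Proof.
move=> c0; rewrite -[in RHS](ger0_norm c0) -(n2Z mD c (sqint_cst 1)).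
by apply: eq_n2 => x _; rewrite mulr1.
Qed.

Lemma sqint_integrable f : sqint mu D f -> mu.-integrable D (EFin \o f).
Proof.
move=> sf; have := sqint_mul mD sf (sqint_cst 1).
by apply: eq_integrable => // x _ /=; rewrite mulr1.
Qed.

Lemma Lfun_integrable1 (p : \bar R) f : (1 < p)%E -> f \_ D \in Lfun mu p ->
  mu.-integrable D (EFin \o f).
Proof.
case: p => [r| |//] p1 Lf; last first.
  have [C fC] := Linfty_bounded Lf.
  exact: sqint_integrable (sqint_bounded (Lfun_measurable Lf) fC).
have r1 : 1 <= r by rewrite -lee_fin ltW.
have [mf irf] := (LfunP_restrict _ r1).1 Lf.
apply: (ae_le_integrable mD mf (integrableD_EFin mD (integrable_cst_fin 1) irf)).
apply: aeW => x _ /=; have [fx1|fx1] := leP `|f x| 1.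
  by rewrite (le_trans fx1)// lerDl powR_ge0.
rewrite (le_trans (_ : _ <= `|f x| `^ r)) ?lerDr//.
by rewrite -{1}[`|f x|]powRr1// ler_powR// ltW.
Qed.

(** The regularity hypothesis speaks of L^{min(p,2)} while the estimates run in L2. The inequality
    [z^s <= 1 + z^2], scaled by [t] and integrated, gives the bound with any [t > 0] that is at
    least [n2 mu D f] in place of this norm. *)
Lemma le_Lnorm_n2 (s : R) f : 1 <= s -> s <= 2 -> sqint mu D f ->
  f \_ D \in Lfun mu s%:E /\
  fine ('N[mu]_s%:E [EFin \o (f \_ D)])%E <= (fine (mu D) + 1) `^ s^-1 * n2 mu D f.
Proof.
move=> s1 s2 [mf f2].
have s0 : 0 < s by exact: lt_le_trans s1.
have bnd t x : 0 < t -> `|f x| `^ s <= t `^ s + t `^ s / t ^+ 2 * f x ^+ 2.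
  move=> t0; pose z := `|f x| / t.
  have z0 : 0 <= z by rewrite divr_ge0// ltW.
  have -> : `|f x| = t * z by rewrite /z mulrC divfK// gt_eqF.
  have -> : f x ^+ 2 = t ^+ 2 * z ^+ 2.
    by rewrite -exprMn /z mulrC divfK ?gt_eqF// real_normK ?num_real.
  rewrite powRM ?(ltW t0)//.
  rewrite (_ : _ + _ = t `^ s * (1 + z ^+ 2)); last by field; rewrite gt_eqF.
  rewrite ler_wpM2l ?powR_ge0//.
  have [z1|z1] := leP z 1.
    rewrite (@le_trans _ _ (1 `^ s))//; last by rewrite powR1 lerDl sqr_ge0.
    by rewrite ge0_ler_powR ?nnegrE// ltW.
  rewrite (@le_trans _ _ (z ^+ 2)) ?lerDr//.
  by rewrite -powR_mulrn// ler_powR// ltW.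
have it t : mu.-integrable D (EFin \o (fun x => t `^ s + t `^ s / t ^+ 2 * f x ^+ 2)).
  apply: integrableD_EFin => //; first exact: integrable_cst_fin.
  exact: integrableZl_EFin.
have mpow : measurable_fun D (fun x => `|f x| `^ s).
  apply: (@measurableT_comp _ _ _ _ _ _ (@powR R ^~ s)) => //.
  exact: measurableT_comp.
have iS : mu.-integrable D (EFin \o (fun x => `|f x| `^ s)).
  apply: (ae_le_integrable mD mpow (it 1)); apply: aeW => x _.
  by rewrite ger0_norm ?powR_ge0//; exact: bnd.
have Lf : f \_ D \in Lfun mu s%:E by exact/(LfunP_restrict _ s1).
split => //; rewrite fine_Lnorm_restrict//.
set K := (_ + 1) `^ _; have K0 : 0 <= K by exact: powR_ge0.
have It t : 0 < t -> n2 mu D f <= t -> (\int[mu]_(x in D) (`|f x| `^ s)) `^ s^-1 <= K * t.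
  move=> t0 ft.
  have I0 : 0 <= \int[mu]_(x in D) (`|f x| `^ s).
    by apply: Rintegral_ge0 => x _; exact: powR_ge0.
  have I1 : \int[mu]_(x in D) (`|f x| `^ s) <= (fine (mu D) + 1) * t `^ s.
    apply: (@le_trans _ _ (\int[mu]_(x in D) (t `^ s + t `^ s / t ^+ 2 * f x ^+ 2))).
      by apply: le_Rintegral => // x _; exact: bnd.
    rewrite RintegralD//; [|exact: integrable_cst_fin|exact: integrableZl_EFin].
    rewrite Rintegral_cst// RintegralZl// -sqr_n2 mulrDl mul1r mulrC lerD2l.
    rewrite -mulrA ler_piMr ?powR_ge0// mulrC ler_pdivrMr ?exprn_gt0// mul1r.
    by rewrite lerXn2r ?nnegrE ?n2_ge0// ltW.
  apply: (@le_trans _ _ (((fine (mu D) + 1) * t `^ s) `^ s^-1)).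
    apply: ge0_ler_powR => //; rewrite ?nnegrE//; first by rewrite invr_ge0 ltW.
    by rewrite mulr_ge0 ?powR_ge0// addr_ge0// fine_ge0.
  rewrite powRM ?powR_ge0 ?addr_ge0 ?fine_ge0// -[X in _ * X]powRrM mulfV ?gt_eqF//.
  by rewrite powRr1// ltW.
(* [n2 mu D f] may vanish, so [t] is taken slightly larger and the excess tends to 0. *)
apply/ler_addgt0Pr => e e0.
have K1 : 0 < K + 1 by rewrite ltr_wpDl.
apply: (@le_trans _ _ (K * (n2 mu D f + e / (K + 1)))).
  apply: It; first by rewrite ltr_wpDl ?n2_ge0// divr_gt0.
  by rewrite lerDl ltW// divr_gt0.
rewrite mulrDr lerD2l mulrCA ler_piMr ?(ltW e0)// ler_pdivrMr// mul1r; lra.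
Qed.

End Lp_restriction.

(** * Weak gradients and the space H1 *)

Section sobolev.
Variables (R : realType) (d : nat) (Omega : set 'rV[R]_d).
Hypotheses (oO : open Omega) (bO : bounded_set Omega).
Local Notation lebT := (caratheodory_type (leb_outer R d)).
Local Notation mu := (leb R d).
Local Notation sq := (@sqint _ lebT R mu (Omega : set lebT)).
Local Notation N2 := (@n2 _ lebT R mu (Omega : set lebT)).
Implicit Types (f g v y phi psi : 'rV[R]_d -> R).

Lemma measurable_Omega : measurable (Omega : set lebT).
Proof. exact: open_measurable_leb. Qed.
Let mO := measurable_Omega.

Lemma leb_Omega_lty : (mu Omega < +oo)%E.
Proof. exact: leb_bounded_lty. Qed.
Let Ofin := leb_Omega_lty.

Lemma Lp2P f : Lp Omega 2%:E f <-> sq f.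
Proof. exact: (Lfun2P mu mO f). Qed.

Lemma Lp_norm2E f : sq f -> Lp_norm Omega 2%:E f = N2 f.
Proof. exact: (fine_Lnorm2 mO). Qed.

Lemma aeO_and (P Q : 'rV[R]_d -> Prop) : aeO Omega P -> aeO Omega Q ->
  aeO Omega (fun x => P x /\ Q x).
Proof.
move=> p q.
have : {ae mu, forall x : lebT, (Omega x -> P x) /\ (Omega x -> Q x)}.
  exact: (@filterI _ (almost_everywhere mu)).
by apply: ae_leb_mono => x [Px Qx] Ox; split; [exact: Px|exact: Qx].
Qed.

Lemma aeO_mono (P Q : 'rV[R]_d -> Prop) : (forall x, Omega x -> P x -> Q x) ->
  aeO Omega P -> aeO Omega Q.
Proof. by move=> PQ; apply: ae_leb_mono => x Px Ox; apply: PQ => //; exact: Px. Qed.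

Lemma aeO_all (P : 'rV[R]_d -> Prop) : (forall x, Omega x -> P x) -> aeO Omega P.
Proof. by move=> PO; exact: (aeW mu). Qed.

Lemma aeO_forall (I : finType) (P : I -> 'rV[R]_d -> Prop) :
  (forall i, aeO Omega (P i)) -> aeO Omega (fun x => forall i, P i x).
Proof.
move=> aP; suff : aeO Omega (fun x => forall i, i \in enum I -> P i x).
  by apply: aeO_mono => x _ xP i; apply: xP; rewrite mem_enum.
elim: (enum I) => [|i s ih]; first exact: aeO_all.
apply: aeO_mono (aeO_and (aP i) ih) => x _ [Pi Ps] j.
by rewrite in_cons => /predU1P[->|/Ps].
Qed.

Lemma test_fun_sqint phi : test_fun Omega phi ->
  sq phi /\ forall i, sq (partial i phi).
Proof.
move=> [Cphi [K [cK KO phiK]]]; have [_ cp] := Cphi.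
have cphi := C1fun_continuous Cphi.
have cs f : continuous f -> (forall x, ~ K x -> f x = 0) -> sq f.
  move=> cf fK; have [C fC] := compact_support_bounded cf cK fK.
  apply: (sqint_bounded mO Ofin (C := C)); last by apply: aeW => x _; exact: fC.
  by apply: measurable_funTS; exact: continuous_measurable_leb.
split=> [|i]; first exact: cs.
by apply: cs; [exact: cp|move=> x; exact: partial_support].
Qed.

(** The product [psi phi] is C^1 with compact support, so the integral of its partial derivative
    vanishes. *)
Lemma test_fun_partial_ibp i phi psi : test_fun Omega phi -> C1fun psi ->
  sq psi -> sq (partial i psi) ->
  intO Omega (fun x => psi x * partial i phi x) =
  - intO Omega (fun x => partial i psi x * phi x).
Proof.
move=> tphi Cpsi spsi sdpsi; have [sphi sdphi] := test_fun_sqint tphi.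
have [Cphi [K [cK KO phiK]]] := tphi.
have pK x : ~ K x -> psi x * phi x = 0 by move=> /phiK ->; rewrite mulr0.
have [_ I0] := Rintegral_partial_eq0 i (C1funM Cpsi Cphi) cK pK.
apply/eqP; rewrite -addr_eq0 -I0 /intO -RintegralD//; last 2 first.
- exact: sqint_mul.
- exact: sqint_mul.
apply/eqP; rewrite Rintegral_mkcond; apply: eq_Rintegral => x _.
rewrite patchE; case: ifPn => [_|/negP /[!inE] xO].
  by rewrite partialM//; ring.
by rewrite (@partial_support _ _ _ _ K)// => /KO.
Qed.

Lemma test_fun_H1 psi : test_fun Omega psi -> H1 Omega psi.
Proof.
move=> tpsi; have [spsi sdpsi] := test_fun_sqint tpsi.
split; first exact/Lp2P.
exists (fun x => \row_i partial i psi x) => i; split.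
  by under eq_fun do rewrite mxE; exact/Lp2P.
move=> phi tphi; rewrite test_fun_partial_ibp//; last by case: tpsi.
by congr (- _); apply: eq_Rintegral => x _; rewrite mxE.
Qed.

Lemma is_wgrad_sqint v w i : is_wgrad Omega v w -> sq (fun x => w x 0 i).
Proof. by move=> vw; apply/Lp2P; have [] := vw i. Qed.

(** The difference of two weak gradients is orthogonal to all test functions, so the du Bois-Reymond
    lemma applies. This is what makes the chosen gradient [wgrad] linear almost everywhere. *)
Lemma is_wgrad_unique v w w' : is_wgrad Omega v w -> is_wgrad Omega v w' ->
  aeO Omega (fun x => w x = w' x).
Proof.
move=> vw vw'.
have : aeO Omega (fun x => forall i, w x 0 i - w' x 0 i = 0).
  apply: aeO_forall => i; have sw := is_wgrad_sqint i vw.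
  have sw' := is_wgrad_sqint i vw'.
  apply: du_bois_reymond => //; first exact: (sqint_integrable mO Ofin (sqintB mO sw sw')).
  move=> phi tphi; have [sphi _] := test_fun_sqint tphi.
  have [_ /(_ phi tphi) E] := vw i; have [_ /(_ phi tphi) E'] := vw' i.
  transitivity (intO Omega (fun x => w x 0 i * phi x) - intO Omega (fun x => w' x 0 i * phi x)).
    rewrite /intO -RintegralB//; [|exact: sqint_mul..].
    by apply: eq_Rintegral => x _; rewrite mulrBl.
  by apply/eqP; rewrite subr_eq0 -eqr_opp -E E'.
by apply: aeO_mono => x _ xP; apply/rowP => i; apply/eqP; rewrite -subr_eq0 xP.
Qed.

Lemma H1_sqint v : H1 Omega v -> sq v.
Proof. by move=> [/Lp2P]. Qed.

Lemma wgradP v : H1 Omega v -> is_wgrad Omega v (wgrad Omega v).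
Proof. by move=> [_ vw]; exact: getPex. Qed.

Lemma wgrad_sqint v i : H1 Omega v -> sq (fun x => wgrad Omega v x 0 i).
Proof. by move=> /wgradP; exact: is_wgrad_sqint. Qed.

Lemma is_wgrad_lin (c : R) v v' w w' : sq v -> sq v' ->
  is_wgrad Omega v w -> is_wgrad Omega v' w' ->
  is_wgrad Omega (c *: v + v') (fun x => c *: w x + w' x).
Proof.
move=> sv sv' vw vw' i; have sw := is_wgrad_sqint i vw.
have sw' := is_wgrad_sqint i vw'; split.
  apply/Lp2P; apply: (eq_sqint mO _ (sqintD mO (sqintZ mO c sw) sw')) => x _.
  by rewrite !mxE.
move=> phi tphi; have [sphi sdphi] := test_fun_sqint tphi.
have [_ /(_ phi tphi) E] := vw i; have [_ /(_ phi tphi) E'] := vw' i.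
transitivity (c * intO Omega (fun x => v x * partial i phi x) +
    intO Omega (fun x => v' x * partial i phi x)).
  rewrite /intO -RintegralZl//; last exact: sqint_mul.
  rewrite -RintegralD//; last 2 first.
  - by apply: integrableZl_EFin => //; exact: sqint_mul.
  - exact: sqint_mul.
  by apply: eq_Rintegral => x _; rewrite !fctE mulrDl -mulrA.
rewrite E E' mulrN -opprD; congr (- _).
rewrite /intO -RintegralZl//; last exact: sqint_mul.
rewrite -RintegralD//; last 2 first.
- by apply: integrableZl_EFin => //; exact: sqint_mul.
- exact: sqint_mul.
by apply: eq_Rintegral => x _; rewrite !mxE mulrDl -mulrA.
Qed.

Lemma H1_lin (c : R) v v' : H1 Omega v -> H1 Omega v' -> H1 Omega (c *: v + v').
Proof.
move=> Hv Hv'; split.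
  by apply/Lp2P; exact: (sqintD mO (sqintZ mO c (H1_sqint Hv)) (H1_sqint Hv')).
by eexists; apply: is_wgrad_lin; (exact: H1_sqint || exact: wgradP).
Qed.

Lemma H1B v v' : H1 Omega v -> H1 Omega v' -> H1 Omega (v - v').
Proof. by move=> Hv Hv'; have := H1_lin (-1) Hv' Hv; rewrite scaleN1r addrC. Qed.

Lemma wgrad_lin (c : R) v v' : H1 Omega v -> H1 Omega v' ->
  aeO Omega (fun x => wgrad Omega (c *: v + v') x = c *: wgrad Omega v x + wgrad Omega v' x).
Proof.
move=> Hv Hv'; apply: is_wgrad_unique; first exact/wgradP/H1_lin.
by apply: is_wgrad_lin; (exact: H1_sqint || exact: wgradP).
Qed.

End sobolev.

(** Triangle inequality for the Euclidean norm of the vector of L2 norms that makes up [H1_norm];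
    the induction merges one entry at a time into the leading one. *)
Lemma minkowski_sqrt (R : rcfType) (I : Type) (s : seq I) (x y : R) (a b : I -> R) :
  0 <= x -> 0 <= y -> (forall i, 0 <= a i) -> (forall i, 0 <= b i) ->
  Num.sqrt ((x + y) ^+ 2 + \sum_(i <- s) (a i + b i) ^+ 2) <=
  Num.sqrt (x ^+ 2 + \sum_(i <- s) a i ^+ 2) + Num.sqrt (y ^+ 2 + \sum_(i <- s) b i ^+ 2).
Proof.
move=> x0 y0 a0 b0; elim: s x y x0 y0 => [|i s ih] x y x0 y0.
  by rewrite !big_nil !addr0 !sqrtr_sqr !ger0_norm// addr_ge0.
rewrite !big_cons !addrA.
have sqE (u v : R) : u ^+ 2 + v ^+ 2 = Num.sqrt (u ^+ 2 + v ^+ 2) ^+ 2.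
  by rewrite sqr_sqrtr// addr_ge0 ?sqr_ge0.
rewrite [x ^+ 2 + _]sqE [y ^+ 2 + _]sqE.
apply: le_trans (ih _ _ (sqrtr_ge0 _) (sqrtr_ge0 _)).
rewrite ler_wsqrtr// lerD2r.
set p := Num.sqrt (x ^+ 2 + _); set q := Num.sqrt (y ^+ 2 + _).
have p0 : 0 <= p by exact: sqrtr_ge0.
have q0 : 0 <= q by exact: sqrtr_ge0.
have p2 : p ^+ 2 = x ^+ 2 + a i ^+ 2 by rewrite sqE.
have q2 : q ^+ 2 = y ^+ 2 + b i ^+ 2 by rewrite sqE.
have : x * y + a i * b i <= p * q.
  have xy0 : 0 <= x * y + a i * b i by rewrite addr_ge0// mulr_ge0.
  rewrite -ler_sqr ?nnegrE ?mulr_ge0// exprMn p2 q2.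
  by have := sqr_ge0 (x * b i - y * a i); lra.
have -> : (p + q) ^+ 2 = p ^+ 2 + q ^+ 2 + 2 * (p * q) by ring.
by rewrite p2 q2 => h; nra.
Qed.

(** * The norm of H1 and closedness of the weak gradient *)

Section sobolev_norm.
Variables (R : realType) (d : nat) (Omega : set 'rV[R]_d).
Hypotheses (oO : open Omega) (bO : bounded_set Omega).
Local Notation lebT := (caratheodory_type (leb_outer R d)).
Local Notation mu := (leb R d).
Local Notation sq := (@sqint _ lebT R mu (Omega : set lebT)).
Local Notation N2 := (@n2 _ lebT R mu (Omega : set lebT)).
Implicit Types (f g v y phi psi : 'rV[R]_d -> R).
Let mO := measurable_Omega oO.

Lemma ae_N2 f g : sq f -> sq g -> aeO Omega (fun x => f x = g x) -> N2 f = N2 g.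
Proof. by move=> [mf _] [mg _] fg; exact: ae_eq_n2. Qed.

Lemma H1_normE v : H1 Omega v ->
  H1_norm Omega v = Num.sqrt (N2 v ^+ 2 + \sum_i N2 (fun x => wgrad Omega v x 0 i) ^+ 2).
Proof.
move=> Hv; rewrite /H1_norm Lp_norm2E//; last exact: H1_sqint.
have E i : Lp_norm Omega 2%:E (fun x => wgrad Omega v x 0 i) =
    N2 (fun x => wgrad Omega v x 0 i).
  exact: (Lp_norm2E oO (wgrad_sqint oO i Hv)).
by rewrite (eq_bigr _ (fun i _ => congr1 (fun t => t ^+ 2) (E i))).
Qed.

Lemma H1_norm_ge0 v : 0 <= H1_norm Omega v. Proof. exact: sqrtr_ge0. Qed.

Lemma N2_le_H1_norm v : H1 Omega v -> N2 v <= H1_norm Omega v.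
Proof.
move=> Hv; rewrite H1_normE// -{1}(ger0_norm (n2_ge0 mu _ v)) -sqrtr_sqr ler_wsqrtr//.
by rewrite lerDl sumr_ge0// => i _; exact: sqr_ge0.
Qed.

Lemma N2_wgrad_le_H1_norm v i : H1 Omega v ->
  N2 (fun x => wgrad Omega v x 0 i) <= H1_norm Omega v.
Proof.
move=> Hv; rewrite H1_normE// -{1}(ger0_norm (n2_ge0 mu _ _)) -sqrtr_sqr ler_wsqrtr//.
rewrite (bigD1 i)//= addrCA lerDl addr_ge0 ?sqr_ge0// sumr_ge0// => j _.
exact: sqr_ge0.
Qed.

Lemma H1_norm_le v : H1 Omega v ->
  H1_norm Omega v <= N2 v + \sum_i N2 (fun x => wgrad Omega v x 0 i).
Proof.
move=> Hv; rewrite H1_normE//.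
have s0 : 0 <= \sum_i N2 (fun x => wgrad Omega v x 0 i).
  by apply: sumr_ge0 => i _; exact: n2_ge0.
rewrite -[leRHS]ger0_norm ?addr_ge0 ?n2_ge0// -sqrtr_sqr ler_wsqrtr//.
have sum2 : \sum_i N2 (fun x => wgrad Omega v x 0 i) ^+ 2 <=
    (\sum_i N2 (fun x => wgrad Omega v x 0 i)) ^+ 2.
  rewrite [leRHS]expr2 big_distrl/=; apply: ler_sum => i _.
  rewrite expr2 ler_wpM2l ?n2_ge0// (bigD1 i)//= lerDl.
  by apply: sumr_ge0 => j _; exact: n2_ge0.
move: s0 sum2 (n2_ge0 mu Omega v); move: (N2 v) (\sum_i _) (\sum_i _) => p s t; nra.
Qed.

Lemma wgrad_lin_N2 (c : R) v v' i : H1 Omega v -> H1 Omega v' ->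
  N2 (fun x => wgrad Omega (c *: v + v') x 0 i) =
  N2 (fun x => c * wgrad Omega v x 0 i + wgrad Omega v' x 0 i).
Proof.
move=> Hv Hv'; apply: ae_N2.
- by apply: wgrad_sqint => //; exact: H1_lin.
- by apply: (sqintD mO (sqintZ mO c _)); exact: wgrad_sqint.
- by apply: aeO_mono (wgrad_lin oO bO c Hv Hv') => x _ ->; rewrite !mxE.
Qed.

Lemma H1_norm_lin (c : R) v v' : H1 Omega v -> H1 Omega v' ->
  H1_norm Omega (c *: v + v') <= `|c| * H1_norm Omega v + H1_norm Omega v'.
Proof.
move=> Hv Hv'; rewrite !H1_normE//; last exact: H1_lin.
rewrite -[X in X * _](ger0_norm (normr_ge0 c)) -(sqrtr_sqr `|c|) -sqrtrM ?sqr_ge0//.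
rewrite mulrDr -exprMn mulr_sumr.
rewrite (eq_bigr _ (fun i _ => esym (exprMn 2 `|c| (N2 (fun x => wgrad Omega v x 0 i))))).
apply: le_trans (minkowski_sqrt _ _ _ _ _); last 4 first.
- by rewrite mulr_ge0 ?n2_ge0.
- exact: n2_ge0.
- by move=> i; rewrite mulr_ge0 ?n2_ge0.
- by move=> i; exact: n2_ge0.
have sv := H1_sqint oO Hv; have sv' := H1_sqint oO Hv'.
rewrite ler_wsqrtr//; apply: lerD; last apply: ler_sum => i _.
- rewrite lerXn2r ?nnegrE ?addr_ge0 ?mulr_ge0 ?n2_ge0// -(n2Z mO)//.
  exact: (n2D mO (sqintZ mO c sv) sv').
- have sw := wgrad_sqint oO i Hv; have sw' := wgrad_sqint oO i Hv'.
  rewrite lerXn2r ?nnegrE ?addr_ge0 ?mulr_ge0 ?n2_ge0// wgrad_lin_N2// -(n2Z mO)//.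
  exact: (n2D mO (sqintZ mO c sw) sw').
Qed.

(** The weak gradients are Cauchy in L2. Their limit is a weak gradient of [f], because for a fixed
    test function both sides of the defining identity are continuous in L2. *)
Lemma H1_closed (F : nat -> 'rV[R]_d -> R) f : (forall n, H1 Omega (F n)) -> sq f ->
  (forall e : R, 0 < e -> exists N, forall m n, (N <= m)%N -> (N <= n)%N ->
     H1_norm Omega (F m - F n) <= e) ->
  (forall e : R, 0 < e -> exists N, forall n, (N <= n)%N -> N2 (fun x => F n x - f x) <= e) ->
  H1 Omega f /\ forall e : R, 0 < e -> exists N, forall n, (N <= n)%N ->
     H1_norm Omega (F n - f) <= e.
Proof.
move=> HF sf cF Ff.
have gradE m n i : N2 (fun x => wgrad Omega (F m) x 0 i - wgrad Omega (F n) x 0 i) =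
    N2 (fun x => wgrad Omega (F m - F n) x 0 i).
  rewrite -[F m - F n]addrC -scaleN1r wgrad_lin_N2//.
  by apply: eq_n2 => x _; rewrite mulN1r addrC.
have /choice[w wP] : forall i : 'I_d, exists w, sq w /\ forall e : R, 0 < e -> exists N,
    forall n, (N <= n)%N -> N2 (fun x => w x - wgrad Omega (F n) x 0 i) <= e.
  move=> i; have [||w sw wF] := @sqint_complete _ lebT R mu Omega mO
      (fun n x => wgrad Omega (F n) x 0 i).
  - by move=> n; exact: wgrad_sqint.
  - move=> e e0; have [N NP] := cF e e0; exists N => m n Nm Nn; rewrite gradE.
    apply: le_trans (NP m n Nm Nn); apply: N2_wgrad_le_H1_norm.
    exact: H1B.
  - by exists w.
have lim0 (r : R) : (forall e, 0 < e -> `|r| <= e) -> r = 0.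
  move=> h; apply/eqP; rewrite -normr_eq0 eq_le normr_ge0 andbT.
  by apply/ler_addgt0Pr => e e0; rewrite add0r; exact: h.
have fw : is_wgrad Omega f (fun x => \row_i w i x).
  move=> i; split; first by under eq_fun do rewrite mxE; apply/(Lp2P oO); case: (wP i).
  move=> phi tphi; have [sphi sdphi] := test_fun_sqint oO bO tphi.
  have [swi wFi] := wP i.
  rewrite (_ : intO _ (fun x => _ * phi x) = intO Omega (fun x => w i x * phi x)); last first.
    by apply: eq_Rintegral => x _; rewrite mxE.
  apply/eqP; rewrite -addr_eq0; apply/eqP; apply: lim0 => e e0.
  pose C := N2 (partial i phi) + N2 phi + 1.
  have C0 : 0 < C by rewrite ltr_wpDl ?addr_ge0 ?n2_ge0.
  have [N1 N1P] := Ff (e / C) (divr_gt0 e0 C0).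
  have [N2' N2P] := wFi (e / C) (divr_gt0 e0 C0).
  pose n := maxn N1 N2'.
  have h1 := N1P n (leq_maxl _ _); have h2 := N2P n (leq_maxr _ _).
  have [_ /(_ phi tphi) E] := wgradP (HF n) i.
  have sFn := H1_sqint oO (HF n); have swn := wgrad_sqint oO i (HF n).
  have -> : intO Omega (fun x => f x * partial i phi x) + intO Omega (fun x => w i x * phi x) =
      intO Omega (fun x => (w i x - wgrad Omega (F n) x 0 i) * phi x) -
      intO Omega (fun x => (F n x - f x) * partial i phi x).
    have -> : intO Omega (fun x => (w i x - wgrad Omega (F n) x 0 i) * phi x) =
        intO Omega (fun x => w i x * phi x) - intO Omega (fun x => wgrad Omega (F n) x 0 i * phi x).
      rewrite /intO -RintegralB//; [|exact: (sqint_mul mO)..].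
      by apply: eq_Rintegral => x _; rewrite mulrBl.
    have -> : intO Omega (fun x => (F n x - f x) * partial i phi x) =
        intO Omega (fun x => F n x * partial i phi x) - intO Omega (fun x => f x * partial i phi x).
      rewrite /intO -RintegralB//; [|exact: (sqint_mul mO)..].
      by apply: eq_Rintegral => x _; rewrite mulrBl.
    by rewrite E; ring.
  apply: le_trans (ler_normB _ _) _.
  have := cauchy_schwarz mO (sqintB mO swi swn) sphi.
  have := cauchy_schwarz mO (sqintB mO sFn sf) (sdphi i).
  rewrite -/(intO _ _) -/(intO _ _) => k1 k2.
  apply: le_trans (lerD k2 k1) _.
  apply: (@le_trans _ _ (e / C * (N2 phi + N2 (partial i phi)))).
    by rewrite mulrDr lerD// ler_wpM2r ?n2_ge0.
  rewrite mulrAC ler_pdivrMr// ler_wpM2l ?(ltW e0)// /C; lra.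
have Hf : H1 Omega f by split; [exact/Lp2P|eexists; exact: fw].
split => // e e0.
(* The H1 norm is at most a sum of [d + 1] L2 norms, each of which receives an equal share of
   [e]. *)
have d0 : 0 < d.+1%:R :> R by rewrite ltr0n.
have [N1 N1P] := Ff (e / d.+1%:R) (divr_gt0 e0 d0).
have /choice[N2' N2P] : forall i : 'I_d, exists N, forall n, (N <= n)%N ->
    N2 (fun x => w i x - wgrad Omega (F n) x 0 i) <= e / d.+1%:R.
  by move=> i; case: (wP i) => _; apply; exact: divr_gt0.
exists (maxn N1 (\max_i N2' i)) => n nN.
have HFf := H1B oO bO (HF n) Hf.
apply: le_trans (H1_norm_le HFf) _.
apply: (@le_trans _ _ (e / d.+1%:R + \sum_(i < d) e / d.+1%:R)).
  apply: lerD; first by apply: N1P; rewrite (leq_trans _ nN)// leq_maxl.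
  apply: ler_sum => i _.
  apply: le_trans (N2P i n _); last first.
    rewrite (leq_trans _ nN)// (leq_trans _ (leq_maxr _ _))//.
    exact: (leq_bigmax i).
  have [swi _] := wP i; have swn := wgrad_sqint oO i (HF n).
  rewrite -n2N le_eqVlt; apply/orP; left; apply/eqP; apply: ae_N2.
  - exact: (sqintN mO (wgrad_sqint oO i HFf)).
  - exact: (sqintB mO swi swn).
  - have E : aeO Omega (fun x => wgrad Omega f x = \row_i w i x).
      exact: is_wgrad_unique (wgradP Hf) fw.
    have := wgrad_lin oO bO (-1) Hf (HF n); rewrite scaleN1r addrC => E'.
    apply: aeO_mono (aeO_and E E') => x _ [E1 ->]; rewrite !mxE E1 !mxE; ring.
rewrite sumr_const card_ord -[X in X + _]mulr1n -mulrnDr add1n -[leLHS]mulr_natr.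
by rewrite divfK// gt_eqF.
Qed.

End sobolev_norm.

(** * The Hoelder norm and completeness of the Hoelder space *)

Section holder_space.
Variables (R : realType) (d : nat) (Omega : set 'rV[R]_d) (mu : R).
Hypotheses (mu0 : 0 < mu).
Implicit Types (w : 'rV[R]_d -> R) (x : 'rV[R]_d).

Lemma scaleD_funE (c : R) w w' x : (c *: w + w') x = c * w x + w' x.
Proof. by []. Qed.

Lemma ball_norm_lt x (e : R) y : ball x e y -> `|x - y| < e.
Proof. by rewrite -ball_normE. Qed.

Lemma enorm_ge0 x : 0 <= enorm x. Proof. exact: sqrtr_ge0. Qed.

Lemma enorm_eq0 x : enorm x = 0 -> x = 0.
Proof.
move=> /eqP; rewrite sqrtr_eq0 => x0.
have {}x0 : dotv x x = 0.
  apply/eqP; rewrite eq_le x0; apply: sumr_ge0 => i _; rewrite -expr2 sqr_ge0 //.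
apply/rowP => i; rewrite mxE; apply/eqP; rewrite -[_ == 0](@expf_eq0 _ _ 2)/=.
rewrite eq_le sqr_ge0 andbT -x0 /dotv (bigD1 i)//= -expr2 lerDl.
by apply: sumr_ge0 => j _; rewrite -expr2 sqr_ge0.
Qed.

Lemma coord_le_norm x i : `|x 0 i| <= `|x|.
Proof.
rewrite [leRHS]/Num.norm/= mx_normrE.
exact: (le_bigmax _ (fun j : 'I_1 * 'I_d => `|x j.1 j.2|) (0, i)).
Qed.

Lemma enorm_le x : enorm x <= d%:R * `|x|.
Proof.
have h0 : 0 <= d%:R * `|x| by rewrite mulr_ge0.
rewrite -[leRHS]ger0_norm// -sqrtr_sqr ler_wsqrtr//.
apply: (@le_trans _ _ (d%:R * `|x| ^+ 2)).
  apply: (@le_trans _ _ (\sum_(i < d) `|x| ^+ 2)); last first.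
    by rewrite sumr_const card_ord -[leLHS]mulr_natl.
  apply: ler_sum => i _; rewrite -expr2 -real_normK ?num_real//.
  by rewrite lerXn2r ?nnegrE// coord_le_norm.
rewrite exprMn ler_wpM2r ?sqr_ge0//.
by case: (d) => [|n]; rewrite ?expr0n// expr2 ler_peMl// ler1n.
Qed.

Definition hsup w : R := sup [set `|w x| | x in closure Omega].
Definition hquot w : R := sup [set r | exists x x', [/\ closure Omega x, closure Omega x', x <> x'
                 & r = `|w x - w x'| / enorm (x - x') `^ mu]].

Lemma holder_normE w : holder_norm Omega mu w = hsup w + hquot w. Proof. by []. Qed.

Lemma sup_le (E : set R) (M : R) : 0 <= M -> (forall r, E r -> r <= M) -> sup E <= M.
Proof.
move=> M0 EM; have [->|/set0P E0] := eqVneq E set0; first by rewrite sup0.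
exact: ge_sup.
Qed.

Lemma le_sup_bounded (E : set R) (M r : R) : (forall r, E r -> r <= M) -> E r -> r <= sup E.
Proof. by move=> EM Er; apply: ub_le_sup => //; exists M. Qed.

(** No boundedness is required, because [sup] is 0 on a set without supremum. *)
Lemma sup_ge0 (E : set R) : (forall r, E r -> 0 <= r) -> 0 <= sup E.
Proof.
move=> E0; have [hE|hE] := pselect (has_sup E); last by rewrite sup_out.
by have [[r Er] ub] := hE; apply: le_trans (E0 r Er) _; exact: ub_le_sup.
Qed.

Lemma hsup_ge0 w : 0 <= hsup w.
Proof. by apply: sup_ge0 => _ [x _ <-]. Qed.

Lemma hquot_ge0 w : 0 <= hquot w.
Proof. by apply: sup_ge0 => _ [x [x' [_ _ _ ->]]]; rewrite divr_ge0// powR_ge0. Qed.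

Lemma holder_norm_ge0 w : 0 <= holder_norm Omega mu w.
Proof. by rewrite holder_normE addr_ge0 ?hsup_ge0 ?hquot_ge0. Qed.

Lemma enorm_sub_powR_gt0 x x' : x <> x' -> 0 < enorm (x - x') `^ mu.
Proof.
move=> xx'; apply: powR_gt0; rewrite lt_neqAle enorm_ge0 andbT eq_sym; apply/eqP.
by move=> /enorm_eq0/eqP; rewrite subr_eq0 => /eqP.
Qed.

Lemma hsup_le w (a : R) : 0 <= a -> (forall x, closure Omega x -> `|w x| <= a) -> hsup w <= a.
Proof. by move=> a0 wa; apply: sup_le => // _ [x Ox <-]; exact: wa. Qed.

Lemma hquot_le w (a : R) : 0 <= a -> holder_bound Omega mu w a -> hquot w <= a.
Proof.
move=> a0 wa; apply: sup_le => // _ [x [x' [Ox Ox' xx' ->]]].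
by rewrite ler_pdivrMr ?enorm_sub_powR_gt0//; exact: wa.
Qed.

Lemma hquotP w : holder Omega mu w -> holder_bound Omega mu w (hquot w).
Proof.
move=> [C wC] x x' Ox Ox'; have [->|/eqP xx'] := eqVneq x x'.
  by rewrite !subrr normr0 mulr_ge0 ?hquot_ge0 ?powR_ge0.
rewrite -ler_pdivrMr ?enorm_sub_powR_gt0//.
apply: (@le_sup_bounded _ C); last by exists x, x'.
move=> _ [z [z' [Oz Oz' zz' ->]]].
by rewrite ler_pdivrMr ?enorm_sub_powR_gt0//; exact: wC.
Qed.

Lemma holder_lin (c : R) w w' : holder Omega mu w -> holder Omega mu w' ->
  holder Omega mu (c *: w + w').
Proof.
move=> [C wC] [C' wC']; exists (`|c| * C + C') => x x' Ox Ox'.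
rewrite (_ : _ - _ = c * (w x - w x') + (w' x - w' x')); last by rewrite !scaleD_funE; ring.
rewrite mulrDl -mulrA; apply: le_trans (ler_normD _ _) _.
by rewrite normrM lerD ?ler_wpM2l//; [exact: wC|exact: wC'].
Qed.

Hypothesis bO : bounded_set Omega.

Lemma closure_bounded : exists B : R, forall x, closure Omega x -> `|x| <= B.
Proof.
have [c [_ /(_ (`|c| + 1)%R)]] := bO.
have -> : (c < `|c| + 1)%R by have := ler_norm c; lra.
move=> /(_ isT) cO; exists (`|c| + 2) => x Ox.
have [y [Oy /ball_norm_lt xy]] := Ox _ (nbhsx_ballx x 1 ltr01).
rewrite -[x](subrK y); apply: le_trans (ler_normD _ _) _.
have := cO y Oy; move: (ltW xy); rewrite /=; lra.
Qed.

(** A Hoelder continuous function on the bounded set [closure Omega] is bounded, so the supremum in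
    the norm is a true upper bound and not a default value. *)
Lemma hsupP w : holder Omega mu w -> forall x, closure Omega x -> `|w x| <= hsup w.
Proof.
move=> [C wC] x Ox; have [B BP] := closure_bounded.
have B0 : 0 <= B by exact: le_trans (BP x Ox).
apply: (@le_sup_bounded _ (`|w x| + `|C| * (d%:R * (B + B)) `^ mu)); last by exists x.
move=> _ [z Oz <-]; rewrite -[w z](subrK (w x)) addrC.
apply: le_trans (ler_normD _ _) _; rewrite lerD2l.
apply: le_trans (wC z x Oz Ox) _; apply: (@le_trans _ _ (`|C| * enorm (z - x) `^ mu)).
  by rewrite ler_wpM2r ?powR_ge0// ler_norm.
rewrite ler_wpM2l// ge0_ler_powR ?nnegrE ?enorm_ge0 ?mulr_ge0 ?addr_ge0 ?(ltW mu0)//.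
apply: le_trans (enorm_le _) _; rewrite ler_wpM2l//.
by apply: le_trans (ler_normB _ _) _; rewrite lerD// BP.
Qed.

Lemma sup_le_holder_norm w : holder Omega mu w ->
  forall x, closure Omega x -> `|w x| <= holder_norm Omega mu w.
Proof.
by move=> hw x Ox; rewrite holder_normE (le_trans (hsupP hw Ox))// lerDl hquot_ge0.
Qed.

Lemma holder_norm_lin (c : R) w w' : holder Omega mu w -> holder Omega mu w' ->
  holder_norm Omega mu (c *: w + w') <=
  `|c| * holder_norm Omega mu w + holder_norm Omega mu w'.
Proof.
move=> hw hw'; rewrite !holder_normE mulrDr addrACA; apply: lerD.
  apply: hsup_le => [|x Ox]; first by rewrite addr_ge0 ?mulr_ge0 ?hsup_ge0.
  rewrite scaleD_funE; apply: le_trans (ler_normD _ _) _.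
  rewrite lerD//; last exact: hsupP.
  by rewrite normrM ler_wpM2l//; exact: hsupP.
apply: hquot_le => [|x x' Ox Ox']; first by rewrite addr_ge0 ?mulr_ge0 ?hquot_ge0.
rewrite (_ : _ - _ = c * (w x - w x') + (w' x - w' x')); last by rewrite !scaleD_funE; ring.
rewrite mulrDl -mulrA; apply: le_trans (ler_normD _ _) _.
by rewrite normrM lerD ?ler_wpM2l//; exact: hquotP.
Qed.

Lemma eq_holder_norm w w' : (forall x, closure Omega x -> w x = w' x) ->
  holder_norm Omega mu w = holder_norm Omega mu w'.
Proof.
move=> ww'; rewrite /holder_norm; congr (sup _ + sup _).
  by apply/seteqP; split => _ [x Ox <-]; exists x; rewrite // ww'.
apply/seteqP; split => _ [x [x' [Ox Ox' xx' ->]]]; exists x, x'; split => //; by rewrite !ww'.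
Qed.

Lemma holder_continuous w x : holder Omega mu w -> closure Omega x ->
  forall e : R, 0 < e -> exists2 r : R, 0 < r &
    forall x', closure Omega x' -> `|x - x'| < r -> `|w x - w x'| < e.
Proof.
move=> [C wC] Ox e e0.
have C1 : 0 < `|C| + 1 by rewrite ltr_wpDl.
pose s := (e / 2 / (`|C| + 1)) `^ mu^-1.
have s0 : 0 < s by rewrite powR_gt0// !divr_gt0.
have D0 : 0 < d%:R + 1 :> R by rewrite ltr_wpDl.
exists (s / (d%:R + 1)) => [|x' Ox' xx']; first by rewrite divr_gt0.
have xs : enorm (x - x') <= s.
  apply: le_trans (enorm_le _) _; move: (ltW xx'); rewrite ler_pdivlMr// mulrC => h.
  by apply: le_trans h; rewrite ler_wpM2r// lerDl.
apply: le_lt_trans (wC x x' Ox Ox') _.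
apply: (@le_lt_trans _ _ ((`|C| + 1) * s `^ mu)).
  apply: (@le_trans _ _ (`|C| * s `^ mu)); last by rewrite ler_wpM2r ?powR_ge0// lerDl.
  apply: (@le_trans _ _ (`|C| * enorm (x - x') `^ mu)).
    by rewrite ler_wpM2r ?powR_ge0// ler_norm.
  by rewrite ler_wpM2l// ge0_ler_powR ?nnegrE ?enorm_ge0 ?(ltW mu0)// ltW.
rewrite /s -powRrM mulVf ?gt_eqF// powRr1 ?(ltW (divr_gt0 (divr_gt0 e0 (ltr0Sn R 1)) C1))//.
rewrite mulrC divfK ?gt_eqF//; lra.
Qed.

(** The Cauchy estimate between two indices passes to the pointwise limit in one of them, both for
    the values and for the Hoelder bound. *)
Lemma holder_complete (F : nat -> 'rV[R]_d -> R) : (forall n, holder Omega mu (F n)) ->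
  (forall e : R, 0 < e -> exists N, forall m n, (N <= m)%N -> (N <= n)%N ->
     holder_norm Omega mu (F m - F n) <= e) ->
  exists2 f, holder Omega mu f & forall e : R, 0 < e -> exists N, forall n, (N <= n)%N ->
     holder_norm Omega mu (F n - f) <= e.
Proof.
move=> hF cF.
have hB m n : holder Omega mu (F m - F n).
  by have := holder_lin (-1) (hF n) (hF m); rewrite scaleN1r addrC.
(* Only the values on [closure Omega] are controlled; elsewhere this limit may be a default
   value. *)
pose f x := limn (F^~ x).
have cv x : closure Omega x -> F^~ x @ \oo --> f x.
  move=> Ox; apply: cauchy_cvg; apply: cauchy_exP => e e0.
  have [N NP] := cF (e / 2) (divr_gt0 e0 (ltr0Sn R 1)).
  exists (F N x); exists N => // n /= Nn; rewrite /ball/=.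
  have := sup_le_holder_norm (hB N n) Ox; rewrite -[(_ - _) x]/(F N x - F n x).
  by have := NP N n (leqnn _) Nn; lra.
have lim_le (u : nat -> R) l (B : R) N : u @ \oo --> l ->
    (forall n, (N <= n)%N -> `|u n| <= B) -> `|l| <= B.
  move=> ul uB; rewrite -(cvg_lim _ (cvg_norm ul))//; apply: limr_le.
    by apply/cvg_ex; eexists; exact: cvg_norm ul.
  by exists N.
have est e : 0 < e -> exists N, forall n, (N <= n)%N ->
    hsup (F n - f) <= e /\ holder_bound Omega mu (F n - f) e.
  move=> e0; have [N NP] := cF e e0; exists N => n Nn; split.
    apply: hsup_le => [|x Ox]; first exact: ltW.
    apply: (lim_le (fun m => F n x - F m x) _ _ N).
      by apply: cvgB; [exact: cvg_cst|exact: cv].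
    move=> m Nm; apply: le_trans (NP n m Nn Nm).
    exact: (sup_le_holder_norm (hB n m) Ox).
  move=> x x' Ox Ox'.
  apply: (lim_le (fun m => (F n x - F m x) - (F n x' - F m x')) _ _ N).
    by apply: cvgB; apply: cvgB; [exact: cvg_cst|exact: cv|exact: cvg_cst|exact: cv].
  move=> m Nm; apply: le_trans (hquotP (hB n m) Ox Ox') _.
  rewrite ler_wpM2r ?powR_ge0//; apply: le_trans (NP n m Nn Nm).
  by rewrite holder_normE lerDr hsup_ge0.
exists f.
  have [N /(_ N (leqnn _))[_ hN]] := est 1 ltr01.
  have := holder_lin (-1) (ex_intro _ _ hN : holder Omega mu (F N - f)) (hF N).
  by rewrite scaleN1r opprB subrK.
move=> e e0; have [N NP] := est (e / 2) (divr_gt0 e0 (ltr0Sn R 1)).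
exists N => n /NP[h1 h2]; rewrite holder_normE [leRHS]splitr lerD//.
by apply: hquot_le => //; rewrite ltW// divr_gt0.
Qed.

End holder_space.

Section holder_ae.
Variables (R : realType) (d : nat) (Omega : set 'rV[R]_d) (mu : R).
Hypotheses (hd : d = 2%N \/ d = 3%N) (oO : open Omega) (mu0 : 0 < mu).
Implicit Types (w : 'rV[R]_d -> R) (x : 'rV[R]_d).

(* A nonempty open set has positive measure, so w = w' on a dense subset of Omega. *)
Lemma holder_ae_eq w w' : holder Omega mu w -> holder Omega mu w' ->
  aeO Omega (fun x => w x = w' x) -> forall x, closure Omega x -> w x = w' x.
Proof.
move=> hw hw' aeww' x Ox; apply: contrapT => /eqP wx.
pose e := `|w x - w' x| / 2.
have e0 : 0 < e by rewrite divr_gt0// normr_gt0 subr_eq0.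
have [r r0 rP] := holder_continuous mu0 hw Ox e0.
have [r' r'0 rP'] := holder_continuous mu0 hw' Ox e0.
pose U := Omega `&` ball x (Num.min r r').
have oU : open U by apply: openI => //; exact: ball_open.
have U0 : U !=set0.
  by apply: Ox; apply: nbhsx_ballx; rewrite lt_min r0.
have := leb_open_gt0 hd oU U0.
have [N [mN N0 sub]] := aeww'.
suff UN : U `<=` N.
  have : (leb R d U <= leb R d N)%E by exact: (@le_outer_measure _ _ (leb_outer R d)).
  by rewrite N0 leNgt => /negP.
move=> z [Oz /ball_norm_lt]; rewrite lt_min => /andP[zr zr'].
apply: sub => /= /(_ Oz) wz.
have Oz' : closure Omega z by exact: subset_closure.
have := rP z Oz' zr; have := rP' z Oz' zr'; rewrite wz.
have := ler_distD (w' z) (w x) (w' x); rewrite [X in _ <= _ + X]distrC.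
have : `|w x - w' x| = 2 * e by rewrite /e; field.
lra.
Qed.

End holder_ae.

(** * Caratheodory functions *)

Section caratheodory_functions.
Context d (T : measurableType d) (R : realType) (mu : {measure set T -> \bar R}).
Variable D : set T.
Hypotheses (mD : measurable D) (cmu : measure_is_complete mu).

Lemma ae_eq_measurable_fun (f g : T -> R) : measurable_fun D f ->
  (\forall x \ae mu, D x -> f x = g x) -> measurable_fun D g.
Proof.
move=> mf fg; apply/measurable_EFinP.
apply: (ae_measurable_fun cmu (f := EFin \o f)); last exact/measurable_EFinP.
by apply: filterS fg => x + Dx => /(_ Dx) /= ->.
Qed.

(** The Caratheodory and differentiability conditions hold for almost every [x] only; completeness
    of the measure lets the exceptional set be ignored. *)
Lemma ae_cvg_measurable_fun (f_ : (T -> R)^nat) (f : T -> R) :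
  (forall n, measurable_fun D (f_ n)) ->
  (\forall x \ae mu, D x -> f_ n x @[n --> \oo] --> f x) -> measurable_fun D f.
Proof.
move=> mf [N [mN N0 sub]].
have aeN : \forall x \ae mu, D x -> f x * \1_(~` N) x = f x.
  exists N; split => // x /=; apply: contra_notP => Nx Dx.
  by rewrite indicE mem_set// mulr1.
apply: ae_eq_measurable_fun aeN.
apply: (@measurable_fun_cvg _ _ _ _ (fun n x => f_ n x * \1_(~` N) x)) => [n|x Dx].
  by apply: measurable_funM => //; apply: measurable_indic; exact: measurableC.
rewrite indicE; case: (boolP (x \in _)) => [/set_mem Nx|_].
  under eq_fun do rewrite mulr1; rewrite mulr1.
  have := contra_not (@sub x) Nx; move/contrapT; exact.
by under eq_fun do rewrite mulr0; rewrite mulr0; exact: cvg_cst.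
Qed.

(** On each of the countably many sets where the floor equals [k], the composition is the section of
    [F] at [k / (n + 1)]. *)
Lemma measurable_floor_comp (F : T -> R -> R) (y : T -> R) (n : nat) :
  (forall t, measurable_fun D (F^~ t)) -> measurable_fun D y ->
  measurable_fun D (fun x => F x ((Num.floor (n.+1%:R * y x))%:~R / n.+1%:R)).
Proof.
move=> mF my _ Y mY.
rewrite (_ : D `&` _ = \bigcup_(k : int)
   ((D `&` (fun x => n.+1%:R * y x) @^-1` `[k%:~R, (k + 1)%:~R[%classic) `&`
    (D `&` (fun x => F x (k%:~R / n.+1%:R)) @^-1` Y))).
  apply: countable_bigcupT_measurable => // k; apply: measurableI.
  - have m1 : measurable_fun D (fun x => n.+1%:R * y x) by exact: measurable_funM.
    exact: m1.
  - exact: mF.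
apply/seteqP; split => x.
  move=> [Dx Yx]; exists (Num.floor (n.+1%:R * y x)) => //; split; split => //.
  by rewrite /= in_itv/= floor_le_tmp floorD1_gt.
move=> [k _ [[Dx /=]]]; rewrite in_itv/= => /floor_def <- [_ ?].
by split.
Qed.

(** The rounded functions approximate [y] within [1 / (n + 1)], and continuity of [F x] passes to
    the limit. *)
Lemma caratheodory_comp_measurable (F : T -> R -> R) (y : T -> R) :
  (forall t, measurable_fun D (F^~ t)) ->
  (\forall x \ae mu, D x -> continuous (F x)) -> measurable_fun D y ->
  measurable_fun D (fun x => F x (y x)).
Proof.
move=> mF cF my.
apply: (ae_cvg_measurable_fun (fun n => measurable_floor_comp n mF my)).
apply: filterS cF => x + Dx => /(_ Dx) cFx.
apply: (@cvg_comp _ _ _ (fun n => (Num.floor (n.+1%:R * y x))%:~R / n.+1%:R) (F x)); last exact: cFx.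
apply/cvgrPdist_le => e e0.
have [N NP] := ltr_add_invr e0; exists N => // n /= Nn.
have n0 : 0 < n.+1%:R :> R by rewrite ltr0n.
rewrite (_ : y x - _ = (n.+1%:R * y x - (Num.floor (n.+1%:R * y x))%:~R) / n.+1%:R); last by field.
have h1 := floor_le_tmp (n.+1%:R * y x); have := floorD1_gt (n.+1%:R * y x).
rewrite intrD => h2.
rewrite ger0_norm ?divr_ge0 ?subr_ge0// ler_pdivrMr//.
apply: (@le_trans _ _ 1); first lra.
move: NP; rewrite add0r => NP.
apply: (@le_trans _ _ (e * N.+1%:R)).
  by rewrite -ler_pdivrMr ?ltr0n// div1r ltW.
by rewrite ler_wpM2l ?(ltW e0)// ler_nat.
Qed.

(** The derivative is a limit of difference quotients. The premise concerns all measurable [y], so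
    that the lemma can be applied to its own conclusion and reaches the second derivative. *)
Lemma derive1_comp_measurable (F : T -> R -> R) :
  (forall y, measurable_fun D y -> measurable_fun D (fun x => F x (y x))) ->
  (\forall x \ae mu, D x -> forall t, derivable (F x) t 1) ->
  forall y, measurable_fun D y -> measurable_fun D (fun x => derive1 (F x) (y x)).
Proof.
move=> mF dF y my.
pose q n x := n.+1%:R * (F x (y x + n.+1%:R^-1) - F x (y x)).
have mq n : measurable_fun D (q n).
  apply: measurable_funM => //; apply: measurable_funB; last exact: mF.
  by apply: mF; apply: measurable_funD.
apply: (ae_cvg_measurable_fun mq).
apply: filterS dF => x + Dx => /(_ Dx) /(_ (y x)) dFx.
have n1 : (forall n, (n.+1%:R^-1 : R) != 0) /\ (n.+1%:R^-1 : R) @[n --> \oo] --> (0 : R).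
  by split=> [n|]; [rewrite invr_eq0 pnatr_eq0|exact: cvg_harmonic].
have /cvgr_dnbhsP /(_ _ n1) := dFx; rewrite derive1E.
apply: cvg_trans; rewrite (_ : (fun n => q n x) = (fun n => (n.+1%:R^-1)^-1 *:
    ((F x \o shift (y x)) (n.+1%:R^-1 *: (1 : R)) - F x (y x))))//.
by apply/funext => n /=; rewrite /q invrK [_ *: (1 : R)]mulr1 [X in F x X]addrC.
Qed.

End caratheodory_functions.

(** The end points come in either order, and the bound on [|xi|] matches the hypotheses on the
    nonlinearity and the cost, which are local in [|y| <= M]. *)
Lemma MVT_derive1 (R : realType) (f : R -> R) (a b : R) : (forall y, derivable f y 1) ->
  exists xi, [/\ `|xi - a| <= `|b - a|, `|xi| <= Num.max `|a| `|b| &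
    f b - f a = derive1 f xi * (b - a)].
Proof.
move=> df.
have cf : continuous f.
  by move=> y; apply: differentiable_continuous; apply/derivable1_diffP.
have isd (y : R) : is_derive y 1 f (derive1 f y) by rewrite derive1E; exact: derivableP.
have [ab|ba] := leP a b.
  have [c] := MVT_segment ab (fun y _ => isd y) (continuous_subspaceT cf).
  rewrite in_itv/= => /andP[ac cb] E; exists c; split => //.
    by rewrite !ger0_norm ?subr_ge0// lerD2r.
  rewrite le_max; case: (ger0P c) => c0; apply/orP.
    by right; rewrite (le_trans cb)// ler_norm.
  by left; rewrite -[`|a|]normrN (le_trans _ (ler_norm _))// lerN2.
have [c] := MVT_segment (ltW ba) (fun y _ => isd y) (continuous_subspaceT cf).
rewrite in_itv/= => /andP[bc ca] E; exists c; split => //.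
- by rewrite !ler0_norm ?subr_le0 ?(ltW ba)// !opprB lerD2l lerN2.
- rewrite le_max; case: (ger0P c) => c0; apply/orP.
    by left; rewrite (le_trans ca)// ler_norm.
  by right; rewrite -[`|b|]normrN (le_trans _ (ler_norm _))// lerN2.
- by rewrite -opprB E -mulrN opprB.
Qed.

(** * Weak solutions of linear equations *)

Section finite_sums_and_bounds.
Context d (T : measurableType d) (R : realType) (mu : {measure set T -> \bar R}).
Variable D : set T.
Hypothesis mD : measurable D.
Implicit Types f g : T -> R.

Lemma Rintegral_sum (I : Type) (s : seq I) (F : I -> T -> R) :
  (forall i, mu.-integrable D (EFin \o F i)) ->
  mu.-integrable D (EFin \o (fun x => \sum_(i <- s) F i x)) /\
  \int[mu]_(x in D) (\sum_(i <- s) F i x) = \sum_(i <- s) \int[mu]_(x in D) F i x.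
Proof.
move=> iF; elim: s => [|i s [ih1 ih2]].
  split; last by rewrite big_nil; under eq_Rintegral do rewrite big_nil; rewrite Rintegral_cst// mul0r.
  have i0 : mu.-integrable D (EFin \o (fun _ : T => 0 : R)) by exact: integrable0.
  by apply: eq_integrable i0 => // x _ /=; rewrite big_nil.
split.
  by apply: eq_integrable (integrableD_EFin mD (iF i) ih1) => // x _ /=; rewrite big_cons.
by rewrite big_cons -ih2 -RintegralD//; apply: eq_Rintegral => x _; rewrite big_cons.
Qed.

(** The extended integral is then infinite, and [fine] sends it to 0. [source_integrable] extracts
    information from this default value. *)
Lemma Rintegral_non_integrable f : measurable_fun D f ->
  ~ mu.-integrable D (EFin \o f) -> \int[mu]_(x in D) f x = 0.
Proof.
move=> mf nif; have mEf : measurable_fun D (EFin \o f) by exact/measurable_EFinP.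
have : (\int[mu]_(x in D) (EFin \o f) x)%E \isn't a fin_num.
  rewrite -integral_fin_num_abs//; apply/negP => lty; apply: nif.
  by apply/integrableP.
by rewrite fin_numEn => /orP[|] /eqP E; rewrite /Rintegral [X in fine X]E.
Qed.

Lemma sqint_norm f : sqint mu D f -> sqint mu D (fun x => `|f x|).
Proof.
move=> [mf f2]; split; first exact: measurableT_comp.
by apply: eq_integrable f2 => // x _ /=; rewrite real_normK ?num_real.
Qed.

Lemma n2_norm f : n2 mu D (fun x => `|f x|) = n2 mu D f.
Proof. by congr Num.sqrt; apply: eq_Rintegral => x _; rewrite real_normK ?num_real. Qed.

(** Splits an unbounded L2 coefficient into a bounded part and a part of small L2 norm; the latter
    tends to 0 by dominated convergence with majorant [f^2]. *)
Lemma sqint_truncation f (e : R) : sqint mu D f -> 0 < e ->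
  exists n : nat, sqint mu D (fun x => if `|f x| <= n%:R then 0 else f x) /\
    n2 mu D (fun x => if `|f x| <= n%:R then 0 else f x) <= e.
Proof.
move=> [mf f2] e0; pose q (n : nat) x := if `|f x| <= n%:R then 0 else f x.
have mq n : measurable_fun D (q n).
  apply: measurable_fun_if => //.
    by apply: (measurable_fun_ler (f := fun x => `|f x|)) => //; exact: measurableT_comp.
  by apply: measurable_funS mf => // x [].
have cv : \int[mu]_(x in D) (q n x ^+ 2) @[n --> \oo] --> \int[mu]_(x in D) (0 : R).
  apply: (@Rintegral_dominated_cvg _ _ _ mu D (fun n x => q n x ^+ 2) (fun=> 0) (fun x => f x ^+ 2) mD) => //.
  - by move=> n; exact: measurable_funX.
  - apply: aeW => x Dx; apply: cvg_near_cst.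
    have [N NP] := ltr_add_invr (ltr01 : 0 < 1 :> R).
    (* From this index on the truncation threshold exceeds [|f x|]. *)
    exists (Num.truncn `|f x|).+1 => // n /= Nn; rewrite /q ifT ?expr0n//.
    apply: le_trans (_ : (Num.truncn `|f x|).+1%:R <= _); last by rewrite ler_nat.
    exact/ltW/truncnS_gt.
  - apply: aeW => x Dx n; rewrite ger0_norm ?sqr_ge0// /q.
    by case: ifP => // _; rewrite expr0n sqr_ge0.
move: cv; rewrite Rintegral_cst// mul0r => /cvgrPdist_le /(_ (e ^+ 2)).
rewrite exprn_gt0// => /(_ isT)[N _ /(_ N (leqnn _))]; rewrite sub0r normrN => h.
exists N; split.
  split; first exact: mq.
  apply: (ae_le_integrable mD (measurable_funX 2 (mq N)) f2).
  by apply: aeW => x _; rewrite ger0_norm ?sqr_ge0// /q; case: ifP => // _; rewrite expr0n sqr_ge0.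
rewrite -ler_sqr ?nnegrE ?n2_ge0 ?(ltW e0)// sqr_n2.
by apply: le_trans h; exact: ler_norm.
Qed.

Hypothesis Dfin : (mu D < +oo)%E.

Lemma ae_le_sqint_affine f g (a b : R) : 0 <= a -> 0 <= b -> measurable_fun D f ->
  sqint mu D g -> (\forall x \ae mu, D x -> `|f x| <= a + b * `|g x|) ->
  sqint mu D f /\ n2 mu D f <= a * n2 mu D (fun=> 1) + b * n2 mu D g.
Proof.
move=> a0 b0 mf sg fg.
have sa := sqint_cst mD Dfin a; have sb := sqintZ mD b (sqint_norm sg).
have [sf le] := ae_le_sqint mD mf (sqintD mD sa sb) fg.
split => //; apply: le_trans le _; apply: le_trans (n2D mD sa sb) _.
by rewrite (n2_cst mD Dfin)// (n2Z mD)// ?n2_norm ?ger0_norm//; exact: sqint_norm.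
Qed.

Lemma sqint_bounded_mul f g (C : R) : 0 <= C -> measurable_fun D f ->
  (\forall x \ae mu, D x -> `|f x| <= C) -> sqint mu D g ->
  sqint mu D (fun x => f x * g x) /\ n2 mu D (fun x => f x * g x) <= C * n2 mu D g.
Proof.
move=> C0 mf fC sg; have [mg _] := sg.
rewrite -[leRHS]add0r -(mul0r (n2 mu D (fun=> 1))).
apply: ae_le_sqint_affine => //; first exact: measurable_funM.
by apply: filterS fC => x + Dx => /(_ Dx) fx; rewrite add0r normrM ler_wpM2r.
Qed.

End finite_sums_and_bounds.

Section bilinear_form.
Variables (R : realType) (d : nat) (Omega : set 'rV[R]_d).
Hypotheses (oO : open Omega) (bO : bounded_set Omega).
Local Notation lebT := (caratheodory_type (leb_outer R d)).
Local Notation mu := (leb R d).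
Local Notation sq := (@sqint _ lebT R mu (Omega : set lebT)).
Local Notation N2 := (@n2 _ lebT R mu (Omega : set lebT)).
Local Notation D i v := (fun x => wgrad Omega v x 0 i).
Implicit Types (f g v y z : 'rV[R]_d -> R) (B : 'rV[R]_d -> 'M[R]_d).
Let mO := measurable_Omega oO.
Let Ofin := leb_Omega_lty bO.

Definition aform B y v : R :=
  intO Omega (fun x => \sum_i \sum_j B x i j * wgrad Omega y x 0 i * wgrad Omega v x 0 j).

Definition bounded_coef B := forall i j, Lp Omega +oo%E (fun x => B x i j).

Lemma aform_transp B y v : aform (transp B) y v = aform B v y.
Proof.
apply: eq_Rintegral => x _; rewrite exchange_big/=; apply: eq_bigr => i _.
by apply: eq_bigr => j _; rewrite mxE mulrAC.
Qed.

Lemma bounded_coefP B : bounded_coef B -> exists2 C : R, 0 <= C &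
  forall i j, measurable_fun (Omega : set lebT) (fun x : lebT => B x i j) /\
    aeO Omega (fun x => `|B x i j| <= C).
Proof.
move=> bB.
have /choice[C CP] : forall ij : 'I_d * 'I_d, exists C : R,
    aeO Omega (fun x => `|B x ij.1 ij.2| <= C).
  by move=> [i j]; have [C CP] := Linfty_bounded (bB i j); exists C.
exists (\sum_ij `|C ij|); first by apply: sumr_ge0.
move=> i j; split; first exact: (Lfun_measurable mO (bB i j)).
apply: aeO_mono (CP (i, j)) => x _ /= h; apply: le_trans h _.
apply: le_trans (ler_norm _) _; rewrite (bigD1 (i, j))//= lerDl.
by apply: sumr_ge0.
Qed.

Lemma aform_term B y v i j : bounded_coef B -> H1 Omega y -> H1 Omega v ->
  mu.-integrable (Omega : set lebT)
    (EFin \o (fun x : lebT => B x i j * wgrad Omega y x 0 i * wgrad Omega v x 0 j)).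
Proof.
move=> /bounded_coefP[C C0 /(_ i j)[mB BC]] Hy Hv.
have [sBy _] := sqint_bounded_mul mO Ofin C0 mB BC (wgrad_sqint oO i Hy).
exact: (sqint_mul mO sBy (wgrad_sqint oO j Hv)).
Qed.

Lemma aformE B y v : bounded_coef B -> H1 Omega y -> H1 Omega v ->
  aform B y v = \sum_i \sum_j
    intO Omega (fun x => B x i j * wgrad Omega y x 0 i * wgrad Omega v x 0 j).
Proof.
move=> bB Hy Hv.
have inner i := Rintegral_sum mO (index_enum 'I_d) (fun j => aform_term i j bB Hy Hv).
have [_ E] := Rintegral_sum mO (index_enum 'I_d) (fun i => (inner i).1).
by rewrite /aform /intO E; apply: eq_bigr => i _; exact: (inner i).2.
Qed.

Lemma aform_linl B (c : R) y y' v : bounded_coef B ->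
  H1 Omega y -> H1 Omega y' -> H1 Omega v ->
  aform B (c *: y + y') v = c * aform B y v + aform B y' v.
Proof.
move=> bB Hy Hy' Hv; have Hl := H1_lin oO bO c Hy Hy'.
rewrite !aformE// mulr_sumr -big_split/=; apply: eq_bigr => i _.
rewrite mulr_sumr -big_split/=; apply: eq_bigr => j _.
have i1 := aform_term i j bB Hy Hv; have i2 := aform_term i j bB Hy' Hv.
rewrite /intO -RintegralZl// -RintegralD//; last exact: integrableZl_EFin.
apply: (ae_eq_Rintegral mO).
- exact: integrable_measurable (aform_term i j bB Hl Hv).
- apply: measurable_funD; last exact: integrable_measurable i2.
  by apply: measurable_funM; [exact: measurable_cst|exact: integrable_measurable i1].
- by apply: aeO_mono (wgrad_lin oO bO c Hy Hy') => x _ ->; rewrite !mxE; ring.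
Qed.

Lemma bounded_coef_transp B : bounded_coef B -> bounded_coef (transp B).
Proof.
move=> bB i j; rewrite (_ : (fun x => _) = (fun x => B x j i))//.
by apply/funext => x; rewrite mxE.
Qed.

Lemma aform_linr B (c : R) y v v' : bounded_coef B ->
  H1 Omega y -> H1 Omega v -> H1 Omega v' ->
  aform B y (c *: v + v') = c * aform B y v + aform B y v'.
Proof.
move=> bB Hy Hv Hv'; rewrite -!(aform_transp B); apply: aform_linl => //.
exact: bounded_coef_transp.
Qed.

Lemma aform_bound B : bounded_coef B -> exists2 C : R, 0 <= C &
  forall y v, H1 Omega y -> H1 Omega v ->
    `|aform B y v| <= C * H1_norm Omega y * H1_norm Omega v.
Proof.
move=> bB; have [C C0 CP] := bounded_coefP bB.
exists (\sum_(i < d) \sum_(j < d) C) => [|y v Hy Hv].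
  by apply: sumr_ge0 => i _; apply: sumr_ge0.
rewrite aformE// -mulrA mulr_suml; apply: le_trans (ler_norm_sum _ _ _) _.
apply: ler_sum => i _; rewrite mulr_suml; apply: le_trans (ler_norm_sum _ _ _) _.
apply: ler_sum => j _; have [mB BC] := CP i j.
have [sBy By] := sqint_bounded_mul mO Ofin C0 mB BC (wgrad_sqint oO i Hy).
apply: le_trans (cauchy_schwarz mO sBy (wgrad_sqint oO j Hv)) _.
rewrite mulrA; apply: ler_pM; rewrite ?n2_ge0//; last exact: N2_wgrad_le_H1_norm.
by apply: le_trans By _; rewrite ler_wpM2l//; exact: N2_wgrad_le_H1_norm.
Qed.

Lemma aform_coercive B (lambda : R) v : bounded_coef B ->
  aeO Omega (fun x => forall xi : 'rV[R]_d,
    lambda * enorm xi ^+ 2 <= \sum_i \sum_j B x i j * xi 0 i * xi 0 j) ->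
  H1 Omega v -> lambda * \sum_i N2 (D i v) ^+ 2 <= aform B v v.
Proof.
move=> bB Bl Hv.
have inner i := Rintegral_sum mO (index_enum 'I_d) (fun j => aform_term i j bB Hv Hv).
have [iS _] := Rintegral_sum mO (index_enum 'I_d) (fun i => (inner i).1).
have i2 i : mu.-integrable (Omega : set lebT) (EFin \o (fun x : lebT => wgrad Omega v x 0 i ^+ 2)).
  by have [] := wgrad_sqint oO i Hv.
have [iD ED] := Rintegral_sum mO (index_enum 'I_d) i2.
under eq_bigr do rewrite sqr_n2.
rewrite -ED -RintegralZl//; apply: (ae_le_Rintegral mO) => //.
  exact: integrableZl_EFin.
apply: aeO_mono Bl => x _ /(_ (wgrad Omega v x)); apply: le_trans.
rewrite /enorm sqr_sqrtr; last by apply: sumr_ge0 => i _; rewrite -expr2 sqr_ge0.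
by rewrite le_eqVlt; apply/orP; left; apply/eqP; congr (_ * _); apply: eq_bigr => i _; rewrite expr2.
Qed.

Lemma weak_neumannE B y l f : weak_neumann Omega B y l f (fun=> 0) <->
  (H1 Omega y /\ forall v, H1 Omega v ->
    aform B y v + intO Omega (fun x => l x * v x) = intO Omega (fun x => f x * v x)).
Proof.
have G0 v : intG Omega (fun x => (fun=> 0 : R) x * trace Omega v x) = 0.
  rewrite /intG /Rintegral; under eq_integral do rewrite mul0r.
  by rewrite integral0.
split=> -[Hy yP]; split=> // v /yP.
  by rewrite G0 addr0.
by rewrite G0 addr0.
Qed.

End bilinear_form.

Lemma lin_rearr (R : comPzRingType) (k x x' y y' : R) :
  (k * x + x') + (k * y + y') = k * (x + y) + (x' + y').
Proof. by rewrite mulrDr addrACA. Qed.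

Lemma sqr_mul_le (R : realDomainType) (C h k a b : R) : 0 <= a -> 0 <= b ->
  a <= C * h -> b <= C * k -> a ^+ 2 * b ^+ 2 <= (C ^+ 2 * h * k) ^+ 2.
Proof.
move=> a0 b0 aC bC.
rewrite (_ : (C ^+ 2 * h * k) ^+ 2 = (C * h) ^+ 2 * (C * k) ^+ 2); last by ring.
by apply: ler_pM; rewrite ?sqr_ge0// lerXn2r ?nnegrE//; exact: (le_trans _ aC) || exact: (le_trans _ bC).
Qed.

(** * Weak equations with a zero order coefficient in L2 *)

Section weak_solutions.
Variables (R : realType) (d : nat) (Omega : set 'rV[R]_d).
Hypotheses (oO : open Omega) (bO : bounded_set Omega).
Local Notation lebT := (caratheodory_type (leb_outer R d)).
Local Notation mu := (leb R d).
Local Notation sq := (@sqint _ lebT R mu (Omega : set lebT)).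
Local Notation N2 := (@n2 _ lebT R mu (Omega : set lebT)).
Local Notation itg f := (mu.-integrable (Omega : set lebT) (EFin \o (f : lebT -> R))).
Local Notation Hn := (H1_norm Omega).
Implicit Types (f g v w y z c : 'rV[R]_d -> R).
Variables (B : 'rV[R]_d -> 'M[R]_d) (C4 : R).
Hypotheses (bB : bounded_coef Omega B) (C40 : 0 < C4) (hemb : L4_embedding Omega C4).
Let mO := measurable_Omega oO.
Let Ofin := leb_Omega_lty bO.
Local Opaque n2 H1_norm.

(** Both squares are in L2 by the L4 embedding, and Cauchy-Schwarz applies to them. This gives
    meaning to the form with a coefficient that is merely square-integrable. *)
Lemma H1_mul z v : H1 Omega z -> H1 Omega v ->
  sq (fun x => z x * v x) /\ N2 (fun x => z x * v x) <= C4 ^+ 2 * Hn z * Hn v.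
Proof.
move=> Hz Hv; have [z4 zn] := hemb Hz; have [v4 vn] := hemb Hv.
have [sz zE] := Lfun4_sqr mO z4; have [sv vE] := Lfun4_sqr mO v4.
have [mz _] := H1_sqint oO Hz; have [mv _] := H1_sqint oO Hv.
have E : (fun x : lebT => (z x * v x) ^+ 2) = (fun x => z x ^+ 2 * v x ^+ 2).
  by apply/funext => x; rewrite exprMn.
split; first by split; [exact: measurable_funM|rewrite E; exact: (sqint_mul mO sz sv)].
have p0 : 0 <= C4 ^+ 2 * Hn z * Hn v.
  exact: mulr_ge0 (mulr_ge0 (sqr_ge0 _) (H1_norm_ge0 _ _)) (H1_norm_ge0 _ _).
rewrite -ler_sqr ?nnegrE ?n2_ge0// sqr_n2 E.
apply: le_trans (ler_norm _) _; apply: le_trans (cauchy_schwarz mO sz sv) _.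
rewrite zE vE -/(Lp_norm Omega 4%:E z) -/(Lp_norm Omega 4%:E v).
have Lz : 0 <= Lp_norm Omega 4%:E z by rewrite fine_ge0 ?Lnorm_ge0.
have Lv : 0 <= Lp_norm Omega 4%:E v by rewrite fine_ge0 ?Lnorm_ge0.
move: (Lp_norm _ _ z) (Lp_norm _ _ v) Lz Lv zn vn => a b a0 b0 aC bC.
exact: (sqr_mul_le a0 b0 aC bC).
Qed.

Lemma itg_potential c z v : sq c -> H1 Omega z -> H1 Omega v -> itg (fun x => c x * z x * v x).
Proof.
move=> sc Hz Hv; have [szv _] := H1_mul Hz Hv.
by apply: eq_integrable (sqint_mul mO sc szv) => // x _ /=; rewrite mulrA.
Qed.

Lemma potential_bound c z v : sq c -> H1 Omega z -> H1 Omega v ->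
  `|intO Omega (fun x => c x * z x * v x)| <= N2 c * (C4 ^+ 2 * Hn z * Hn v).
Proof.
move=> sc Hz Hv; have [szv zvn] := H1_mul Hz Hv.
rewrite (_ : intO _ _ = \int[mu]_(x in Omega) (c x * (z x * v x))); last first.
  by apply: eq_Rintegral => x _; rewrite mulrA.
by apply: le_trans (cauchy_schwarz mO sc szv) _; rewrite ler_wpM2l ?n2_ge0.
Qed.

Definition cform c z v : R := aform Omega B z v + intO Omega (fun x => c x * z x * v x).

Lemma cform_linl c (k : R) z z' v : sq c -> H1 Omega z -> H1 Omega z' -> H1 Omega v ->
  cform c (k *: z + z') v = k * cform c z v + cform c z' v.
Proof.
move=> sc Hz Hz' Hv; rewrite /cform aform_linl//.
have i1 := itg_potential sc Hz Hv; have i2 := itg_potential sc Hz' Hv.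
have -> : intO Omega (fun x => c x * (k *: z + z') x * v x) =
    k * intO Omega (fun x => c x * z x * v x) + intO Omega (fun x => c x * z' x * v x).
  rewrite /intO -(RintegralZl k mO i1) -(RintegralD mO (integrableZl_EFin mO k i1) i2).
  by apply: eq_Rintegral => x _; rewrite scaleD_funE; ring.
apply: lin_rearr.
Qed.

Lemma cform_linr c (k : R) z v v' : sq c -> H1 Omega z -> H1 Omega v -> H1 Omega v' ->
  cform c z (k *: v + v') = k * cform c z v + cform c z v'.
Proof.
move=> sc Hz Hv Hv'; rewrite /cform aform_linr//.
have i1 := itg_potential sc Hz Hv; have i2 := itg_potential sc Hz Hv'.
have -> : intO Omega (fun x => c x * z x * (k *: v + v') x) =
    k * intO Omega (fun x => c x * z x * v x) + intO Omega (fun x => c x * z x * v' x).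
  rewrite /intO -(RintegralZl k mO i1) -(RintegralD mO (integrableZl_EFin mO k i1) i2).
  by apply: eq_Rintegral => x _; rewrite scaleD_funE; ring.
apply: lin_rearr.
Qed.

Lemma cform_bound c : sq c -> exists2 C : R, 0 <= C & forall z v, H1 Omega z -> H1 Omega v ->
  `|cform c z v| <= C * Hn z * Hn v.
Proof.
move=> sc; have [C C0 CP] := aform_bound oO bO bB.
exists (C + N2 c * C4 ^+ 2) => [|z v Hz Hv]; first by rewrite addr_ge0// mulr_ge0 ?n2_ge0 ?sqr_ge0.
apply: le_trans (ler_normD _ _) _.
apply: le_trans (lerD (CP z v Hz Hv) (potential_bound sc Hz Hv)) _.
move: (Hn z) (Hn v) (N2 c) => h k n.
by rewrite le_eqVlt; apply/orP; left; apply/eqP; ring.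
Qed.

(** Homogeneous Neumann problem with zero order coefficient [c]. No integrability of [f] is built
    in, since the adjoint right-hand side need not be in L2. *)
Definition wsol c z f := H1 Omega z /\ forall v, H1 Omega v ->
  cform c z v = intO Omega (fun x => f x * v x).

Lemma itg_source f v : sq f -> H1 Omega v -> itg (fun x => f x * v x).
Proof. by move=> sf Hv; exact: (sqint_mul mO sf (H1_sqint oO Hv)). Qed.

Lemma source_bound f v : sq f -> H1 Omega v ->
  `|intO Omega (fun x => f x * v x)| <= N2 f * Hn v.
Proof.
move=> sf Hv; apply: le_trans (cauchy_schwarz mO sf (H1_sqint oO Hv)) _.
by rewrite ler_wpM2l ?n2_ge0//; exact: N2_le_H1_norm.
Qed.

Lemma wsol_lin c (k : R) z z' f f' : sq c -> sq f -> sq f' ->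
  wsol c z f -> wsol c z' f' -> wsol c (k *: z + z') (fun x => k * f x + f' x).
Proof.
move=> sc sf sf' [Hz zP] [Hz' zP']; split; first exact: H1_lin.
move=> v Hv; rewrite cform_linl// zP// zP'//.
have i1 := itg_source sf Hv; have i2 := itg_source sf' Hv.
rewrite /intO -(RintegralZl k mO i1) -(RintegralD mO (integrableZl_EFin mO k i1) i2).
by apply: eq_Rintegral => x _; ring.
Qed.

Lemma eq_wsol c z f f' : (forall x, Omega x -> f x = f' x) -> wsol c z f -> wsol c z f'.
Proof.
move=> ff' [Hz zP]; split => // v Hv; rewrite zP//.
by apply: eq_Rintegral => x /set_mem /ff' ->.
Qed.

Lemma wsol_closed c (zn fn : nat -> 'rV[R]_d -> R) z f : sq c ->
  (forall n, sq (fn n)) -> sq f -> H1 Omega z -> (forall n, wsol c (zn n) (fn n)) ->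
  (forall e : R, 0 < e -> exists N, forall n, (N <= n)%N -> Hn (zn n - z) <= e) ->
  (forall e : R, 0 < e -> exists N, forall n, (N <= n)%N -> N2 (fun x => fn n x - f x) <= e) ->
  wsol c z f.
Proof.
move=> sc sfn sf Hz znP znz fnf; split => // v Hv.
have [C C0 CP] := cform_bound sc.
apply/eqP; rewrite -subr_eq0 -normr_eq0 eq_le normr_ge0 andbT.
apply/ler_addgt0Pr => e e0; rewrite add0r.
pose K := (C + 1) * Hn v + 1.
have Hv0 := H1_norm_ge0 Omega v.
have K0 : 0 < K by rewrite ltr_wpDl// mulr_ge0// addr_ge0.
have [N1 N1P] := znz (e / K) (divr_gt0 e0 K0).
have [N2' N2P] := fnf (e / K) (divr_gt0 e0 K0).
pose n := maxn N1 N2'.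
have h1 := N1P n (leq_maxl _ _); have h2 := N2P n (leq_maxr _ _).
have [Hzn znE] := znP n.
have E1 : cform c (zn n - z) v = cform c (zn n) v - cform c z v.
  by rewrite -[zn n - z]addrC -scaleN1r cform_linl// mulN1r addrC.
have sd := sqintB mO (sfn n) sf.
have E2 : intO Omega (fun x => (fn n x - f x) * v x) =
    intO Omega (fun x => fn n x * v x) - intO Omega (fun x => f x * v x).
  rewrite /intO -(RintegralB mO (itg_source (sfn n) Hv) (itg_source sf Hv)).
  by apply: eq_Rintegral => x _; rewrite mulrBl.
have -> : cform c z v - intO Omega (fun x => f x * v x) =
    intO Omega (fun x => (fn n x - f x) * v x) - cform c (zn n - z) v.
  by rewrite E1 E2 (znE v Hv); move: (intO _ _) (intO _ _) (cform _ _ _) => r1 r2 r3; ring.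
apply: le_trans (ler_normB _ _) _.
apply: le_trans (lerD (source_bound sd Hv) (CP _ _ (H1B oO bO Hzn Hz) Hv)) _.
apply: (@le_trans _ _ (e / K * Hn v + C * (e / K) * Hn v)).
  by apply: lerD; rewrite ler_wpM2r// ler_wpM2l.
rewrite (_ : _ + _ = e * ((C + 1) * Hn v / K)); last by field; rewrite gt_eqF.
by rewrite ler_piMr ?(ltW e0)// ler_pdivrMr// mul1r /K lerDl.
Qed.

(* If g v were not integrable, the integral of g v and of g (v + psi) would both
   take the junk value 0 for every test function psi; hence the integral of
   g psi would vanish, and g = 0. *)
Lemma source_integrable c z g : sq c -> itg g -> wsol c z g ->
  forall v, H1 Omega v -> itg (fun x => g x * v x).
Proof.
move=> sc ig [Hz zP] v Hv; apply: contrapT => nig.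
have mg := integrable_measurable ig.
have mH w : H1 Omega w -> measurable_fun (Omega : set lebT) (fun x : lebT => g x * w x).
  by move=> Hw; apply: measurable_funM => //; case: (H1_sqint oO Hw).
have gpsi psi : test_fun Omega psi -> itg (fun x => g x * psi x).
  move=> tpsi; have [Cpsi [K [cK KO psiK]]] := tpsi.
  have [C fC] := compact_support_bounded (C1fun_continuous Cpsi) cK psiK.
  apply: (ae_le_integrable mO (mH _ (test_fun_H1 oO bO tpsi))
    (integrableZl_EFin mO C (integrable_norm ig))).
  by apply: aeW => x _; rewrite normrM mulrC ler_wpM2r.
have junk psi : test_fun Omega psi -> cform c z (1 *: psi + v) = 0.
  move=> tpsi; have Hpsi := test_fun_H1 oO bO tpsi.
  rewrite zP; last exact: H1_lin.
  apply: (Rintegral_non_integrable mO (mH _ (H1_lin oO bO 1 Hpsi Hv))) => ig'.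
  apply: nig; apply: eq_integrable (integrableB_EFin mO ig' (gpsi _ tpsi)) => // x _ /=.
  by rewrite scaleD_funE mul1r; congr (_%:E); ring.
have cv0 : cform c z v = 0.
  by rewrite zP//; exact: (Rintegral_non_integrable mO (mH v Hv) nig).
have g0 : aeO Omega (fun x => g x = 0).
  apply: du_bois_reymond => // psi tpsi; have Hpsi := test_fun_H1 oO bO tpsi.
  have := junk psi tpsi; rewrite cform_linr// mul1r cv0 addr0 zP//.
have le0 : aeO Omega (fun x => `|g x * v x| <= `|g x|).
  by apply: (aeO_mono _ g0) => x _ ->; rewrite mul0r normr0.
exact: nig (ae_le_integrable mO (mH _ Hv) (integrable_norm ig) le0).
Qed.

Section coercive.
Variables (Lambda lambda epsr : R) (c r : 'rV[R]_d -> R).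
Hypothesis hB : aeO Omega (fun x => forall xi : 'rV[R]_d,
    Lambda * enorm xi ^+ 2 <= \sum_i \sum_j B x i j * xi 0 i * xi 0 j).
Hypotheses (sc : sq c) (sr : sq r) (lL : lambda <= Lambda).
Hypothesis hc : aeO Omega (fun x => lambda <= c x - r x).
Hypothesis hr : N2 r <= epsr.
Hypothesis kappa0 : 0 < lambda - epsr * C4 ^+ 2.

(** [c] is split as [(c - r) + r]: the first part is bounded below by [lambda], the second, small in
    L2, costs at most [epsr * C4 ^+ 2] times the squared H1 norm. The condition [lambda <= Lambda]
    lets one constant serve the gradient and the zero order term. *)
Lemma cform_coercive w : H1 Omega w ->
  (lambda - epsr * C4 ^+ 2) * Hn w ^+ 2 <= cform c w w.
Proof.
move=> Hw; have h1 := aform_coercive oO bO bB hB Hw.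
have sw := H1_sqint oO Hw.
have i1 := itg_potential sc Hw Hw; have i2 := itg_potential sr Hw Hw.
have i3 : itg (fun x => w x ^+ 2) by case: sw.
have h2 : lambda * N2 w ^+ 2 <= intO Omega (fun x => c x * w x * w x) -
    intO Omega (fun x => r x * w x * w x).
  rewrite sqr_n2 -(RintegralZl lambda mO i3) /intO -(RintegralB mO i1 i2).
  apply: (ae_le_Rintegral mO (integrableZl_EFin mO lambda i3) (integrableB_EFin mO i1 i2)).
  apply: aeO_mono hc => x _ lx.
  rewrite (_ : _ - _ = (c x - r x) * w x ^+ 2); last by ring.
  by rewrite ler_wpM2r ?sqr_ge0.
have h3 := potential_bound sr Hw Hw.
have HE : Hn w ^+ 2 = N2 w ^+ 2 + \sum_i N2 (fun x => wgrad Omega w x 0 i) ^+ 2.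
  rewrite H1_normE// sqr_sqrtr// addr_ge0 ?sqr_ge0//; apply: sumr_ge0 => i _; exact: sqr_ge0.
have S0 : 0 <= \sum_i N2 (fun x => wgrad Omega w x 0 i) ^+ 2.
  by apply: sumr_ge0 => i _; exact: sqr_ge0.
have h4 : lambda * \sum_i N2 (fun x => wgrad Omega w x 0 i) ^+ 2 <=
    Lambda * \sum_i N2 (fun x => wgrad Omega w x 0 i) ^+ 2 by rewrite ler_wpM2r.
have h5 : N2 r * (C4 ^+ 2 * Hn w * Hn w) <= epsr * (C4 ^+ 2 * Hn w * Hn w).
  by rewrite ler_wpM2r// mulr_ge0 ?H1_norm_ge0// mulr_ge0 ?sqr_ge0 ?H1_norm_ge0.
have h6 := le_trans (lerNnormlW h3) (lexx _).
rewrite /cform.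
move: HE h1 h2 h4 h5 h6; move: (\sum_i _) (aform _ _ _ _) (intO _ _) (intO _ _) => S a p q.
move: (N2 w) (N2 r) (Hn w) => n nr H HE h1 h2 h4 h5 h6.
have -> : (lambda - epsr * C4 ^+ 2) * H ^+ 2 = lambda * H ^+ 2 - epsr * (C4 ^+ 2 * H * H).
  by ring.
rewrite HE mulrDr; move: h1 h2 h4 h5 h6.
move: (lambda * n ^+ 2) (lambda * S) (Lambda * S) (epsr * _) (nr * _) => *; lra.
Qed.

Lemma energy_estimate w f : sq f -> wsol c w f ->
  (lambda - epsr * C4 ^+ 2) * Hn w <= N2 f.
Proof.
move=> sf [Hw wP]; have [H0|H0] := eqVneq (Hn w) 0; first by rewrite H0 mulr0 n2_ge0.
have Hpos : 0 < Hn w by rewrite lt_neqAle eq_sym H0 H1_norm_ge0.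
rewrite -(ler_pM2r Hpos) -mulrA -expr2.
apply: le_trans (cform_coercive Hw) _; rewrite wP//.
by apply: le_trans (ler_norm _) _; exact: source_bound.
Qed.

End coercive.
End weak_solutions.

(** * A priori estimate in H1 and in the Hoelder space *)

Section regularity.
Variables (R : realType) (d : nat) (Omega : set 'rV[R]_d).
Hypotheses (hd : d = 2%N \/ d = 3%N) (oO : open Omega) (bO : bounded_set Omega).
Local Notation lebT := (caratheodory_type (leb_outer R d)).
Local Notation mu := (leb R d).
Local Notation sq := (@sqint _ lebT R mu (Omega : set lebT)).
Local Notation N2 := (@n2 _ lebT R mu (Omega : set lebT)).
Local Notation Hn := (H1_norm Omega).
Implicit Types (f g v w y z c : 'rV[R]_d -> R).
Variables (B : 'rV[R]_d -> 'M[R]_d) (C4 : R).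
Hypotheses (bB : bounded_coef Omega B) (C40 : 0 < C4) (hemb : L4_embedding Omega C4).
Variables (p q : \bar R) (al : R).
Hypotheses (p1 : (1 < p)%E) (q1 : (1 <= q)%E) (al0 : 0 < al).
Hypothesis hreg : holder_regularity Omega p q al B.
Local Notation hn := (holder_norm Omega al).
Let mO := measurable_Omega oO.
Let Ofin := leb_Omega_lty bO.
Local Opaque n2 H1_norm.

Lemma LpG_cst0 : LpG Omega q (fun=> 0) /\ LpG_norm Omega q (fun=> 0) = 0.
Proof.
have E : (fun=> 0 : R) \_ (boundary Omega) = cst 0.
  by apply/funext => x; rewrite patchE; case: ifP.
split.
  rewrite /LpG /= E inE; apply/andP; rewrite !inE/=; split; first exact: measurable_cst.
  exact: finite_norm_cst0.
rewrite /LpG_norm E (_ : EFin \o _ = cst 0%E)// Lnorm0//.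
by rewrite gt_eqF// (lt_le_trans _ q1).
Qed.

Lemma min_exponent : exists s : R, [/\ 1 <= s, s <= 2 & Order.min p 2%:E = s%:E].
Proof.
case: p p1 => [r| |]// r1; last first.
  by exists 2; rewrite ler1n lexx; split => //; apply/min_idPr; exact: leey.
rewrite lte_fin in r1; have [r2|r2] := leP r 2.
  exists r; split => //; first exact: ltW.
  by apply/min_idPl; rewrite lee_fin.
by exists 2; rewrite ler1n lexx; split => //; apply/min_idPr; rewrite lee_fin ltW.
Qed.

(** The L^{min(p,2)} norm is dominated by the L2 norm, the boundary datum is zero, and the Hoelder
    representative coincides with [w] on [closure Omega]; so the regularity hypothesis becomes an L2
    bound for [w] itself. *)
Lemma regularity_bound : exists2 K : R, 0 <= K & forall w f, H1 Omega w ->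
  holder Omega al w -> sq f ->
  (forall v, H1 Omega v -> aform Omega B w v + intO Omega (fun x => w x * v x) =
     intO Omega (fun x => f x * v x)) ->
  hn w <= K * N2 f.
Proof.
have [C CP] := hreg; have [s [s1 s2 sE]] := min_exponent.
exists (`|C| * (fine (mu Omega) + 1) `^ s^-1) => [|w f Hw hw sf wP].
  by rewrite mulr_ge0 ?powR_ge0.
have [Lf Lfn] := le_Lnorm_n2 mO Ofin s1 s2 sf.
have [G0 Gn0] := LpG_cst0.
have wn : weak_neumann Omega B w w f (fun=> 0) by apply/weak_neumannE.
have [|w' [ww' hw' w'n]] := CP f (fun=> 0) w _ G0 wn; first by rewrite sE.
have ww'E x : closure Omega x -> w' x = w x by apply: (holder_ae_eq hd oO al0).
rewrite (eq_holder_norm _ (fun x Ox => esym (ww'E x Ox))).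
apply: le_trans w'n _; rewrite Gn0 addr0 -mulrA.
have n0 : 0 <= Lp_norm Omega (Order.min p 2%:E) f by rewrite fine_ge0 ?Lnorm_ge0.
apply: (@le_trans _ _ (`|C| * Lp_norm Omega (Order.min p 2%:E) f)).
  by rewrite ler_wpM2r// ler_norm.
by rewrite ler_wpM2l// sE.
Qed.

Variables (Lambda lambda epsr : R) (c r : 'rV[R]_d -> R).
Hypothesis hB : aeO Omega (fun x => forall xi : 'rV[R]_d,
    Lambda * enorm xi ^+ 2 <= \sum_i \sum_j B x i j * xi 0 i * xi 0 j).
Hypotheses (sc : sq c) (sr : sq r) (lL : lambda <= Lambda).
Hypothesis hc : aeO Omega (fun x => lambda <= c x - r x).
Hypothesis hr : N2 r <= epsr.
Hypothesis kappa0 : 0 < lambda - epsr * C4 ^+ 2.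

Lemma sq_mul_holder f w : holder Omega al w -> measurable_fun (Omega : set lebT) (w : lebT -> R) ->
  sq f -> sq (fun x => w x * f x) /\ N2 (fun x => w x * f x) <= hn w * N2 f.
Proof.
move=> hw mw sf; apply: (sqint_bounded_mul mO Ofin _ mw _ sf); first exact: holder_norm_ge0.
apply: aeO_all => x Ox; apply: (sup_le_holder_norm al0 bO hw).
exact: subset_closure.
Qed.

(* The large values of c have small L2 norm, so that their contribution to the
   Hoelder bound of w is absorbed by the left-hand side. *)
Lemma apriori_estimate : exists2 K : R, 0 <= K & forall w f,
  holder Omega al w -> sq f -> wsol Omega B c w f -> Hn w + hn w <= K * N2 f.
Proof.
have [K0 K00 K0P] := regularity_bound.
(* Chosen so that [K0 * dl <= 1/2]; the added 1 covers [K0 = 0]. *)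
pose dl := (2 * (K0 + 1))^-1.
have dl0 : 0 < dl by rewrite invr_gt0 mulr_gt0// ltr_wpDl.
have [n [sct ctn]] := sqint_truncation mO sc dl0.
set ct := fun x => _ in sct ctn.
set kp := lambda - epsr * C4 ^+ 2; have kpos : 0 < kp := kappa0.
exists (kp^-1 + 2 * K0 * (1 + (1 + n%:R) * kp^-1)) => [|w f hw sf [Hw wP]].
  rewrite addr_ge0 ?invr_ge0 ?(ltW kpos)// mulr_ge0 ?mulr_ge0// addr_ge0// mulr_ge0 ?addr_ge0//.
  by rewrite invr_ge0 (ltW kpos).
have h1 := energy_estimate oO bO bB hemb hB sc sr lL hc hr sf (conj Hw wP).
rewrite -/kp in h1.
have h1' : Hn w <= kp^-1 * N2 f by rewrite mulrC ler_pdivlMr// mulrC.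
have sw := H1_sqint oO Hw; have [mw _] := sw.
have [scw _] := sq_mul_holder hw mw sc.
have [sctw ctwn] := sq_mul_holder hw mw sct.
have [mc _] := sc; have [mct _] := sct.
have [srw rwn] : sq (fun x => (c x - ct x) * w x) /\ N2 (fun x => (c x - ct x) * w x) <= n%:R * N2 w.
  have mcc : measurable_fun (Omega : set lebT) (fun x : lebT => c x - ct x).
    exact: measurable_funB.
  apply: (sqint_bounded_mul mO Ofin (ler0n R n) mcc _ sw).
  apply: aeO_all => x _; rewrite /ct; case: ifPn => [|_]; first by rewrite subr0.
  by rewrite subrr normr0.
(* Adding [w] and moving [c w] to the right gives an equation with zero order coefficient 1, the
   form covered by [regularity_bound]. *)
pose F x := f x + (w x - w x * c x).
have sF : sq F by exact: (sqintD mO sf (sqintB mO sw scw)).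
have FE v : H1 Omega v -> aform Omega B w v + intO Omega (fun x => w x * v x) =
    intO Omega (fun x => F x * v x).
  move=> Hv; have := wP v Hv; rewrite /cform => E.
  have i1 := itg_source oO sf Hv; have i2 := itg_source oO sw Hv.
  have i3 := itg_potential oO hemb sc Hw Hv.
  have -> : intO Omega (fun x => F x * v x) = intO Omega (fun x => f x * v x) +
      (intO Omega (fun x => w x * v x) - intO Omega (fun x => c x * w x * v x)).
    rewrite /intO -(RintegralB mO i2 i3) -(RintegralD mO i1 (integrableB_EFin mO i2 i3)).
    by apply: eq_Rintegral => x _; rewrite /F; ring.
  by rewrite -E; ring.
have h2 := K0P w F Hw hw sF FE.
have h3 : N2 F <= N2 f + (N2 w + (n%:R * N2 w + hn w * dl)).
  apply: le_trans (n2D mO sf (sqintB mO sw scw)) _; rewrite lerD2l.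
  apply: le_trans (n2B mO sw scw) _; rewrite lerD2l.
  rewrite (_ : N2 (fun x => w x * c x) = N2 (fun x => (c x - ct x) * w x + w x * ct x)); last first.
    by apply: eq_n2 => x _; ring.
  apply: le_trans (n2D mO srw sctw) _; apply: lerD => //.
  by apply: le_trans ctwn _; rewrite ler_wpM2l// holder_norm_ge0.
have h4 := N2_le_H1_norm oO Hw.
have hn0 := holder_norm_ge0 Omega al w.
have f0 : 0 <= N2 f by exact: n2_ge0.
have K0dl : K0 * dl <= 2^-1.
  by rewrite /dl invfM mulrCA ler_piMr ?invr_ge0// ler_pdivrMr ?mul1r ?lerDl// ltr_wpDl.
move: h1' h2 h3 h4 hn0 f0 K0dl.
have n0 : 0 <= n%:R :> R by [].
have kp0 : 0 <= kp^-1 by rewrite invr_ge0 ltW.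
move: (N2 F) (N2 w) (N2 f) (Hn w) (hn w) => a b f0 H h h1' h2 h3 h4 hn0 f00 K0dl.
have k1 : b <= kp^-1 * f0 by exact: le_trans h4 h1'.
have k2 : K0 * a <= K0 * (f0 + (b + (n%:R * b + h * dl))) by rewrite ler_wpM2l.
have k3 : K0 * ((1 + n%:R) * b) <= K0 * ((1 + n%:R) * (kp^-1 * f0)).
  by rewrite ler_wpM2l// ler_wpM2l// addr_ge0.
have k4 : h * (K0 * dl) <= h * 2^-1 by rewrite ler_wpM2l.
have k5 : h <= 2 * (K0 * f0 + K0 * ((1 + n%:R) * (kp^-1 * f0))).
  have : h <= K0 * f0 + K0 * ((1 + n%:R) * b) + h * (K0 * dl).
    by apply: le_trans h2 (le_trans k2 _); rewrite le_eqVlt; apply/orP; left; apply/eqP; ring.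
  by move: k3 k4; lra.
apply: le_trans (lerD h1' k5) _.
by rewrite le_eqVlt; apply/orP; left; apply/eqP; ring.
Qed.

End regularity.

(** * Derivatives of Caratheodory integrands along functions *)

Section superposition.
Variables (R : realType) (d : nat) (Omega : set 'rV[R]_d) (P : 'rV[R]_d -> R -> R).
Hypotheses (oO : open Omega) (cP : caratheodory_C2 Omega P).
Local Notation lebT := (caratheodory_type (leb_outer R d)).
Let mO := measurable_Omega oO.
Let cmu := @measure_is_complete_leb R d.

Lemma derive_comp_measurable y : measurable_fun (Omega : set lebT) (y : lebT -> R) ->
  measurable_fun (Omega : set lebT) (fun x : lebT => derive1 (P x) (y x)) /\
  measurable_fun (Omega : set lebT) (fun x : lebT => derive1n 2 (P x) (y x)).
Proof.
move=> my; have [mP conP C2P] := cP.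
have m1 z : measurable_fun (Omega : set lebT) (z : lebT -> R) ->
    measurable_fun (Omega : set lebT) (fun x : lebT => P x (z x)).
  exact: (caratheodory_comp_measurable mO cmu mP conP).
have m2 z : measurable_fun (Omega : set lebT) (z : lebT -> R) ->
    measurable_fun (Omega : set lebT) (fun x : lebT => derive1 (P x) (z x)).
  move=> mz; refine (derive1_comp_measurable cmu m1 _ mz).
  by apply: (aeO_mono _ C2P) => x _ [dP _ _]; exact: dP.
split; first exact: m2.
refine (derive1_comp_measurable cmu m2 _ my).
by apply: (aeO_mono _ C2P) => x _ [_ dP _]; exact: dP.
Qed.

Lemma derive_lipschitz (M C : R) :
  aeO Omega (fun x => forall y, `|y| <= M -> `|derive1n 2 (P x) y| <= C) ->
  aeO Omega (fun x => forall s t, `|s| <= M -> `|t| <= M ->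
    `|derive1 (P x) t - derive1 (P x) s| <= C * `|t - s|).
Proof.
move=> bP; have [_ _ C2P] := cP.
apply: (aeO_mono _ (aeO_and C2P bP)) => x _ [[_ dP _] bx] s t sM tM.
have [xi [_ xiM ->]] := MVT_derive1 s t dP.
by rewrite normrM ler_wpM2r//; apply: bx; rewrite (le_trans xiM)// ge_max sM tM.
Qed.

(** By the mean value theorem for [derive1 (P x)]: the intermediate point is within [rho] of [s],
    where the second derivative differs from its value at [s] by at most [e]. *)
Lemma derive_taylor (M e : R) : second_deriv_unif Omega P -> 0 < M -> 0 < e ->
  exists2 rho : R, 0 < rho & aeO Omega (fun x => forall s t, `|s| <= M -> `|t| <= M ->
    `|t - s| <= rho -> `|derive1 (P x) t - derive1 (P x) s - derive1n 2 (P x) s * (t - s)|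
      <= e * `|t - s|).
Proof.
move=> uP M0 e0; have [_ _ C2P] := cP.
have [rho rho0 rhoP] := uP e M e0 M0; exists rho => //.
apply: (aeO_mono _ (aeO_and C2P rhoP)) => x _ [[_ dP _] ux] s t sM tM st.
have [xi [xis xiM ->]] := MVT_derive1 s t dP.
rewrite -mulrBl normrM ler_wpM2r//; apply: (ux xi s _ sM (le_trans xis st)).
by rewrite (le_trans xiM)// ge_max sM tM.
Qed.

End superposition.

Lemma lerD_lin (R : numDomainType) (k a a' b b' r s : R) :
  r <= k * a + a' -> s <= k * b + b' -> r + s <= k * (a + b) + (a' + b').
Proof. by move=> ra sb; rewrite mulrDr addrACA; exact: lerD. Qed.

(** * Comparison of solutions, and small perturbations in L2 *)

Section perturbations.
Variables (R : realType) (d : nat) (Omega : set 'rV[R]_d).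
Hypotheses (oO : open Omega) (bO : bounded_set Omega).
Local Notation lebT := (caratheodory_type (leb_outer R d)).
Local Notation mu := (leb R d).
Local Notation sq := (@sqint _ lebT R mu (Omega : set lebT)).
Local Notation N2 := (@n2 _ lebT R mu (Omega : set lebT)).
Local Notation itg f := (mu.-integrable (Omega : set lebT) (EFin \o (f : lebT -> R))).
Implicit Types (f g v w y z c h : 'rV[R]_d -> R).
Variables (B : 'rV[R]_d -> 'M[R]_d) (C4 al : R).
Hypotheses (bB : bounded_coef Omega B) (hemb : L4_embedding Omega C4) (al0 : 0 < al).
Local Notation X := (H1 Omega `&` holder Omega al).
Local Notation nX w := (H1_norm Omega w + holder_norm Omega al w).
Let mO := measurable_Omega oO.
Let Ofin := leb_Omega_lty bO.
Local Opaque n2 H1_norm holder_norm.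

(** Integrability against all of H1 replaces membership of the sources in L2, so that the lemma also
    covers the adjoint equations themselves. *)
Lemma wsol_sub c z z' f f' : sq c ->
  (forall v, H1 Omega v -> itg (fun x => f x * v x)) ->
  (forall v, H1 Omega v -> itg (fun x => f' x * v x)) ->
  wsol Omega B c z f -> wsol Omega B c z' f' ->
  wsol Omega B c (z - z') (fun x => f x - f' x).
Proof.
move=> sc fi fi' [Hz zP] [Hz' zP']; split; first exact: H1B.
move=> v Hv; have -> : z - z' = -1 *: z' + z by rewrite scaleN1r addrC.
rewrite (cform_linl oO bO bB hemb _ sc Hz' Hz Hv) (zP v Hv) (zP' v Hv) mulN1r addrC.
rewrite /intO -(RintegralB mO (fi v Hv) (fi' v Hv)).
by apply: eq_Rintegral => x _; rewrite mulrBl.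
Qed.

Lemma mul_holder f w : X w -> sq f ->
  sq (fun x => f x * w x) /\ N2 (fun x => f x * w x) <= nX w * N2 f.
Proof.
move=> [Hw hw] sf; have [mw _] := H1_sqint oO Hw.
have [s n] := sq_mul_holder oO bO al0 hw mw sf.
have E : forall x : lebT, (Omega : set lebT) x -> w x * f x = f x * w x by move=> x _; rewrite mulrC.
split; first exact: (eq_sqint mO E s).
rewrite -(eq_n2 _ E); apply: le_trans n _.
by rewrite ler_wpM2r ?n2_ge0// lerDr H1_norm_ge0.
Qed.

(** A change of coefficient becomes a source, in L2 because [c' - c] is in L2 and [z] is bounded.
    All comparisons between different controls use this. *)
Lemma wsol_shift c c' z f : sq c -> sq c' -> X z ->
  (forall v, H1 Omega v -> itg (fun x => f x * v x)) ->
  wsol Omega B c' z f -> wsol Omega B c z (fun x => f x - (c' x - c x) * z x).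
Proof.
move=> sc sc' Xz fi [Hz zP]; split => // v Hv.
have sd := sqintB mO sc' sc; have [sdz _] := mul_holder Xz sd.
have i1 := itg_potential oO hemb sc Hz Hv; have i2 := itg_potential oO hemb sc' Hz Hv.
have -> : intO Omega (fun x => (f x - (c' x - c x) * z x) * v x) =
    intO Omega (fun x => f x * v x) - intO Omega (fun x => (c' x - c x) * z x * v x).
  rewrite /intO -(RintegralB mO (fi v Hv) (itg_source oO sdz Hv)).
  by apply: eq_Rintegral => x _; rewrite mulrBl.
have -> : intO Omega (fun x => (c' x - c x) * z x * v x) =
    intO Omega (fun x => c' x * z x * v x) - intO Omega (fun x => c x * z x * v x).
  by rewrite /intO -(RintegralB mO i2 i1); apply: eq_Rintegral => x _; ring.
rewrite -(zP v Hv) /cform; move: (aform _ _ _ _) (intO _ _) (intO _ _) => r1 r2 r3.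
by ring.
Qed.

Lemma sq_ae_bounded f (C : R) : 0 <= C -> measurable_fun (Omega : set lebT) (f : lebT -> R) ->
  aeO Omega (fun x => `|f x| <= C) -> sq f /\ N2 f <= C * N2 (fun=> 1).
Proof.
move=> C0 mf fC; have [s n] := ae_le_sqint mO mf (sqint_cst mO Ofin C) fC.
by split => //; rewrite -(n2_cst mO Ofin C0).
Qed.

Lemma norm_le_holder w x : holder Omega al w -> Omega x -> `|w x| <= nX w.
Proof.
move=> hw Ox; apply: le_trans (sup_le_holder_norm al0 bO hw (subset_closure Ox)) _.
by rewrite lerDr H1_norm_ge0.
Qed.

Lemma X_norm_ge0 w : 0 <= nX w.
Proof. by rewrite addr_ge0 ?H1_norm_ge0 ?holder_norm_ge0. Qed.

Lemma X_lin (k : R) w w' : X w -> X w' -> X (k *: w + w') /\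
  nX (k *: w + w') <= `|k| * nX w + nX w'.
Proof.
move=> [Hw hw] [Hw' hw']; split; first by split; [exact: H1_lin|exact: holder_lin].
have h1 := H1_norm_lin oO bO k Hw Hw'; have h2 := holder_norm_lin al0 bO k hw hw'.
by apply: lerD_lin h1 h2.
Qed.

Lemma X_D w w' : X w -> X w' -> X (w + w') /\ nX (w + w') <= nX w + nX w'.
Proof. by move=> Xw Xw'; have := X_lin 1 Xw Xw'; rewrite scale1r normr1 mul1r. Qed.

Lemma X_B w w' : X w -> X w' -> X (w - w') /\ nX (w - w') <= nX w + nX w'.
Proof.
move=> Xw Xw'; have := X_lin (-1) Xw' Xw.
by rewrite scaleN1r normrN normr1 mul1r (addrC (- w')) (addrC (nX w')).
Qed.

(** Eventual truth as [h] tends to 0 in L2; smallness conditions are then combined with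
    [small_ev_and] without explicit radii. *)
Definition small_ev (Q : ('rV[R]_d -> R) -> Prop) : Prop :=
  exists2 delta : R, 0 < delta & forall h, sq h -> N2 h < delta -> Q h.

Lemma small_ev_and (Q Q' : ('rV[R]_d -> R) -> Prop) : small_ev Q -> small_ev Q' ->
  small_ev (fun h => Q h /\ Q' h).
Proof.
move=> [e e0 eP] [e' e'0 e'P]; exists (Order.min e e') => [|h sh]; first by rewrite lt_min e0.
by rewrite lt_min => /andP[he he']; split; [exact: eP|exact: e'P].
Qed.

Lemma small_ev_mono (Q Q' : ('rV[R]_d -> R) -> Prop) : (forall h, sq h -> Q h -> Q' h) ->
  small_ev Q -> small_ev Q'.
Proof. by move=> QQ' [e e0 eP]; exists e => // h sh he; apply: QQ' => //; exact: eP. Qed.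

Lemma small_ev_le (K e : R) : 0 <= K -> 0 < e -> small_ev (fun h => K * N2 h <= e).
Proof.
move=> K0 e0; have K1 : 0 < K + 1 by rewrite ltr_wpDl.
exists (e / (K + 1)) => [|h _]; first by rewrite divr_gt0.
rewrite ltr_pdivlMr// => he; apply: le_trans (ltW he).
by rewrite mulrC ler_wpM2l ?n2_ge0// lerDl.
Qed.

End perturbations.

(** * Solutions obtained as limits *)

Section solvability.
Variables (R : realType) (d : nat) (Omega : set 'rV[R]_d).
Hypotheses (oO : open Omega) (bO : bounded_set Omega).
Local Notation lebT := (caratheodory_type (leb_outer R d)).
Local Notation mu := (leb R d).
Local Notation sq := (@sqint _ lebT R mu (Omega : set lebT)).
Local Notation N2 := (@n2 _ lebT R mu (Omega : set lebT)).
Implicit Types (f g v w y z c h : 'rV[R]_d -> R).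
Variables (B : 'rV[R]_d -> 'M[R]_d) (C4 al : R).
Hypotheses (bB : bounded_coef Omega B) (hemb : L4_embedding Omega C4) (al0 : 0 < al).
Local Notation X := (H1 Omega `&` holder Omega al).
Local Notation nX w := (H1_norm Omega w + holder_norm Omega al w).
Let mO := measurable_Omega oO.
Let Ofin := leb_Omega_lty bO.
Local Opaque n2 H1_norm holder_norm.

Lemma holder_limit_sqint (F : nat -> 'rV[R]_d -> R) w : (forall n, H1 Omega (F n)) ->
  (forall n, holder Omega al (F n)) -> holder Omega al w ->
  (forall e : R, 0 < e -> exists N, forall n, (N <= n)%N -> holder_norm Omega al (F n - w) <= e) ->
  sq w.
Proof.
move=> HF hF hw Fw.
have hB n : holder Omega al (F n - w).
  by have := holder_lin (-1) hw (hF n); rewrite scaleN1r addrC.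
have mw : measurable_fun (Omega : set lebT) (w : lebT -> R).
  refine (ae_cvg_measurable_fun (@measure_is_complete_leb R d)
    (fun n => proj1 (H1_sqint oO (HF n))) _).
  have : aeO Omega (fun x => F n x @[n --> \oo] --> w x); last by [].
  apply: aeO_all => x Ox; apply/cvgrPdist_le => e e0.
  have [N NP] := Fw e e0; exists N => // n /= Nn; rewrite distrC.
  exact: le_trans (sup_le_holder_norm al0 bO (hB n) (subset_closure Ox)) (NP n Nn).
apply: (proj1 (sq_ae_bounded oO bO (holder_norm_ge0 Omega al w) mw _)).
by apply: aeO_all => x Ox; exact: (sup_le_holder_norm al0 bO hw (subset_closure Ox)).
Qed.

(** Hoelder convergence is uniform, hence holds in L2 on the bounded set [Omega], which identifies
    the Hoelder limit with the H1 limit. H1 convergence is what the passage to the limit in the weak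
    equation consumes. *)
Lemma X_complete (F : nat -> 'rV[R]_d -> R) : (forall n, X (F n)) ->
  (forall e : R, 0 < e -> exists N, forall m n, (N <= m)%N -> (N <= n)%N ->
     nX (F m - F n) <= e) ->
  exists2 w, X w & forall e : R, 0 < e -> exists N, forall n, (N <= n)%N ->
     H1_norm Omega (F n - w) <= e.
Proof.
move=> XF cF; have HF n := proj1 (XF n); have hF n := proj2 (XF n).
have [|w hw Fw] := holder_complete al0 bO hF.
  move=> e e0; have [N NP] := cF e e0; exists N => m n Nm Nn.
  by apply: le_trans (NP m n Nm Nn); rewrite lerDr H1_norm_ge0.
have sw := holder_limit_sqint HF hF hw Fw.
have [||Hw Hcv] := H1_closed oO bO HF sw; last by exists w.
- move=> e e0; have [N NP] := cF e e0; exists N => m n Nm Nn.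
  by apply: le_trans (NP m n Nm Nn); rewrite lerDl holder_norm_ge0.
- move=> e e0; have N10 : 0 < N2 (fun=> 1) + 1 by rewrite ltr_wpDl// n2_ge0.
  have [N NP] := Fw (e / (N2 (fun=> 1) + 1)) (divr_gt0 e0 N10); exists N => n Nn.
  have hB : holder Omega al (F n - w).
    by have := holder_lin (-1) hw (hF n); rewrite scaleN1r addrC.
  have [mF _] := H1_sqint oO (HF n); have [mw _] := sw.
  have [_ le1] := sq_ae_bounded oO bO (holder_norm_ge0 Omega al (F n - w)) (measurable_funB mF mw)
    (aeO_all (fun x Ox => sup_le_holder_norm al0 bO hB (subset_closure Ox))).
  apply: le_trans le1 _; apply: (@le_trans _ _ (e / (N2 (fun=> 1) + 1) * N2 (fun=> 1))).
    by rewrite ler_wpM2r ?n2_ge0// NP.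
  move: (N2 _) N10 => N1 N10.
  by rewrite mulrAC ler_pdivrMr// ler_wpM2l ?(ltW e0)// lerDl.
Qed.

(** By linearity the a priori estimate applies to differences and turns L2 convergence of the
    sources into a Cauchy property of the solutions. *)
Lemma wsol_limit c (K : R) (zn fn : nat -> 'rV[R]_d -> R) f : sq c -> 0 <= K ->
  (forall w g, holder Omega al w -> sq g -> wsol Omega B c w g -> nX w <= K * N2 g) ->
  (forall n, X (zn n)) -> (forall n, sq (fn n)) -> sq f ->
  (forall n, wsol Omega B c (zn n) (fn n)) ->
  (forall e : R, 0 < e -> exists N, forall n, (N <= n)%N -> N2 (fun x => fn n x - f x) <= e) ->
  exists2 z, X z & wsol Omega B c z f.
Proof.
move=> sc K0 KP Xz sfn sf znP fnf.
have [|z Xz' zcv] := X_complete Xz; last first.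
  exists z => //; exact: (wsol_closed oO bO bB hemb sc sfn sf (proj1 Xz') znP zcv fnf).
move=> e e0; have K1 : 0 < 2 * (K + 1) by rewrite mulr_gt0// ltr_wpDl.
have [N NP] := fnf (e / (2 * (K + 1))) (divr_gt0 e0 K1); exists N => m n Nm Nn.
have Xd := proj1 (X_B oO bO al0 (Xz m) (Xz n)).
have W := wsol_sub oO bO bB hemb sc (fun v Hv => itg_source oO (sfn m) Hv)
  (fun v Hv => itg_source oO (sfn n) Hv) (znP m) (znP n).
apply: le_trans (KP _ _ (proj2 Xd) (sqintB mO (sfn m) (sfn n)) W) _.
have sm := sqintB mO (sfn m) sf; have sn := sqintB mO (sfn n) sf.
have E : N2 (fun x => fn m x - fn n x) = N2 (fun x => (fn m x - f x) - (fn n x - f x)).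
  by apply: eq_n2 => x _; ring.
have le1 := n2B mO sm sn; rewrite -E in le1.
have := le_trans le1 (lerD (NP m Nm) (NP n Nn)).
move: (N2 _) => r rle; apply: le_trans (ler_wpM2l K0 rle) _.
have q0 : 0 <= e / (2 * (K + 1)) by rewrite ltW// divr_gt0.
apply: (@le_trans _ _ ((K + 1) * (e / (2 * (K + 1)) + e / (2 * (K + 1))))).
  by rewrite ler_wpM2r ?addr_ge0// lerDl.
rewrite (_ : _ * _ = e)//; field; move: K1; rewrite pmulr_rgt0// => K1; by rewrite gt_eqF.
Qed.

End solvability.

(** * The adjoint state map *)

(** This and the following scalar lemmas carry the arithmetic of the estimates below, with function
    values and norms abstracted to variables. *)
Lemma rhs_identity (R : comPzRingType) (w' w g' g v p' p : R) :
  w' * g' - v * p' - (w * g - v * p) = w * (g' - g) + ((w' - w) * g' - v * (p' - p)).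
Proof. ring. Qed.

(** With [e1 = e / (C + Cg + 2)], the three terms cost at most [C e1], [(Cg + 1) e1] and [e1]. *)
Lemma rhs_le (R : realFieldType) (e C Cg n d g' w s1 s2 s3 : R) : 0 <= C -> 0 <= Cg ->
  0 < C + Cg + 2 -> 0 < e -> 0 <= n -> n <= 1 -> s1 <= C * d ->
  s2 <= e / (C + Cg + 2) * g' -> s3 <= w * n -> d <= e / (C + Cg + 2) ->
  g' <= Cg * n + 1 -> w <= e / (C + Cg + 2) -> s1 + (s2 + s3) <= e.
Proof.
move=> C0 Cg0 q0 e0 n0 n1; set e1 := e / _ => h1 h2 h3 h4 h5 h6.
have e10 : 0 <= e1 by rewrite ltW// divr_gt0.
have k1 : C * d <= C * e1 by rewrite ler_wpM2l.
have k2 : Cg * n <= Cg by rewrite ler_piMr.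
have k3 : e1 * g' <= e1 * (Cg + 1) by rewrite ler_wpM2l//; lra.
have k4 : w * n <= e1.
  by apply: le_trans (ler_wpM2r n0 h6) _; rewrite ler_piMr.
have -> : e = e1 * (C + Cg + 2) by rewrite /e1 divfK// gt_eqF.
by move: k1 k3 k4; lra.
Qed.

(** [d] reappears on the right through [z' <= z + d], with a factor [K Kc n <= 1/2] that lets it be
    absorbed. The final 1 in the denominator keeps it positive when [K = 0]. *)
Lemma continuity_le (R : realFieldType) (e K E Kc n d z' z F s m c : R) : 0 <= K -> 0 <= E ->
  0 < 2 * (K * (1 + E)) + 1 -> 0 < e -> 0 <= d -> 0 <= z' -> 0 <= Kc * n ->
  d <= K * F -> z' <= z + d ->
  F <= s + m -> m <= z' * c -> z <= E -> c <= Kc * n ->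
  s <= e / (2 * (K * (1 + E)) + 1) -> Kc * n <= e / (2 * (K * (1 + E)) + 1) ->
  K * Kc * n <= 2^-1 -> d <= e.
Proof.
move=> K0 E0 q0 e0 d0 z'0 c0; set e1 := e / _ => h1 h2 h3 h4 h5 h6 h7 h8 h9.
have e10 : 0 <= e1 by rewrite ltW// divr_gt0.
have k1 : z' * c <= z' * (Kc * n) by rewrite ler_wpM2l.
have k2 : z' * (Kc * n) <= (E + d) * (Kc * n) by rewrite ler_wpM2r//; lra.
have k3 : E * (Kc * n) <= E * e1 by rewrite ler_wpM2l.
have k4 : K * F <= K * (e1 + E * e1 + d * (Kc * n)).
  by rewrite ler_wpM2l//; move: k1 k2 k3; lra.
have k5 : d * (K * Kc * n) <= d * 2^-1 by rewrite ler_wpM2l.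
have -> : e = e1 * (2 * (K * (1 + E)) + 1) by rewrite /e1 divfK// gt_eqF.
by move: h1 k4 k5; lra.
Qed.

(** The shares of [e] are 1 for the change of [l], [P + 1] for that of [a2], since [|p'| <= P + 1],
    and [C] for that of [p]. *)
Lemma weight_le (R : realFieldType) (e P C l' l a2' a2 p' p : R) : 0 < P + 2 + C ->
  `|a2| <= C -> `|a2' - a2| <= e / (P + 2 + C) -> `|l' - l| <= e / (P + 2 + C) ->
  `|p| <= P -> `|p' - p| <= e / (P + 2 + C) -> `|p' - p| <= 1 ->
  `|l' - p' * a2' - (l - p * a2)| <= e.
Proof.
move=> q0; set e1 := e / _ => aC ha hl hp hd h1.
have p'P : `|p'| <= P + 1.
  by rewrite -[p'](subrK p) addrC; apply: le_trans (ler_normD _ _) _; exact: lerD.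
rewrite (_ : _ - _ = (l' - l) - (p' * (a2' - a2) + (p' - p) * a2)); last by ring.
apply: le_trans (ler_normB _ _) _.
apply: le_trans (lerD hl (le_trans (ler_normD _ _) (lexx _))) _.
rewrite !normrM.
have k1 : `|p'| * `|a2' - a2| <= (P + 1) * e1 by exact: ler_pM.
have k2 : `|p' - p| * `|a2| <= e1 * C by exact: ler_pM.
have -> : e = e1 * (P + 2 + C) by rewrite /e1 divfK// gt_eqF.
by move: k1 k2; lra.
Qed.

Lemma quotient_le (R : realFieldType) (n t e w : R) : n * t = 1 -> 0 <= w -> 0 < e ->
  n * (e / (w + 1) * (t * w)) <= e.
Proof.
move=> nt w0 e0; have w1 : 0 < w + 1 by rewrite ltr_wpDl.
rewrite [e / _ * _]mulrCA !mulrA nt mul1r mulrAC ler_pdivrMr//.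
by rewrite ler_wpM2l ?(ltW e0)// lerDl.
Qed.

Lemma quotient_identity (R : comPzRingType) (n t f s s' s0 : R) : n * t = 1 ->
  n * f - s' = n * ((f - s) + ((s - (t * s' + s0)) + s0)).
Proof.
move=> nt; rewrite (_ : f - s + _ = f - t * s'); last by ring.
by rewrite mulrBr mulrA nt mul1r.
Qed.

Lemma increment_identity (R : comPzRingType) (l' l l2 a' a a2 p' p y' y g u h : R) :
  l' - l - (a' + (u + h) - (a + u)) * p' - ((l2 - p * a2) * g - h * p) =
  l' - l - l2 * (y' - y) - p * (a' - a - a2 * (y' - y)) +
    ((l2 - p * a2) * (y' - y - g) - (a' + (u + h) - (a + u)) * (p' - p)).
Proof. ring. Qed.

(** Half of [e] covers the Taylor and state remainders, the other half the term quadratic in [n]. *)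
Lemma remainder_le (R : realFieldType) (e r N C K Kc n : R) : 0 < e -> 0 <= r * N + C ->
  0 <= n -> K * Kc * n <= e / 2 ->
  r * (e / (2 * (r * N + C + 1)) * n) * N +
    (C * (e / (2 * (r * N + C + 1)) * n) + K * n * (Kc * n)) <= e * n.
Proof.
move=> e0 p0 n0 hs; set q := e / _.
have hq : (r * N + C) * q <= e / 2.
  have p1 : 0 < r * N + C + 1 by rewrite ltr_wpDl.
  rewrite /q mulrA ler_pdivrMr ?mulr_gt0//.
  rewrite (_ : e / 2 * _ = (r * N + C + 1) * e); last by field.
  by rewrite ler_wpM2r ?(ltW e0)// lerDl.
rewrite (_ : _ + _ = ((r * N + C) * q + K * Kc * n) * n); last by ring.
by apply: ler_wpM2r => //; lra.
Qed.

(** [W] enters its own bound through [P' <= P + W]; as [K Kc n <= 1/2] it is absorbed, which doubles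
    the constant. *)
Lemma absorb_le (R : realFieldType) (K Kc KL W P' P n c F l m : R) : 0 <= K -> 0 <= Kc ->
  0 <= W -> 0 <= n -> 0 <= P' -> W <= K * F -> F <= l + m -> P' <= P + W ->
  m <= P' * c -> c <= Kc * n -> l <= KL * n -> K * Kc * n <= 2^-1 ->
  W <= 2 * (K * (KL + P * Kc)) * n.
Proof.
move=> K0 Kc0 W0 n0 P'0 h1 h2 h3 h4 h5 h6 h7.
have k1 : P' * c <= P' * (Kc * n) by rewrite ler_wpM2l.
have k2 : P' * (Kc * n) <= (P + W) * (Kc * n) by rewrite ler_wpM2r ?mulr_ge0.
have k3 : K * F <= K * (KL * n + (P + W) * (Kc * n)) by rewrite ler_wpM2l//; lra.
have k4 : W * (K * Kc * n) <= W * 2^-1 by rewrite ler_wpM2l.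
have k5 : K * (KL * n + (P + W) * (Kc * n)) =
    K * (KL + P * Kc) * n + W * (K * Kc * n) by ring.
rewrite -mulrA; move: k3 k4 k5; rewrite -mulrA; move: (K * ((KL + P * Kc) * n)) => Q; lra.
Qed.

(** * Differentiability of the adjoint state map, with an abstract a priori estimate *)

Section sensitivity.
Variables (R : realType) (d : nat) (Omega : set 'rV[R]_d).
Hypotheses (oO : open Omega) (bO : bounded_set Omega).
Local Notation lebT := (caratheodory_type (leb_outer R d)).
Local Notation mu := (leb R d).
Local Notation sq := (@sqint _ lebT R mu (Omega : set lebT)).
Local Notation N2 := (@n2 _ lebT R mu (Omega : set lebT)).
Local Notation itg f := (mu.-integrable (Omega : set lebT) (EFin \o (f : lebT -> R))).
Implicit Types (f g v w y z c h u : 'rV[R]_d -> R).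
Variables (B : 'rV[R]_d -> 'M[R]_d) (C4 al : R).
Hypotheses (bB : bounded_coef Omega B) (hemb : L4_embedding Omega C4) (al0 : 0 < al).
Local Notation X := (H1 Omega `&` holder Omega al).
Local Notation nX w := (H1_norm Omega w + holder_norm Omega al w).
Local Notation SX := (H1_holder_space Omega al).
Let mO := measurable_Omega oO.
Let Ofin := leb_Omega_lty bO.
Local Notation N1 := (N2 (fun=> 1)).
Local Notation ev := (small_ev Omega).
Local Opaque n2 H1_norm holder_norm.

Variables (D : set (L2_space Omega)) (G : L2_space Omega -> SX)
  (DG : L2_space Omega -> Lop (L2_space Omega) SX).
Hypotheses (Dsq : forall u, D u -> sq u) (Dopen : forall u, D u -> ev (fun h => D (u + h)))
  (hG : C1_on D G DG).

Lemma X_norm_lin (T : L2_space Omega -> SX) (k : R) v w : bounded_op T -> sq v -> sq w ->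
  nX (T (k *: v + w) - (k *: T v + T w)) = 0.
Proof. by move=> [_ lT _] sv sw; exact: (lT k v w ((Lp2P oO v).2 sv) ((Lp2P oO w).2 sw)). Qed.

Lemma bounded_op_bound (T : L2_space Omega -> SX) : bounded_op T ->
  exists2 C : R, 0 <= C & forall v, sq v -> X (T v) /\ nX (T v) <= C * N2 v.
Proof.
move=> [mT _ [C CP]]; exists `|C| => // v sv; have Lv := (Lp2P oO v).2 sv.
split; first exact: (mT v Lv).
have : nX (T v) <= C * Lp_norm Omega 2%:E v by exact: (CP v Lv).
rewrite (Lp_norm2E oO sv) => le1; apply: le_trans le1 _.
by rewrite ler_wpM2r ?n2_ge0// ler_norm.
Qed.

Lemma state_X u : D u -> X (G u).
Proof. by move=> Du; case: hG => mG _ _ _; exact: (mG u Du). Qed.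

Lemma DG_bounded u : D u -> bounded_op (DG u).
Proof. by move=> Du; case: hG => _ mDG _ _; exact: (mDG u Du). Qed.

Lemma DG_remainder u (e : R) : D u -> 0 < e ->
  ev (fun h => D (u + h) /\ nX (G (u + h) - G u - DG u h) <= e * N2 h).
Proof.
move=> Du e0; case: hG => _ _ fG _.
have [dl dl0 dlP] := fG u Du e e0.
have hdl : ev (fun h => N2 h < dl) by exists dl.
apply: (small_ev_mono _ (small_ev_and (Dopen Du) hdl)) => h sh [Dh hlt]; split => //.
have Lh := (Lp2P oO h).2 sh.
have : Lp_norm Omega 2%:E h < dl -> nX (G (u + h) - G u - DG u h) <= e * Lp_norm Omega 2%:E h.
  by move=> lth; exact: (dlP h Lh lth Dh).
by rewrite (Lp_norm2E oO sh); apply.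
Qed.

Lemma state_lipschitz u : D u -> exists2 K : R, 0 <= K &
  ev (fun h => D (u + h) /\ nX (G (u + h) - G u) <= K * N2 h).
Proof.
move=> Du; have [C C0 CP] := bounded_op_bound (DG_bounded Du).
exists (1 + C); first by rewrite addr_ge0.
apply: (small_ev_mono _ (DG_remainder Du ltr01)) => h sh [Dh hle]; split => //.
have [Xd dle] := CP h sh.
have Xr := proj1 (X_B oO bO al0 (proj1 (X_B oO bO al0 (state_X Dh) (state_X Du))) Xd).
have [_] := X_D oO bO al0 Xr Xd; rewrite subrK => le1.
apply: le_trans le1 _; rewrite mulrDl; exact: lerD.
Qed.

(** The added 1 leaves room for the states of nearby controls, so that a single [M] in the local
    bounds on the integrands serves all of them. *)
Definition state_radius u : R := nX (G u) + 1.

Lemma state_radius_gt0 u : 0 < state_radius u.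
Proof. by rewrite ltr_wpDl// X_norm_ge0. Qed.

Lemma state_le_radius u x : D u -> Omega x -> `|G u x| <= state_radius u.
Proof.
move=> Du Ox; have [_ hGu] := state_X Du.
by apply: le_trans (norm_le_holder bO al0 hGu Ox) _; rewrite lerDl.
Qed.

Lemma state_local u : D u -> exists2 K : R, 0 <= K & ev (fun h =>
  [/\ D (u + h), nX (G (u + h) - G u) <= K * N2 h & forall x, Omega x ->
    `|G (u + h) x| <= state_radius u /\ `|G (u + h) x - G u x| <= K * N2 h]).
Proof.
move=> Du; have [K K0 KP] := state_lipschitz Du; exists K => //.
(* Requiring [K * N2 h <= 1] keeps the perturbed state within [state_radius u]. *)
apply: (small_ev_mono _ (small_ev_and KP (small_ev_le Omega K0 ltr01))) => h sh [[Dh hle] h1].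
split => // x Ox.
have [_ hd] := proj1 (X_B oO bO al0 (state_X Dh) (state_X Du)).
have le1 : `|G (u + h) x - G u x| <= K * N2 h.
  exact: le_trans (norm_le_holder bO al0 hd Ox) hle.
split => //; rewrite -[G (u + h) x](subrK (G u x)); apply: le_trans (ler_normD _ _) _.
rewrite /state_radius addrC; apply: lerD; last exact: le_trans le1 h1.
exact: (norm_le_holder bO al0 (proj2 (state_X Du)) Ox).
Qed.

Lemma DG_continuous u (e : R) : D u -> 0 < e ->
  ev (fun h => D (u + h) /\ forall v, sq v -> N2 v <= 1 -> nX (DG (u + h) v - DG u v) <= e).
Proof.
move=> Du e0; case: hG => _ _ _ cG.
have [dl dl0 dlP] := cG u Du e e0.
have hdl : ev (fun h => N2 h < dl) by exists dl.
apply: (small_ev_mono _ (small_ev_and (Dopen Du) hdl)) => h sh [Dh hlt]; split => // v sv v1.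
have hE : u + h - u = h by rewrite addrC addKr.
have hlt' : Lp_norm Omega 2%:E (u + h - u) < dl by rewrite hE (Lp_norm2E oO sh).
apply: le_trans (dlP (u + h) Dh hlt').
have [C _ CP] := bounded_op_bound (DG_bounded Du).
have [C' _ CP'] := bounded_op_bound (DG_bounded Dh).
(* A supremum dominates its members only if the set is bounded above; boundedness of both operators
   provides the bound. *)
apply: (@le_sup_bounded _ _ (`|C'| + `|C|)); last first.
  exists v => //; split; first exact/(Lp2P oO).
  by have : Lp_norm Omega 2%:E v <= 1 by rewrite (Lp_norm2E oO sv).
move=> _ [w [/(Lp2P oO) sw w1] <-].
have {}w1 : N2 w <= 1 by rewrite -(Lp_norm2E oO sw).
have [X1 le1] := CP' w sw; have [X2 le2] := CP w sw.
have [_ le3] := X_B oO bO al0 X1 X2.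
have bnd (k : R) : k * N2 w <= `|k|.
  apply: le_trans (ler_wpM2r (n2_ge0 mu _ w) (ler_norm k)) _.
  by rewrite ler_piMr.
exact: le_trans le3 (lerD (le_trans le1 (bnd C')) (le_trans le2 (bnd C))).
Qed.

(** * Superposition along the state map, for [P] the nonlinearity or the cost integrand *)

Section composition.
Variable P : 'rV[R]_d -> R -> R.
Hypotheses (cP : caratheodory_C2 Omega P) (uP : second_deriv_unif Omega P)
  (bP : forall M : R, 0 < M -> exists C : R, aeO Omega (fun x =>
     forall t, `|t| <= M -> `|derive1n 2 (P x) t| <= C)).

Lemma derive_state_measurable u : D u ->
  measurable_fun (Omega : set lebT) (fun x : lebT => derive1 (P x) (G u x)) /\
  measurable_fun (Omega : set lebT) (fun x : lebT => derive1n 2 (P x) (G u x)).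
Proof.
move=> Du; have [HG _] := state_X Du; have [mG _] := H1_sqint oO HG.
exact: (derive_comp_measurable oO cP mG).
Qed.

Lemma derive2_state_bounded u : D u -> exists2 C : R, 0 <= C &
  aeO Omega (fun x => `|derive1n 2 (P x) (G u x)| <= C).
Proof.
move=> Du; have [C CP] := bP (state_radius_gt0 u); exists `|C| => //.
apply: (aeO_mono _ CP) => x Ox xC; apply: le_trans (ler_norm C).
exact: xC _ (state_le_radius Du Ox).
Qed.

Lemma derive_state_lipschitz u : D u -> exists2 K : R, 0 <= K & ev (fun h =>
  aeO Omega (fun x => `|derive1 (P x) (G (u + h) x) - derive1 (P x) (G u x)| <= K * N2 h)).
Proof.
move=> Du; have [C CP] := bP (state_radius_gt0 u); have [K K0 KP] := state_local Du.
exists (`|C| * K); first by rewrite mulr_ge0.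
apply: (small_ev_mono _ KP) => h sh [_ _ hO].
apply: (aeO_mono _ (derive_lipschitz cP CP)) => x Ox xC; have [h1 h2] := hO x Ox.
apply: le_trans (xC _ _ (state_le_radius Du Ox) h1) _; rewrite -mulrA.
apply: le_trans (ler_wpM2r (normr_ge0 _) (ler_norm C)) (ler_wpM2l (normr_ge0 _) h2).
Qed.

Lemma derive2_state_continuous u (e : R) : D u -> 0 < e -> ev (fun h =>
  aeO Omega (fun x => `|derive1n 2 (P x) (G (u + h) x) - derive1n 2 (P x) (G u x)| <= e)).
Proof.
move=> Du e0; have [rho rho0 rhoP] := uP e0 (state_radius_gt0 u).
have [K K0 KP] := state_local Du.
apply: (small_ev_mono _ (small_ev_and KP (small_ev_le Omega K0 rho0))) => h sh [[_ _ hO] hr].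
apply: (aeO_mono _ rhoP) => x Ox xC; have [h1 h2] := hO x Ox.
exact: (xC _ _ h1 (state_le_radius Du Ox) (le_trans h2 hr)).
Qed.

Lemma derive_state_taylor u (e : R) : D u -> 0 < e -> ev (fun h => aeO Omega (fun x =>
  `|derive1 (P x) (G (u + h) x) - derive1 (P x) (G u x)
     - derive1n 2 (P x) (G u x) * (G (u + h) x - G u x)| <= e * N2 h)).
Proof.
move=> Du e0; have [K K0 KP] := state_local Du.
have K1 : 0 < K + 1 by rewrite ltr_wpDl.
have [rho rho0 rhoP] := derive_taylor cP uP (state_radius_gt0 u) (divr_gt0 e0 K1).
apply: (small_ev_mono _ (small_ev_and KP (small_ev_le Omega K0 rho0))) => h sh [[_ _ hO] hr].
apply: (aeO_mono _ rhoP) => x Ox xC; have [h1 h2] := hO x Ox.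
apply: le_trans (xC _ _ (state_le_radius Du Ox) h1 (le_trans h2 hr)) _.
apply: le_trans (ler_wpM2l (ltW (divr_gt0 e0 K1)) h2) _.
rewrite mulrA ler_wpM2r ?n2_ge0// mulrAC ler_pdivrMr// ler_wpM2l ?(ltW e0)// lerDl.
exact: ler01.
Qed.

End composition.

Variables (a L : 'rV[R]_d -> R -> R) (Phi : L2_space Omega -> SX).
Hypotheses (ca : caratheodory_C2 Omega a) (ua : second_deriv_unif Omega a)
  (ba : forall M : R, 0 < M -> exists C : R, aeO Omega (fun x =>
     forall t, `|t| <= M -> `|derive1 (a x) t| + `|derive1n 2 (a x) t| <= C)).
Hypotheses (cL : caratheodory_C2 Omega L) (uL : second_deriv_unif Omega L)
  (bL1 : forall M : R, 0 < M -> exists2 LM : 'rV[R]_d -> R, itg LM & aeO Omega (fun x =>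
     forall t, `|t| <= M -> `|derive1 (L x) t| <= LM x))
  (bL2 : forall M : R, 0 < M -> exists C : R, aeO Omega (fun x =>
     forall t, `|t| <= M -> `|derive1n 2 (L x) t| <= C)).

Let ba2 (M : R) : 0 < M -> exists C : R, aeO Omega (fun x =>
  forall t, `|t| <= M -> `|derive1n 2 (a x) t| <= C).
Proof.
move=> M0; have [C CP] := ba M0; exists C; apply: (aeO_mono _ CP) => x _ xC t tM.
by apply: le_trans (xC t tM); rewrite lerDr.
Qed.

Definition potential u x : R := derive1 (a x) (G u x) + u x.

Hypothesis adjoint_apriori : forall u, D u -> exists2 K : R, 0 <= K & forall w f,
  holder Omega al w -> sq f -> wsol Omega B (potential u) w f -> nX w <= K * N2 f.
Hypothesis hPhi : forall u, D u -> X (Phi u) /\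
  wsol Omega B (potential u) (Phi u) (fun x => derive1 (L x) (G u x)).

Lemma potential_sqint u : D u -> sq (potential u).
Proof.
move=> Du; have [C CP] := ba (state_radius_gt0 u).
have [m1 _] := derive_state_measurable ca Du.
have bnd : aeO Omega (fun x => `|derive1 (a x) (G u x)| <= C).
  apply: (aeO_mono _ CP) => x Ox xC; apply: le_trans (xC _ (state_le_radius Du Ox)).
  by rewrite lerDl.
exact: (sqintD mO (sqint_bounded mO Ofin m1 bnd) (Dsq Du)).
Qed.

Lemma potential_lipschitz u : D u -> exists2 K : R, 0 <= K & ev (fun h =>
  sq (fun x => potential (u + h) x - potential u x) /\
  N2 (fun x => potential (u + h) x - potential u x) <= K * N2 h).
Proof.
move=> Du; have [K K0 KP] := derive_state_lipschitz ca ba2 Du.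
exists (K * N1 + 1); first by rewrite addr_ge0 ?mulr_ge0 ?n2_ge0.
apply: (small_ev_mono _ (small_ev_and (Dopen Du) KP)) => h sh [Dh le1].
split; first exact: (sqintB mO (potential_sqint Dh) (potential_sqint Du)).
have [m1 _] := derive_state_measurable ca Du; have [m2 _] := derive_state_measurable ca Dh.
have h0 := n2_ge0 mu (Omega : set lebT) h.
have [s1 n1] := sq_ae_bounded oO bO (mulr_ge0 K0 h0) (measurable_funB m2 m1) le1.
rewrite (_ : N2 _ = N2 (fun x =>
  (derive1 (a x) (G (u + h) x) - derive1 (a x) (G u x)) + h x)); last first.
  apply: eq_n2 => x _; rewrite /potential.
  rewrite (_ : (u + h) x = u x + h x)//; ring.
apply: le_trans (n2D mO s1 sh) _; rewrite mulrDl mul1r lerD2r.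
by apply: le_trans n1 _; rewrite mulrAC.
Qed.

(** For [p] close to 1 the L4 embedding does not pair [dL/dy] with all of H1; integrability is read
    off the equation that [Phi u] solves. *)
Lemma cost_derivative_integrable u v : D u -> H1 Omega v ->
  itg (fun x => derive1 (L x) (G u x) * v x).
Proof.
move=> Du Hv; have [LM iLM LMP] := bL1 (state_radius_gt0 u).
have [m1 _] := derive_state_measurable cL Du; have [_ W] := hPhi Du.
have i1 : itg (fun x => derive1 (L x) (G u x)).
  apply: (ae_le_integrable mO m1 iLM).
  by apply: (aeO_mono _ LMP) => x Ox xL; exact: xL _ (state_le_radius Du Ox).
exact: (source_integrable oO bO bB hemb (potential_sqint Du) i1 W Hv).
Qed.

(** Source of the equation, with the coefficient frozen at [u], for the increment of the adjoint
    state. The possibly non-square-integrable values of [dL/dy] enter only through their difference,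
    which is bounded for small [h]. *)
Definition adjoint_increment u h x : R :=
  derive1 (L x) (G (u + h) x) - derive1 (L x) (G u x)
    - (potential (u + h) x - potential u x) * Phi (u + h) x.

Lemma adjoint_incrementP u h : D u -> D (u + h) ->
  wsol Omega B (potential u) (Phi (u + h) - Phi u) (adjoint_increment u h).
Proof.
move=> Du Dh; have [Xh Wh] := hPhi Dh; have [Xu Wu] := hPhi Du.
have sc := potential_sqint Du; have sc' := potential_sqint Dh.
have fi' v := @cost_derivative_integrable _ v Dh; have fi v := @cost_derivative_integrable _ v Du.
have W1 := wsol_shift oO bO hemb al0 sc sc' Xh fi' Wh.
have [sd _] := mul_holder oO bO al0 Xh (sqintB mO sc' sc).
have fi1 v (Hv : H1 Omega v) : itg (fun x => (derive1 (L x) (G (u + h) x) -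
    (potential (u + h) x - potential u x) * Phi (u + h) x) * v x).
  apply: eq_integrable (integrableB_EFin mO (fi' v Hv) (itg_source oO sd Hv)) => // x _ /=.
  by congr (_%:E); ring.
have W2 := wsol_sub oO bO bB hemb sc fi1 fi W1 Wu.
by apply: (eq_wsol _ W2) => x _; rewrite /adjoint_increment addrAC.
Qed.

Lemma adjoint_X u : D u -> X (Phi u). Proof. by case/hPhi. Qed.

Lemma cost_derivative_lipschitz u : D u -> exists2 K : R, 0 <= K & ev (fun h =>
  sq (fun x => derive1 (L x) (G (u + h) x) - derive1 (L x) (G u x)) /\
  N2 (fun x => derive1 (L x) (G (u + h) x) - derive1 (L x) (G u x)) <= K * N2 h).
Proof.
move=> Du; have [K K0 KP] := derive_state_lipschitz cL bL2 Du.
exists (K * N1); first by rewrite mulr_ge0 ?n2_ge0.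
apply: (small_ev_mono _ (small_ev_and (Dopen Du) KP)) => h sh [Dh le1].
have [m1 _] := derive_state_measurable cL Du; have [m2 _] := derive_state_measurable cL Dh.
have h0 := n2_ge0 mu (Omega : set lebT) h.
have [s1 n1] := sq_ae_bounded oO bO (mulr_ge0 K0 h0) (measurable_funB m2 m1) le1.
by split => //; apply: le_trans n1 _; rewrite mulrAC.
Qed.

(** The source contains the perturbed adjoint state, whose norm is at most that of [Phi u] plus that
    of the increment being estimated; for small [h] the latter is absorbed. *)
Lemma adjoint_lipschitz u : D u -> exists2 K : R, 0 <= K & ev (fun h =>
  [/\ D (u + h), nX (Phi (u + h) - Phi u) <= K * N2 h & sq (adjoint_increment u h)]).
Proof.
move=> Du; have [K K0 KP] := adjoint_apriori Du.
have [Kc Kc0 KcP] := potential_lipschitz Du.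
have [KL KL0 KLP] := cost_derivative_lipschitz Du.
have half0 : 0 < 2^-1 :> R by rewrite invr_gt0.
exists (2 * (K * (KL + nX (Phi u) * Kc))).
  by rewrite !mulr_ge0// addr_ge0// mulr_ge0// X_norm_ge0.
apply: (small_ev_mono _ (small_ev_and (small_ev_and (Dopen Du) KcP)
  (small_ev_and KLP (small_ev_le Omega (mulr_ge0 K0 Kc0) half0)))) => h sh.
move=> [[Dh [sc nc]] [[sL nL] hs]].
have Xu := adjoint_X Du; have Xh := adjoint_X Dh.
have [sm nm] := mul_holder oO bO al0 Xh sc.
have sF : sq (adjoint_increment u h) := sqintB mO sL sm.
have [Xd _] := X_B oO bO al0 Xh Xu.
have le1 := KP _ _ (proj2 Xd) sF (adjoint_incrementP Du Dh).
have le2 := n2B mO sL sm.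
have [_] := X_D oO bO al0 Xu Xd; rewrite (addrC (Phi u)) subrK => le3.
split => //.
exact: (absorb_le K0 Kc0 (X_norm_ge0 Omega al _) (n2_ge0 mu (Omega : set lebT) h)
  (X_norm_ge0 Omega al _) le1 le2 le3 nm nc nL hs).
Qed.

Definition adjoint_weight u x : R :=
  derive1n 2 (L x) (G u x) - Phi u x * derive1n 2 (a x) (G u x).

Definition adjoint_rhs u v x : R := adjoint_weight u x * DG u v x - v x * Phi u x.

Lemma adjoint_weight_bounded u : D u ->
  measurable_fun (Omega : set lebT) (adjoint_weight u : lebT -> R) /\
  exists2 C : R, 0 <= C & aeO Omega (fun x => `|adjoint_weight u x| <= C).
Proof.
move=> Du; have [Ca Ca0 CaP] := derive2_state_bounded ba2 Du.
have [CL CL0 CLP] := derive2_state_bounded bL2 Du.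
have [_ m1] := derive_state_measurable ca Du; have [_ m2] := derive_state_measurable cL Du.
have [HP hP] := adjoint_X Du; have [m3 _] := H1_sqint oO HP.
split; first exact: (measurable_funB m2 (measurable_funM m3 m1)).
exists (CL + nX (Phi u) * Ca); first by rewrite addr_ge0// mulr_ge0// X_norm_ge0.
apply: (aeO_mono _ (aeO_and CaP CLP)) => x Ox [xa xL].
apply: le_trans (ler_normB _ _) _; rewrite normrM; apply: lerD => //.
by apply: ler_pM => //; exact: (norm_le_holder bO al0 hP Ox).
Qed.

Lemma adjoint_weight_mul u : D u -> exists2 C : R, 0 <= C & forall w, sq w ->
  sq (fun x => adjoint_weight u x * w x) /\
  N2 (fun x => adjoint_weight u x * w x) <= C * N2 w.
Proof.
move=> Du; have [m [C C0 CP]] := adjoint_weight_bounded Du.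
exists C; first exact: C0.
by move=> w sw; exact: (sqint_bounded_mul mO Ofin C0 m CP sw).
Qed.

Lemma adjoint_rhs_bound u : D u -> exists2 C : R, 0 <= C &
  forall v, sq v -> sq (adjoint_rhs u v) /\ N2 (adjoint_rhs u v) <= C * N2 v.
Proof.
move=> Du; have [C C0 CP] := adjoint_weight_mul Du.
have [K K0 KP] := bounded_op_bound (DG_bounded Du).
exists (C * K + nX (Phi u)); first by rewrite addr_ge0 ?mulr_ge0 ?X_norm_ge0.
move=> v sv; have [Xd nd] := KP v sv; have sd := H1_sqint oO (proj1 Xd).
have [s1 n1] := CP _ sd; have [s2 n2] := mul_holder oO bO al0 (adjoint_X Du) sv.
split; first exact: (sqintB mO s1 s2).
apply: le_trans (n2B mO s1 s2) _; rewrite mulrDl; apply: lerD => //.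
apply: le_trans n1 _; rewrite -mulrA ler_wpM2l//; apply: le_trans nd.
apply: le_trans (N2_le_H1_norm oO (proj1 Xd)) _.
by rewrite lerDl holder_norm_ge0.
Qed.

Lemma N2_le_X w : X w -> N2 w <= nX w.
Proof.
move=> [Hw _]; apply: le_trans (N2_le_H1_norm oO Hw) _.
by rewrite lerDl holder_norm_ge0.
Qed.

Lemma DG_X u v : D u -> sq v -> X (DG u v).
Proof. by move=> Du sv; have [C _ /(_ v sv)[]] := bounded_op_bound (DG_bounded Du). Qed.

(** [DG u] is linear only up to seminorm zero, so linearity of the right-hand side is an identity of
    L2 norms and not a pointwise one. *)
Lemma adjoint_rhs_lin u (k : R) v w : D u -> sq v -> sq w ->
  N2 (fun x => adjoint_rhs u (k *: v + w) x - (k * adjoint_rhs u v x + adjoint_rhs u w x)) = 0.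
Proof.
move=> Du sv sw; have [C C0 CP] := adjoint_weight_mul Du.
have skw : sq (k *: v + w) := sqintD mO (sqintZ mO k sv) sw.
have X1 := DG_X Du skw; have [X2 _] := X_lin oO bO al0 k (DG_X Du sv) (DG_X Du sw).
have [X3 _] := X_B oO bO al0 X1 X2.
have E := X_norm_lin k (DG_bounded Du) sv sw.
have [_ le1] := CP _ (H1_sqint oO (proj1 X3)).
have le2 := N2_le_X X3; rewrite E in le2.
apply: le_anti; rewrite n2_ge0 andbT.
apply: (@le_trans _ _ (C * 0)); last by rewrite mulr0.
apply: le_trans (ler_wpM2l C0 le2); apply: le_trans le1.
rewrite le_eqVlt; apply/orP; left; apply/eqP; apply: eq_n2 => x _.
rewrite /adjoint_rhs (_ : (DG u (k *: v + w) - (k *: DG u v + DG u w)) x =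
  DG u (k *: v + w) x - (k * DG u v x + DG u w x))// scaleD_funE.
by ring.
Qed.

(* With T_P the Taylor remainder of dP/dy between the two states and r that of
   G, the difference is T_L - Phi T_a + (adjoint weight) r - (potential
   increment) (adjoint state increment). *)
Lemma adjoint_increment_remainder u (e : R) : D u -> 0 < e -> ev (fun h =>
  [/\ D (u + h), sq (adjoint_increment u h) &
    N2 (fun x => adjoint_increment u h x - adjoint_rhs u h x) <= e * N2 h]).
Proof.
move=> Du e0; have [C C0 CP] := adjoint_weight_mul Du.
have [K K0 KP] := adjoint_lipschitz Du; have [Kc Kc0 KcP] := potential_lipschitz Du.
pose p := (1 + nX (Phi u)) * N1 + C.
have P0 := X_norm_ge0 Omega al (Phi u).
have p0 : 0 <= p by rewrite addr_ge0// mulr_ge0 ?n2_ge0// addr_ge0.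
have p1 : 0 < 2 * (p + 1) by rewrite mulr_gt0// ltr_wpDl.
pose e1 := e / (2 * (p + 1)); have e10 : 0 < e1 by rewrite divr_gt0.
have half0 : 0 < e / 2 by rewrite divr_gt0.
apply: (small_ev_mono _ (small_ev_and
  (small_ev_and (derive_state_taylor ca ua Du e10) (derive_state_taylor cL uL Du e10))
  (small_ev_and (small_ev_and KP KcP)
    (small_ev_and (DG_remainder Du e10) (small_ev_le Omega (mulr_ge0 K0 Kc0) half0))))) => h sh.
move=> [[Ta TL] [[[Dh hK sF] [sc nc]] [[_ hr] hs]]]; split => //.
have h0 := n2_ge0 mu (Omega : set lebT) h.
have [ma ma2] := derive_state_measurable ca Du; have [mL mL2] := derive_state_measurable cL Du.
have [ma' _] := derive_state_measurable ca Dh; have [mL' _] := derive_state_measurable cL Dh.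
have XG := state_X Du; have XG' := state_X Dh; have XP := adjoint_X Du.
have mG := proj1 (H1_sqint oO (proj1 XG)); have mG' := proj1 (H1_sqint oO (proj1 XG')).
have mP := proj1 (H1_sqint oO (proj1 XP)).
have [XdG _] := X_B oO bO al0 XG' XG; have [Xr _] := X_B oO bO al0 XdG (DG_X Du sh).
have [XdP _] := X_B oO bO al0 (adjoint_X Dh) XP.
have [s2 n2'] := CP _ (H1_sqint oO (proj1 Xr)).
have [s3 n3] := mul_holder oO bO al0 XdP sc.
pose T1 x := (derive1 (L x) (G (u + h) x) - derive1 (L x) (G u x)
     - derive1n 2 (L x) (G u x) * (G (u + h) x - G u x)) - Phi u x *
   (derive1 (a x) (G (u + h) x) - derive1 (a x) (G u x)
     - derive1n 2 (a x) (G u x) * (G (u + h) x - G u x)).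
have mT1 : measurable_fun (Omega : set lebT) (T1 : lebT -> R).
  exact: (measurable_funB
    (measurable_funB (measurable_funB mL' mL) (measurable_funM mL2 (measurable_funB mG' mG)))
    (measurable_funM mP (measurable_funB (measurable_funB ma' ma)
       (measurable_funM ma2 (measurable_funB mG' mG))))).
have c1 : 0 <= (1 + nX (Phi u)) * (e1 * N2 h).
  exact: mulr_ge0 (addr_ge0 ler01 P0) (mulr_ge0 (ltW e10) h0).
have bT1 : aeO Omega (fun x => `|T1 x| <= (1 + nX (Phi u)) * (e1 * N2 h)).
  apply: (aeO_mono _ (aeO_and Ta TL)) => x Ox [xa xL].
  apply: le_trans (ler_normB _ _) _; rewrite [leRHS]mulrDl mul1r; apply: (lerD xL).
  rewrite normrM.
  exact: (ler_pM (normr_ge0 _) (normr_ge0 _) (norm_le_holder bO al0 (proj2 XP) Ox) xa).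
have [s1 n1] := sq_ae_bounded oO bO c1 mT1 bT1.
have -> : N2 (fun x => adjoint_increment u h x - adjoint_rhs u h x) =
  N2 (fun x => T1 x + (adjoint_weight u x * (G (u + h) - G u - DG u h) x -
    (potential (u + h) x - potential u x) * (Phi (u + h) - Phi u) x)).
  apply: eq_n2 => x _.
  have E1 : (G (u + h) - G u - DG u h) x = G (u + h) x - G u x - DG u h x by [].
  have E2 : (Phi (u + h) - Phi u) x = Phi (u + h) x - Phi u x by [].
  have E3 : (u + h) x = u x + h x by [].
  rewrite E1 E2 /adjoint_increment /adjoint_rhs /T1 /adjoint_weight /potential E3.
  exact: increment_identity.
apply: le_trans (n2D mO s1 (sqintB mO s2 s3)) _.
apply: le_trans (lerD n1 (n2B mO s2 s3)) _.
have le2 := le_trans n2' (ler_wpM2l C0 (le_trans (N2_le_X Xr) hr)).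
have le3 := le_trans n3 (ler_pM (X_norm_ge0 Omega al _) (n2_ge0 mu (Omega : set lebT) _) hK nc).
apply: le_trans (lerD (lexx _) (lerD le2 le3)) _.
exact: (remainder_le e0 p0 h0 hs).
Qed.

Lemma wsolZ c (k : R) z f : sq c -> sq f -> wsol Omega B c z f ->
  wsol Omega B c (k *: z) (fun x => k * f x).
Proof.
(* [k z] is written as [(k - 1) z + z] to fit the shape [k z + z'] of [wsol_lin]. *)
move=> sc sf W; have := wsol_lin oO bO bB hemb (k - 1) sc sf sf W W.
rewrite -{2}(scale1r z) -scalerDl subrK; apply: eq_wsol => x _.
by rewrite mulrBl mul1r subrK.
Qed.

(** The remainder estimate at [h = t v], with [t = 1 / (n + 1)], divided by [t]. This turns the
    first-order expansion of the sources into L2 convergence of the difference quotients. *)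
Lemma adjoint_quotient u v (e : R) : D u -> sq v -> 0 < e ->
  exists N : nat, forall n, (N <= n)%N ->
  [/\ D (u + n.+1%:R^-1 *: v),
      sq (fun x => n.+1%:R * adjoint_increment u (n.+1%:R^-1 *: v) x) &
      N2 (fun x => n.+1%:R * adjoint_increment u (n.+1%:R^-1 *: v) x - adjoint_rhs u v x) <= e].
Proof.
move=> Du sv e0; have v0 := n2_ge0 mu (Omega : set lebT) v.
have v1 : 0 < N2 v + 1 by rewrite ltr_wpDl.
have [dl dl0 dlP] := adjoint_increment_remainder Du (divr_gt0 e0 v1).
(* For such [n] the perturbation [t v] has norm below [dl]. *)
exists (Num.bound (N2 v / dl)) => n Nn.
have n0 : 0 < n.+1%:R :> R by rewrite ltr0n.
set t := n.+1%:R^-1; have t0 : 0 < t by rewrite invr_gt0.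
have tn : t * n.+1%:R = 1 by rewrite mulVf ?gt_eqF.
have stv : sq (t *: v) := sqintZ mO t sv.
have ntv : N2 (t *: v) = t * N2 v.
  by have := n2Z mO t sv; rewrite (ger0_norm (ltW t0)).
have small : N2 (t *: v) < dl.
  rewrite ntv mulrC ltr_pdivrMr// mulrC -ltr_pdivrMr//.
  apply: lt_le_trans (archi_boundP (divr_ge0 v0 (ltW dl0))) _.
  by rewrite ler_nat (leq_trans Nn).
have [Dh sF nF] := dlP _ stv small; split; [exact: Dh|exact: (sqintZ mO _ sF)|].
have [C C0 CP] := adjoint_rhs_bound Du.
have [s1 _] := CP _ stv; have [s2 _] := CP _ sv.
have s0 : sq (fun=> 0) := sqint_cst mO Ofin 0; have [s3 _] := CP _ s0.
(* Homogeneity is obtained from [adjoint_rhs_lin] with second argument 0, which leaves this term; it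
   has norm zero but need not vanish pointwise. *)
have z0 : N2 (adjoint_rhs u (fun=> 0)) = 0.
  apply: le_anti; rewrite n2_ge0 andbT; have [_ le1] := CP _ s0.
  by apply: le_trans le1 _; rewrite (n2_cst mO Ofin (lexx 0)) mul0r mulr0.
have lin := adjoint_rhs_lin t Du sv s0.
rewrite (_ : t *: v + (fun=> 0) = t *: v) in lin; last by rewrite addr0.
have s4 := sqintB mO s1 (sqintD mO (sqintZ mO t s2) s3).
have s5 := sqintB mO sF s1.
have -> : N2 (fun x => n.+1%:R * adjoint_increment u (t *: v) x - adjoint_rhs u v x) =
  N2 (fun x => n.+1%:R * ((adjoint_increment u (t *: v) x - adjoint_rhs u (t *: v) x) +
    ((adjoint_rhs u (t *: v) x - (t * adjoint_rhs u v x + adjoint_rhs u (fun=> 0) x)) +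
      adjoint_rhs u (fun=> 0) x))).
  by apply: eq_n2 => x _; apply: quotient_identity; rewrite mulrC.
rewrite (n2Z mO _ (sqintD mO s5 (sqintD mO s4 s3))) (ger0_norm (ltW n0)).
have le1 := n2D mO s5 (sqintD mO s4 s3).
have le2 := n2D mO s4 s3; rewrite lin z0 addr0 in le2.
have le3 := le_trans le1 (lerD nF le2).
apply: le_trans (ler_wpM2l (ltW n0) le3) _; rewrite addr0 ntv.
by apply: quotient_le => //; rewrite mulrC.
Qed.

Lemma adjoint_derivative_exists u v : D u -> sq v ->
  exists2 z, X z & wsol Omega B (potential u) z (adjoint_rhs u v).
Proof.
move=> Du sv; have [K K0 KP] := adjoint_apriori Du.
have sc := potential_sqint Du.
have [C C0 CP] := adjoint_rhs_bound Du; have [sS _] := CP v sv.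
have [N NP] := adjoint_quotient Du sv ltr01.
(* The shift by [N] puts every perturbed control in [D]. *)
pose m n := (N + n)%N; pose h n := (m n).+1%:R^-1 *: v.
have Nm n : (N <= m n)%N by exact: leq_addr.
have Dm n : D (u + h n) by have [] := NP _ (Nm n).
have sF n : sq (adjoint_increment u (h n)).
  have [_ s _] := NP _ (Nm n).
  apply: (eq_sqint mO _ (sqintZ mO (m n).+1%:R^-1 s)) => x _.
  by rewrite mulKf.
apply: (wsol_limit oO bO bB hemb al0 sc K0 KP
  (zn := fun n => (m n).+1%:R *: (Phi (u + h n) - Phi u))
  (fn := fun n x => (m n).+1%:R * adjoint_increment u (h n) x)).
- move=> n; have [Xd _] := X_B oO bO al0 (adjoint_X (Dm n)) (adjoint_X Du).
  have [+ _] := X_lin oO bO al0 ((m n).+1%:R - 1) Xd Xd.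
  by rewrite -{2}(scale1r (Phi (u + h n) - Phi u)) -scalerDl subrK.
- by move=> n; exact: (sqintZ mO _ (sF n)).
- exact: sS.
- by move=> n; exact: (wsolZ _ sc (sF n) (adjoint_incrementP Du (Dm n))).
- move=> e e0; have [M MP] := adjoint_quotient Du sv e0; exists M => n Mn.
  by have [] := MP (m n) (leq_trans Mn (leq_addl _ _)).
Qed.

(** Any choice will do: two solutions in the space differ by a solution with source 0, of norm zero
    by the a priori estimate. *)
Definition adjoint_derivative u : Lop (L2_space Omega) SX := fun v =>
  get [set z | X z /\ wsol Omega B (potential u) z (adjoint_rhs u v)].

Lemma adjoint_derivativeP u v : D u -> sq v -> X (adjoint_derivative u v) /\
  wsol Omega B (potential u) (adjoint_derivative u v) (adjoint_rhs u v).
Proof.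
move=> Du sv; have [z Xz Wz] := adjoint_derivative_exists Du sv.
apply: (getPex (P := [set z | X z /\ wsol Omega B (potential u) z (adjoint_rhs u v)])).
by exists z.
Qed.

Lemma adjoint_derivative_bound u : D u -> exists2 C : R, 0 <= C &
  forall v, sq v -> nX (adjoint_derivative u v) <= C * N2 v.
Proof.
move=> Du; have [K K0 KP] := adjoint_apriori Du.
have [C C0 CP] := adjoint_rhs_bound Du; exists (K * C); first exact: mulr_ge0.
move=> v sv; have [[_ hd] W] := adjoint_derivativeP Du sv; have [sS nS] := CP v sv.
by apply: le_trans (KP _ _ hd sS W) _; rewrite -mulrA ler_wpM2l.
Qed.

Lemma adjoint_derivative_lin u (k : R) v w : D u -> sq v -> sq w ->
  nX (adjoint_derivative u (k *: v + w) -
      (k *: adjoint_derivative u v + adjoint_derivative u w)) = 0.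
Proof.
move=> Du sv sw; have [K K0 KP] := adjoint_apriori Du; have sc := potential_sqint Du.
have [C C0 CP] := adjoint_rhs_bound Du.
have skw : sq (k *: v + w) := sqintD mO (sqintZ mO k sv) sw.
have [s1 _] := CP _ skw; have [s2 _] := CP _ sv; have [s3 _] := CP _ sw.
have [X1 W1] := adjoint_derivativeP Du skw.
have [X2 W2] := adjoint_derivativeP Du sv; have [X3 W3] := adjoint_derivativeP Du sw.
have [X4 _] := X_lin oO bO al0 k X2 X3; have [[_ hd] _] := X_B oO bO al0 X1 X4.
have W4 := wsol_lin oO bO bB hemb k sc s2 s3 W2 W3.
have s4 := sqintD mO (sqintZ mO k s2) s3.
have W5 := wsol_sub oO bO bB hemb sc (fun v Hv => itg_source oO s1 Hv)
  (fun v Hv => itg_source oO s4 Hv) W1 W4.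
have := KP _ _ hd (sqintB mO s1 s4) W5; rewrite (adjoint_rhs_lin k Du sv sw) mulr0 => le0.
by apply: le_anti; rewrite le0 X_norm_ge0.
Qed.

Lemma adjoint_derivative_bounded u : D u -> bounded_op (adjoint_derivative u).
Proof.
move=> Du; split.
- by move=> v /(Lp2P oO) sv; have [Xz _] := adjoint_derivativeP Du sv; exact: Xz.
- by move=> k v w /(Lp2P oO) sv /(Lp2P oO) sw; exact: (adjoint_derivative_lin k Du sv sw).
- have [C _ CP] := adjoint_derivative_bound Du; exists C => v /(Lp2P oO) sv.
  have := CP v sv; rewrite -(Lp_norm2E oO sv); exact: (fun x => x).
Qed.

Lemma adjoint_frechet u (e : R) : D u -> 0 < e -> ev (fun h =>
  nX (Phi (u + h) - Phi u - adjoint_derivative u h) <= e * N2 h).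
Proof.
move=> Du e0; have [K K0 KP] := adjoint_apriori Du; have sc := potential_sqint Du.
have K1 : 0 < K + 1 by rewrite ltr_wpDl.
have [C C0 CP] := adjoint_rhs_bound Du.
apply: (small_ev_mono _ (adjoint_increment_remainder Du (divr_gt0 e0 K1))) => h sh.
move=> [Dh sF nF]; have [sS _] := CP h sh; have [X1 W1] := adjoint_derivativeP Du sh.
have [X2 _] := X_B oO bO al0 (adjoint_X Dh) (adjoint_X Du).
have [[_ hd] _] := X_B oO bO al0 X2 X1.
have W := wsol_sub oO bO bB hemb sc (fun v Hv => itg_source oO sF Hv)
  (fun v Hv => itg_source oO sS Hv) (adjoint_incrementP Du Dh) W1.
apply: le_trans (KP _ _ hd (sqintB mO sF sS) W) _.
apply: le_trans (ler_wpM2l K0 nF) _; rewrite mulrA ler_wpM2r ?n2_ge0//.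
by rewrite mulrCA ler_piMr ?(ltW e0)// ler_pdivrMr// mul1r lerDl.
Qed.

Lemma adjoint_weight_continuous u (e : R) : D u -> 0 < e -> ev (fun h =>
  D (u + h) /\ forall w, sq w ->
  sq (fun x => (adjoint_weight (u + h) x - adjoint_weight u x) * w x) /\
  N2 (fun x => (adjoint_weight (u + h) x - adjoint_weight u x) * w x) <= e * N2 w).
Proof.
move=> Du e0; have [Ca Ca0 CaP] := derive2_state_bounded ba2 Du.
have [K K0 KP] := adjoint_lipschitz Du.
have P0 := X_norm_ge0 Omega al (Phi u).
pose e1 := e / (nX (Phi u) + 2 + Ca).
have q0 : 0 < nX (Phi u) + 2 + Ca by rewrite ltr_wpDr// ltr_wpDl.
have e10 : 0 < e1 by rewrite divr_gt0.
apply: (small_ev_mono _ (small_ev_and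
  (small_ev_and (derive2_state_continuous ua Du e10) (derive2_state_continuous uL Du e10))
  (small_ev_and KP (small_ev_and (small_ev_le Omega K0 e10) (small_ev_le Omega K0 ltr01))))) => h sh.
move=> [[da dL] [[Dh hK _] [h1 h2]]]; split; first exact: Dh.
move=> w sw; have [m _] := adjoint_weight_bounded Du; have [m' _] := adjoint_weight_bounded Dh.
refine (sqint_bounded_mul mO Ofin (ltW e0) (measurable_funB m' m) _ sw).
have XP := adjoint_X Du; have XP' := adjoint_X Dh.
have [XdP _] := X_B oO bO al0 XP' XP.
apply: (aeO_mono _ (aeO_and CaP (aeO_and da dL))) => x Ox [xC [xa xL]].
have nd := le_trans (norm_le_holder bO al0 (proj2 XdP) Ox) hK.
have nP := norm_le_holder bO al0 (proj2 XP) Ox.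
exact: (weight_le q0 xC xa xL nP (le_trans nd h1) (le_trans nd h2)).
Qed.

Lemma adjoint_rhs_continuous u (e : R) : D u -> 0 < e -> ev (fun h =>
  D (u + h) /\ forall v, sq v -> N2 v <= 1 ->
  N2 (fun x => adjoint_rhs (u + h) v x - adjoint_rhs u v x) <= e).
Proof.
move=> Du e0; have [C C0 CP] := adjoint_weight_mul Du.
have [Cg Cg0 CgP] := bounded_op_bound (DG_bounded Du).
have [K K0 KP] := adjoint_lipschitz Du.
have q0 : 0 < C + Cg + 2 by rewrite ltr_wpDl// addr_ge0.
pose e1 := e / (C + Cg + 2); have e10 : 0 < e1 by rewrite divr_gt0.
apply: (small_ev_mono _ (small_ev_and
  (small_ev_and (DG_continuous Du e10) (DG_continuous Du ltr01))
  (small_ev_and (small_ev_and KP (small_ev_le Omega K0 e10))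
     (adjoint_weight_continuous Du e10)))) => h sh.
move=> [[[Dh g1] [_ g2]] [[[_ hK _] hs] [_ hW]]]; split; first exact: Dh.
move=> v sv v1; have [Xg ng] := CgP v sv; have Xg' := DG_X Dh sv.
have [Xd _] := X_B oO bO al0 Xg' Xg; have [XdP _] := X_B oO bO al0 (adjoint_X Dh) (adjoint_X Du).
have [s1 n1] := CP _ (H1_sqint oO (proj1 Xd)).
have [s2 n2'] := hW _ (H1_sqint oO (proj1 Xg')).
have [s3 n3] := mul_holder oO bO al0 XdP sv.
have [_] := X_D oO bO al0 Xg Xd; rewrite (addrC (DG u v)) subrK => ng'.
have -> : N2 (fun x => adjoint_rhs (u + h) v x - adjoint_rhs u v x) =
  N2 (fun x => adjoint_weight u x * (DG (u + h) v - DG u v) x +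
   ((adjoint_weight (u + h) x - adjoint_weight u x) * DG (u + h) v x -
    v x * (Phi (u + h) - Phi u) x)).
  apply: eq_n2 => x _; exact: rhs_identity.
apply: le_trans (n2D mO s1 (sqintB mO s2 s3)) _.
apply: le_trans (lerD (lexx _) (n2B mO s2 s3)) _.
apply: (rhs_le C0 Cg0 q0 e0 (n2_ge0 mu (Omega : set lebT) v) v1 n1 n2' n3).
- exact: le_trans (N2_le_X Xd) (g1 v sv v1).
- exact: le_trans (N2_le_X Xg') (le_trans ng' (lerD ng (g2 v sv v1))).
- exact: le_trans hK hs.
Qed.

(** The solution at [u + h] is rewritten with the coefficient at [u]; the extra source is small
    relative to that solution, whose norm is that at [u] plus the difference, and the difference is
    absorbed. *)
Lemma adjoint_derivative_continuous u (e : R) : D u -> 0 < e -> ev (fun h =>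
  forall v, sq v -> N2 v <= 1 ->
  nX (adjoint_derivative (u + h) v - adjoint_derivative u v) <= e).
Proof.
move=> Du e0; have [K K0 KP] := adjoint_apriori Du; have sc := potential_sqint Du.
have [E E0 EP] := adjoint_derivative_bound Du.
have [Kc Kc0 KcP] := potential_lipschitz Du.
have half0 : 0 < 2^-1 :> R by rewrite invr_gt0.
have q0 : 0 < 2 * (K * (1 + E)) + 1 by rewrite ltr_wpDl// !mulr_ge0// addr_ge0.
pose e1 := e / (2 * (K * (1 + E)) + 1); have e10 : 0 < e1 by rewrite divr_gt0.
apply: (small_ev_mono _ (small_ev_and
  (small_ev_and (adjoint_rhs_continuous Du e10) KcP)
  (small_ev_and (small_ev_le Omega Kc0 e10) (small_ev_le Omega (mulr_ge0 K0 Kc0) half0)))) => h sh.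
move=> [[[Dh hS] [_ nc]] [h1 h2]] v sv v1.
have sc' := potential_sqint Dh; have sd := sqintB mO sc' sc.
have [X1 W1] := adjoint_derivativeP Du sv; have [X2 W2] := adjoint_derivativeP Dh sv.
have [b1 _ CP1] := adjoint_rhs_bound Du; have [s1 _] := CP1 v sv.
have [b2 _ CP2] := adjoint_rhs_bound Dh; have [s2 _] := CP2 v sv.
have W3 := wsol_shift oO bO hemb al0 sc sc' X2 (fun w Hw => itg_source oO s2 Hw) W2.
have [s3 n3] := mul_holder oO bO al0 X2 sd.
have s23 := sqintB mO s2 s3.
have W4 := wsol_sub oO bO bB hemb sc (fun w Hw => itg_source oO s23 Hw)
  (fun w Hw => itg_source oO s1 Hw) W3 W1.
have [[_ hd] _] := X_B oO bO al0 X2 X1; have [Xd _] := X_B oO bO al0 X2 X1.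
have le1 := KP _ _ hd (sqintB mO s23 s1) W4.
have [_] := X_D oO bO al0 X1 Xd; rewrite (addrC (adjoint_derivative u v)) subrK => le2.
have le3 : N2 (fun x => adjoint_rhs (u + h) v x - (potential (u + h) x - potential u x) *
     adjoint_derivative (u + h) v x - adjoint_rhs u v x) <=
   N2 (fun x => adjoint_rhs (u + h) v x - adjoint_rhs u v x) +
   N2 (fun x => (potential (u + h) x - potential u x) * adjoint_derivative (u + h) v x).
  apply: le_trans (n2B mO (sqintB mO s2 s1) s3).
  by rewrite le_eqVlt; apply/orP; left; apply/eqP; apply: eq_n2 => x _; rewrite addrAC.
have le4 : nX (adjoint_derivative u v) <= E.
  by apply: le_trans (EP v sv) _; rewrite ler_piMr.
exact: (continuity_le K0 E0 q0 e0 (X_norm_ge0 Omega al _) (X_norm_ge0 Omega al _)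
  (mulr_ge0 Kc0 (n2_ge0 mu (Omega : set lebT) h)) le1 le2 le3 n3 le4 nc (hS v sv v1) h1 h2).
Qed.

Lemma adjoint_C1 : C1_on D Phi adjoint_derivative.
Proof.
split.
- by move=> u Du; have Xu := adjoint_X Du; exact: Xu.
- by move=> u Du; have bu := adjoint_derivative_bounded Du; exact: bu.
- move=> u Du e e0; have [dl dl0 dlP] := adjoint_frechet Du e0; exists dl => // h.
  move=> /(Lp2P oO) sh hlt Dh; have {}hlt : N2 h < dl by rewrite -(Lp_norm2E oO sh).
  have := dlP h sh hlt; rewrite -(Lp_norm2E oO sh); exact: (fun x => x).
- move=> u Du e e0; have [dl dl0 dlP] := adjoint_derivative_continuous Du e0.
  exists dl => // u' Du' hlt; pose h : 'rV[R]_d -> R := u' - u.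
  have sh : sq h := sqintB mO (Dsq Du') (Dsq Du).
  have {}hlt : N2 h < dl by rewrite -(Lp_norm2E oO sh).
  have uh : u + h = u' by rewrite addrC subrK.
  have := dlP h sh hlt; rewrite uh => hv.
  apply: (sup_le (ltW e0)) => _ [v [/(Lp2P oO) sv v1] <-].
  have {}v1 : N2 v <= 1 by rewrite -(Lp_norm2E oO sv).
  exact: (hv v sv v1).
Qed.

End sensitivity.

(** * Admissible controls *)

Section admissible_controls.
Variables (R : realType) (d : nat) (Omega : set 'rV[R]_d).
Hypotheses (oO : open Omega) (bO : bounded_set Omega).
Local Notation lebT := (caratheodory_type (leb_outer R d)).
Local Notation mu := (leb R d).
Local Notation sq := (@sqint _ lebT R mu (Omega : set lebT)).
Local Notation N2 := (@n2 _ lebT R mu (Omega : set lebT)).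
Implicit Types (f v w z u h : 'rV[R]_d -> R).
Variables (Lambda a0 C4 : R) (eps : ('rV[R]_d -> R) -> R).
Hypothesis C40 : 0 < C4.
Hypothesis heps : forall ubar, A0_set Omega a0 ubar -> 0 < eps ubar /\
  ((eps ubar)%:E < Lambda_u Omega Lambda a0 ubar * (C4 ^- 2)%:E)%E.
Local Notation D := (A_set Omega a0 eps).
Let mO := measurable_Omega oO.
Local Opaque n2 H1_norm holder_norm.

Lemma A_set_sqint u : D u -> sq u.
Proof. by move=> [ubar _ [/(Lp2P oO)]]. Qed.

Lemma A_set_open u : D u -> small_ev Omega (fun h => D (u + h)).
Proof.
move=> [ubar hub [/(Lp2P oO) su uub]]; have /(Lp2P oO) sub := proj1 hub.
have sd : sq (u - ubar) := sqintB mO su sub.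
rewrite (Lp_norm2E oO sd) in uub.
exists (eps ubar - N2 (u - ubar)); first by rewrite subr_gt0.
move=> h sh hlt; exists ubar; first exact: hub.
split; first by apply/(Lp2P oO); exact: (sqintD mO su sh).
have E : u + h - ubar = (u - ubar) + h by rewrite addrAC.
have sdh : sq ((u - ubar) + h) := sqintD mO sd sh.
rewrite E (Lp_norm2E oO sdh); apply: le_lt_trans (n2D mO sd sh) _.
by rewrite addrC -ltrBrDr.
Qed.

Lemma ess_infO_le f : aeO Omega (fun x => (ess_infO Omega f <= (f x)%:E)%E).
Proof.
apply: (ae_leb_mono _ (ess_inf_le mu (patch (fun=> +oo%E) Omega (EFin \o f)))) => x + Ox.
by rewrite /patch mem_set.
Qed.

(** Replaces the extended-real [Lambda_u] by a real number. An essential infimum [+oo] leaves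
    [Lambda] as the bound, and [-oo] is excluded by the positivity in [A0_set]. *)
Lemma A0_set_lower ubar : A0_set Omega a0 ubar -> 0 < Lambda -> exists lambda : R,
  [/\ lambda <= Lambda, aeO Omega (fun x => lambda <= a0 + ubar x) &
    eps ubar < lambda / C4 ^+ 2].
Proof.
move=> hub L0; have [e0 elt] := heps hub; have [_ pos] := hub.
have := ess_infO_le ubar; move: elt pos; rewrite /Lambda_u.
case: (ess_infO Omega ubar) => [m| |] elt pos mle //.
- exists (Order.min Lambda (a0 + m)); split; first by rewrite ge_min lexx.
    apply: (aeO_mono _ mle) => x _; rewrite lee_fin => mx.
    by rewrite ge_min lerD2l mx orbT.
  by move: elt; rewrite -EFinD -EFin_min -EFinM lte_fin.
- have minE : Order.min Lambda%:E +oo%E = Lambda%:E by apply/min_idPl; exact: leey.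
  exists Lambda; split => //; last by move: elt; rewrite addey// minE -EFinM lte_fin.
  by apply: (aeO_mono _ mle) => x _; rewrite leye_eq.
Qed.

(** The small part is [r = u - ubar], so that [c - r >= a0 + ubar]; the radius condition
    [eps ubar < lambda / C4 ^+ 2] is exactly positivity of the coercivity constant. *)
Lemma A_set_coercive (c : 'rV[R]_d -> R) u : D u -> 0 < Lambda ->
  aeO Omega (fun x => a0 + u x <= c x) ->
  exists lambda epsr r, [/\ lambda <= Lambda, sq r, aeO Omega (fun x => lambda <= c x - r x),
    N2 r <= epsr & 0 < lambda - epsr * C4 ^+ 2].
Proof.
move=> [ubar hub [/(Lp2P oO) su uub]] L0 hc; have /(Lp2P oO) sub := proj1 hub.
have [lambda [lL hl he]] := A0_set_lower hub L0.
have sd : sq (u - ubar) := sqintB mO su sub.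
rewrite (Lp_norm2E oO sd) in uub.
exists lambda, (eps ubar), (u - ubar); split; [exact: lL|exact: sd| |exact: ltW|].
  apply: (aeO_mono _ (aeO_and hc hl)) => x _ [cx lx].
  have E : (u - ubar) x = u x - ubar x by [].
  by rewrite E; move: cx lx; move: (c x) (u x) (ubar x) => r1 r2 r3; lra.
by rewrite subr_gt0 -ltr_pdivlMr// exprn_gt0.
Qed.

End admissible_controls.

(** A matrix and its transpose have the same quadratic form. *)
Lemma elliptic_coef_transp (R : realType) (d : nat) (Omega : set 'rV[R]_d)
    (A : 'rV[R]_d -> 'M[R]_d) (M Lambda : R) : elliptic_coef Omega A M Lambda ->
  aeO Omega (fun x => forall xi : 'rV[R]_d,
    Lambda * enorm xi ^+ 2 <= \sum_i \sum_j transp A x i j * xi 0 i * xi 0 j).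
Proof.
move=> [_ _ _ hA]; apply: (aeO_mono _ hA) => x _ xA xi.
have /andP[le1 _] := xA xi; apply: le_trans le1 _; rewrite exchange_big.
rewrite le_eqVlt; apply/orP; left; apply/eqP.
by apply: eq_bigr => i _; apply: eq_bigr => j _; rewrite mxE mulrAC.
Qed.

Lemma adjoint_solutionE (R : realType) (d : nat) (Omega : set 'rV[R]_d)
    (A : 'rV[R]_d -> 'M[R]_d) (a : 'rV[R]_d -> R -> R) (u y f z : 'rV[R]_d -> R) :
  adjoint_solution Omega A a u y f z <->
  wsol Omega (transp A) (fun x => derive1 (a x) (y x) + u x) z f.
Proof.
have E v : intO Omega (fun x => (derive1 (a x) (y x) * z x + u x * z x) * v x) =
    intO Omega (fun x => (derive1 (a x) (y x) + u x) * z x * v x).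
  by apply: eq_Rintegral => x _; rewrite -mulrDl.
rewrite /adjoint_solution weak_neumannE /wsol /cform.
by split=> -[Hz zP]; split => // v Hv; [rewrite -E|rewrite E]; exact: zP.
Qed.

Theorem theorem3p5 (R : realType) (d : nat) (hd : d = 2%N \/ d = 3%N)
  (Omega : set 'rV[R]_d) (hOmega : lipschitz_domain Omega)
  (A : 'rV[R]_d -> 'M[R]_d) (M_A Lambda_A : R)
  (hA : elliptic_coef Omega A M_A Lambda_A)
  (p q : \bar R) (hp : ((d%:R / 2)%:E < p)%E) (hq : ((d%:R - 1)%:E < q)%E)
  (a : 'rV[R]_d -> R -> R) (a0 : R) (ha : nonlinearity Omega p a0 a)
  (g : 'rV[R]_d -> R) (hg : LpG Omega q g)
  (L : 'rV[R]_d -> R -> R) (hL : cost_integrand Omega p L)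
  (mu : R) (hmu : 0 < mu <= 1)
  (hregA : holder_regularity Omega p q mu A)
  (hregAt : holder_regularity Omega p q mu (transp A))
  (C4 : R) (hC4 : 0 < C4) (hemb : L4_embedding Omega C4)
  (eps : ('rV[R]_d -> R) -> R)
  (heps : forall ubar, A0_set Omega a0 ubar ->
     0 < eps ubar /\
     ((eps ubar)%:E < Lambda_u Omega Lambda_A a0 ubar * (C4 ^- 2)%:E)%E)
  (G : L2_space Omega -> H1_holder_space Omega mu)
  (hGsol : forall u, A_set Omega a0 eps u ->
     state_solution Omega A a g u (G u) /\
     forall y, (H1 Omega `&` holder Omega mu) y ->
       state_solution Omega A a g u y -> forall x, closure Omega x -> y x = G u x)
  (DG : L2_space Omega -> Lop (L2_space Omega) (H1_holder_space Omega mu))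
  (hG : C2_on (A_set Omega a0 eps) G DG)
  (Phi : L2_space Omega -> H1_holder_space Omega mu)
  (hPhi : forall u, A_set Omega a0 eps u ->
     (H1 Omega `&` holder Omega mu) (Phi u) /\
     adjoint_solution Omega A a u (G u) (fun x => derive1 (L x) (G u x)) (Phi u)) :
  exists DPhi : L2_space Omega -> Lop (L2_space Omega) (H1_holder_space Omega mu),
    C1_on (A_set Omega a0 eps) Phi DPhi /\
    forall u v, A_set Omega a0 eps u -> Lp Omega 2%:E v ->
      let rhs := fun x =>
        (derive1n 2 (L x) (G u x) - Phi u x * derive1n 2 (a x) (G u x)) * DG u v x
        - v x * Phi u x in
      adjoint_solution Omega A a u (G u) rhs (DPhi u v) /\
      forall eta, adjoint_solution Omega A a u (G u) rhs eta ->
        aeO Omega (fun x => eta x = DPhi u v x).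
Proof.
have [_ oO bO _ _] := hOmega; have [al0 _] := andP hmu.
(* [d >= 2] gives [d / 2 >= 1]; then L^p functions are integrable on the bounded set [Omega]. *)
have p1 : (1 < p)%E.
  apply: le_lt_trans hp; rewrite lee_fin ler_pdivlMr// mul1r ler_nat.
  by case: hd => ->.
have q1 : (1 <= q)%E.
  apply: ltW; apply: le_lt_trans hq; rewrite lee_fin lerBrDr (ler_nat R 2 d).
  by case: hd => ->.
have mO := measurable_Omega oO; have Ofin := leb_Omega_lty bO.
have [bA _ L0 _] := hA.
have bB := bounded_coef_transp bA; have hB := elliptic_coef_transp hA.
have [ca _ [_ ha0] ba ua] := ha; have [cL _ bL1 bL2 uL] := hL.
have bL1' (M : R) : 0 < M -> exists2 LM : 'rV[R]_d -> R,
    (leb R d).-integrable (Omega : set (caratheodory_type (leb_outer R d))) (EFin \o LM) &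
    aeO Omega (fun x => forall t, `|t| <= M -> `|derive1 (L x) t| <= LM x).
  move=> M0; have [LM LMp LMP] := bL1 M M0; exists LM; last exact: LMP.
  exact: (Lfun_integrable1 mO Ofin p1 LMp).
have Dsq := @A_set_sqint R d Omega oO a0 eps.
have Dopen := @A_set_open R d Omega oO a0 eps.
have [hG1 _] := hG.
have sc u (Du : A_set Omega a0 eps u) := potential_sqint oO bO al0 Dsq hG1 ca ba Du.
have hc u : aeO Omega (fun x => a0 + u x <= potential G a u x).
  by apply: (aeO_mono _ ha0) => x _ xa; rewrite lerD2r.
have coer u (Du : A_set Omega a0 eps u) := A_set_coercive oO hC4 heps Du L0 (hc u).
have apri u : A_set Omega a0 eps u -> exists2 K : R, 0 <= K & forall w f,
    holder Omega mu w -> sqint (leb R d) (Omega : set (caratheodory_type (leb_outer R d))) f ->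
    wsol Omega (transp A) (potential G a u) w f -> H1_norm Omega w + holder_norm Omega mu w <=
      K * n2 (leb R d) (Omega : set (caratheodory_type (leb_outer R d))) f.
  move=> Du; have [lambda [epsr [r [lL sr hr nr kappa0]]]] := coer u Du.
  exact: (apriori_estimate hd oO bO bB hemb p1 q1 al0 hregAt hB (sc u Du) sr lL hr nr kappa0).
have hPhi' u : A_set Omega a0 eps u -> (H1 Omega `&` holder Omega mu) (Phi u) /\
    wsol Omega (transp A) (potential G a u) (Phi u) (fun x => derive1 (L x) (G u x)).
  by move=> Du; have [XP /adjoint_solutionE WP] := hPhi u Du; split; [exact: XP|exact: WP].
exists (adjoint_derivative (transp A) G DG a L Phi); split.
  exact: (adjoint_C1 oO bO bB hemb al0 Dsq Dopen hG1 ca ua ba cL uL bL1' bL2 apri hPhi').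
move=> u v Du /(Lp2P oO) sv rhs.
have [_ W] := adjoint_derivativeP oO bO bB hemb al0 Dsq Dopen hG1 ca ua ba cL uL bL1' bL2
  apri hPhi' Du sv.
have [C _ CP] := adjoint_rhs_bound oO bO al0 hG1 ca ba cL bL2 hPhi' Du.
split; first by apply/adjoint_solutionE; exact: W.
move=> eta /adjoint_solutionE Weta.
have [srhs _] := CP v sv.
(* The difference of the two solutions has source 0, so the energy estimate alone makes it vanish
   almost everywhere; [eta] is any H1 solution, not assumed Hoelder continuous. *)
have W0 := wsol_sub oO bO bB hemb (sc u Du) (fun w Hw => itg_source oO srhs Hw)
  (fun w Hw => itg_source oO srhs Hw) Weta W.
have [lambda [epsr [r [lL sr hr nr kappa0]]]] := coer u Du.
have le0 := energy_estimate oO bO bB hemb hB (sc u Du) sr lL hr nr (sqintB mO srhs srhs) W0.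
have [Hd _] := W0; have sd := H1_sqint oO Hd.
have n0 : n2 (leb R d) (Omega : set (caratheodory_type (leb_outer R d)))
    (eta - adjoint_derivative (transp A) G DG a L Phi u v) = 0.
  apply: le_anti; rewrite n2_ge0 andbT; apply: le_trans (N2_le_H1_norm oO Hd) _.
  rewrite -(pmulr_rle0 _ kappa0); apply: le_trans le0 _.
  rewrite (_ : n2 _ _ _ = n2 (leb R d) (Omega : set (caratheodory_type (leb_outer R d)))
    (fun=> 0)); first by rewrite (n2_cst mO Ofin (lexx 0)) mul0r.
  by apply: eq_n2 => x _; rewrite subrr.
have : aeO Omega (fun x => (eta - adjoint_derivative (transp A) G DG a L Phi u v) x = 0).
  exact: (n2_eq0 mO sd n0).
apply: aeO_mono => x _.
have -> : (eta - adjoint_derivative (transp A) G DG a L Phi u v) x =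
  eta x - adjoint_derivative (transp A) G DG a L Phi u v x by [].
by move/eqP; rewrite subr_eq0 => /eqP.
Qed.
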